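(* Two uniformly random elements of $\mathfrak{sl}_n(\mathbf{F}_q)$, with $(n,p)\neq(3,3),(4,2)$ where $p$ is the characteristic of $\mathbf{F}_q$, generate the Lie algebra $\mathfrak{sl}_n(\mathbf{F}_q)$ with probability $1-o(1)$ as $|\mathfrak{sl}_n(\mathbf{F}_q)|\to\infty$. Explicitly: for every $\varepsilon>0$ there is $K>0$ such that for every positive integer $n$ and every prime power $q$, a power of a prime $p$, with $(n,p)\notin\{(3,3),(4,2)\}$ and $|\mathfrak{sl}_n(\mathbf{F}_q)|\geq K$, if $A,B\in\mathfrak{sl}_n(\mathbf{F}_q)$ are independent and uniformly random, then the probability that $A$ and $B$ generate $\mathfrak{sl}_n(\mathbf{F}_q)$ as a Lie algebra over $\mathbf{F}_q$ is at least $1-\varepsilon$.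
   Context: $\mathbf{F}_q$ is the finite field with $q$ elements. $\mathfrak{sl}_n(\mathbf{F}_q)$ is the Lie algebra of $n\times n$ trace zero matrices over $\mathbf{F}_q$ with bracket $[X,Y]=XY-YX$. Elements generate a Lie algebra over $\mathbf{F}_q$ if the smallest $\mathbf{F}_q$-Lie subalgebra containing them is the whole algebra. *)

(* Defs.v *)
From HB Require Import structures.
From mathcomp Require Import all_boot all_order all_algebra.
From mathcomp Require Import reals.

Set Implicit Arguments.
Unset Strict Implicit.
Unset Printing Implicit Defensive.

Import Order.TTheory GRing.Theory Num.Theory.
Local Open Scope ring_scope.

Definition lie_bracket (F : finFieldType) (n : nat) (X Y : 'M[F]_n) : 'M[F]_n :=
  X *m Y - Y *m X.

Definition sl (n : nat) (F : finFieldType) : {set 'M[F]_n} :=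
  [set X | \tr X == 0].

Definition lie_subalgebra (F : finFieldType) (n : nat)
    (g L : {set 'M[F]_n}) : bool :=
  [&& L \subset g,
      0 \in L,
      [forall a : F, forall X in L, forall Y in L, a *: X + Y \in L] &
      [forall X in L, forall Y in L, lie_bracket X Y \in L]].

(* The smallest Lie subalgebra of g containing S; this is meaningful only for
   g a Lie algebra and S \subset g, since otherwise the intersection may be
   empty and thus be the whole of 'M[F]_n. *)
Definition lie_span (F : finFieldType) (n : nat)
    (g S : {set 'M[F]_n}) : {set 'M[F]_n} :=
  \bigcap_(L : {set 'M[F]_n} | lie_subalgebra g L && (S \subset L)) L.

Definition lie_generate (F : finFieldType) (n : nat)
    (g : {set 'M[F]_n}) (A B : 'M[F]_n) : bool :=
  lie_span g [set A; B] == g.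

Definition uniform_prob (R : realType) (T : finType) (Omega : {set T})
    (E : pred T) : R :=
  #|[set w in Omega | E w]|%:R / #|Omega|%:R.

(* Independent uniform elements A, B of g form a uniform element of g x g. *)
Definition prob_two_generate (R : realType) (F : finFieldType) (n : nat)
    (g : {set 'M[F]_n}) : R :=
  uniform_prob R (setX g g) (fun AB => lie_generate g AB.1 AB.2).

(* Main.v *)
(* Non-generating pairs are rare for two different reasons, depending on the rank n.

   Large n, any q. Work over an algebraic closure of F with Frobenius map phi. Most A have
   an eigenvalue l of large degree such that the differences of l, phi l, phi^2 l occur only
   once among the differences of eigenvalues. Let x_i and y_i be dual left and right
   eigenvectors for phi^i l and E_ij = y_i x_j. Multiplying ad A - c over all the other
   differences c kills every component of B except a combination of E_ij and E_ji, and
   brackets of these combinations separate the E_ij unless a cubic form in the numbers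
   x_i B y_j vanishes. Once the E_ij are available, irreducibility of (A, B) and of its
   transpose gives all trace zero matrices. To count the A, write A by means of the cyclic
   subspace of the first basis vector: the characteristic polynomial of A on it is then
   uniform among the monic ones with given trace.

   Bounded n, large q. Some pair (A0, B0) generates: take A0 diagonal with distinct
   differences of entries, and B0 with generic support. On a line
   (A0 + t C, B0 + t E) some minor of the matrix of Lie words is a nonzero polynomial in t
   of bounded degree, so that only boundedly many t give non-generating pairs. *)

Require Import Defs.
From HB Require Import structures.
From mathcomp Require Import all_boot all_order all_algebra all_field.
From mathcomp Require Import zify ring lra.
From mathcomp Require Import boolp reals.

Set Implicit Arguments.
Unset Strict Implicit.
Unset Printing Implicit Defensive.

Import Order.TTheory GRing.Theory Num.Theory.
Local Open Scope ring_scope.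

(** * Lie algebras over a field containing the eigenvalues *)

(** In characteristic 2 the differences l_i - l_j and l_j - l_i coincide, so [ad A] alone cannot
    separate E_ij from E_ji; the third index serves to produce, by a bracket, a second combination
    of the same two units. The three eigenvalues are Frobenius conjugate because irreducibility of
    (A, B) is known over F only: the units carry an eigenvector to its Frobenius conjugate, so the
    subspace that it generates over the closure is Frobenius stable and descends to F. The large
    degree of l makes many combinations of the entries of an eigenvector distinct, so that the cubic
    form seldom vanishes even for q = 2. For small q a random A often has repeated eigenvalues, so A
    is not assumed diagonalizable: three conjugate eigenvalues are simple, and the rest of the
    spectrum only must not reproduce their differences. The two regimes cover everything: for rank
    below a fixed bound, a large |sl_n| forces q to be large. *)

Lemma row_free_completion (K : fieldType) k m (U : 'M[K]_(k, k + m)) :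
  row_free U -> exists2 M : 'M_(k + m), M \in unitmx & usubmx M = U.
Proof.
move=> /eqP rU.
exists (block_mx (col_ebase U) 0 0 1%:M *m row_ebase U).
  rewrite unitmx_mul row_ebase_unit andbT unitmxE det_lblock det1 mulr1.
  by rewrite -unitmxE col_ebase_unit.
rewrite -mul_usub_mx block_mxEv col_mxKu -[RHS](mulmx_ebase U) rU.
by rewrite pid_mx_row mul_mx_row mulmx1 mulmx0.
Qed.

Lemma char_poly_conj (K : fieldType) n (M A : 'M[K]_n) :
  M \in unitmx -> char_poly (M *m A *m invmx M) = char_poly A.
Proof.
move=> uM; rewrite /char_poly /char_poly_mx !map_mxM.
have uM' : map_mx polyC M \in unitmx.
  by rewrite unitmxE det_map_mx rmorph_unit // -unitmxE.
have -> : map_mx polyC (invmx M) = invmx (map_mx polyC M).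
  by rewrite -[RHS]mul1mx -(map_mx1 polyC) -(mulVmx uM) map_mxM mulmxK.
have {1}-> : ('X%:M : 'M[{poly K}]_n) = map_mx polyC M *m 'X%:M *m invmx (map_mx polyC M).
  by rewrite scalar_mxC -mulmxA mulmxV // mulmx1.
rewrite -mulmxBl -mulmxBr !det_mulmx mulrC mulrA -det_mulmx mulVmx //.
by rewrite det1 mul1r.
Qed.

(** In a basis that starts with x, A is block lower triangular with diagonal blocks l and a matrix
    of characteristic polynomial g, which does not have the eigenvalue l; so an eigenvector for l
    has no component outside the line of x. *)
Lemma simple_root_eigenrow (K : fieldType) n (A : 'M[K]_n.+1) (l : K) (g : {poly K})
    (x w : 'rV_n.+1) :
  char_poly A = ('X - l%:P) * g -> g.[l] != 0 ->
  x != 0 -> x *m A = l *: x -> w *m A = l *: w -> exists c, w = c *: x.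
Proof.
rewrite -[n.+1]/(1 + n)%N in A x w *.
move=> chA gl x0 xA wA.
have [|M uM Mx] := @row_free_completion K 1 n x; first by rewrite /row_free rank_rV x0.
set B := M *m A *m invmx M.
have uB : usubmx B = l *: row_mx 1%:M 0.
  rewrite /B -mulmxA -mul_usub_mx Mx mulmxA xA -scalemxAl; congr (_ *: _).
  have: x *m invmx M = usubmx (1%:M : 'M_(1 + n)).
    by rewrite -(mulmxV uM) -mul_usub_mx Mx.
  by move->; rewrite (scalar_mx_block 1 n) block_mxEv col_mxKu.
have eB : B = block_mx l%:M 0 (dlsubmx B) (drsubmx B).
  rewrite -{1}[B]submxK /ulsubmx /ursubmx uB !linearZ /= row_mxKl row_mxKr.
  by rewrite scaler0 scalemx1.
have chB : char_poly B = char_poly A by rewrite /B char_poly_conj.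
have chB2 : char_poly B = ('X - l%:P) * char_poly (drsubmx B).
  rewrite {1}eB /char_poly /char_poly_mx (map_block_mx polyC) map_mx0.
  rewrite (scalar_mx_block 1 n) opp_block_mx add_block_mx oppr0 addr0 add0r.
  by rewrite det_lblock map_scalar_mx -raddfB det_scalar1.
have eg : char_poly (drsubmx B) = g.
  apply: (@mulfI _ ('X - l%:P)); first by rewrite polyXsubC_eq0.
  by rewrite -chB2 chB.
have nev : ~~ eigenvalue (drsubmx B) l by rewrite eigenvalue_root_char eg.
set w' : 'rV_(1 + n) := w *m invmx M.
have w'B : w' *m B = l *: w'.
  by rewrite /w' /B !mulmxA mulmxKV // wA -scalemxAl.
have r0 : rsubmx w' = 0.
  apply/eqP; apply: contraNT nev => r0; apply/eigenvalueP.
  exists (rsubmx w') => //.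
  have := congr1 rsubmx w'B; rewrite linearZ /= => <-.
  rewrite -{2}[w']hsubmxK -{2}[B]submxK mul_row_block row_mxKr.
  by rewrite {2}eB block_mxKur mulmx0 add0r.
exists (lsubmx w' 0 0).
rewrite -[w](mulmxKV uM) -/w' -{1}[w']hsubmxK r0.
rewrite -[M]vsubmxK Mx mul_row_col mul0mx addr0.
by rewrite {1}[lsubmx w']mx11_scalar mul_scalar_mx.
Qed.

Lemma char_poly_tr (R : comNzRingType) n (A : 'M[R]_n) : char_poly A^T = char_poly A.
Proof.
rewrite /char_poly -[RHS]det_tr; congr (\det _).
by rewrite /char_poly_mx linearB /= tr_scalar_mx map_trmx.
Qed.

Section EigenPair.
Variables (K : fieldType) (n : nat) (A : 'M[K]_n.+1).
Implicit Types (rs : seq K).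

Definition rprod rs : {poly K} := \prod_(r <- rs) ('X - r%:P).

Lemma rprod_cons r rs : rprod (r :: rs) = ('X - r%:P) * rprod rs.
Proof. by rewrite /rprod big_cons. Qed.

Lemma rprod_perm rs rs' : perm_eq rs rs' -> rprod rs = rprod rs'.
Proof. exact: perm_big. Qed.

Lemma rprod_eq0 rs l : ((rprod rs).[l] == 0) = (l \in rs).
Proof. by rewrite -[_ == 0]/(root _ l) /rprod root_prod_XsubC. Qed.

Lemma horner_mx_eigen_col (p : {poly K}) (l : K) (y : 'cV_n.+1) :
  A *m y = l *: y -> horner_mx A p *m y = p.[l] *: y.
Proof.
move=> Ay; elim/poly_ind: p => [|p c IH].
  by rewrite rmorph0 mul0mx horner0 scale0r.
rewrite rmorphD rmorphM /= horner_mx_X horner_mx_C mulmxDl -mulmxA Ay.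
by rewrite -scalemxAr IH mul_scalar_mx !hornerE scalerDl scalerA mulrC.
Qed.

Lemma horner_mx_eigen_row (p : {poly K}) (l : K) (x : 'rV_n.+1) :
  x *m A = l *: x -> x *m horner_mx A p = p.[l] *: x.
Proof.
move=> xA; elim/poly_ind: p => [|p c IH].
  by rewrite rmorph0 mulmx0 horner0 scale0r.
rewrite rmorphD rmorphM /= horner_mx_X horner_mx_C mulmxDr mulmxA IH.
by rewrite -scalemxAl xA mul_mx_scalar !hornerE scalerDl scalerA.
Qed.

Lemma rows_eigen (T : 'M[K]_n.+1) (l : K) (g : {poly K}) (x : 'rV_n.+1) :
  char_poly A = ('X - l%:P) * g -> g.[l] != 0 ->
  x != 0 -> x *m A = l *: x -> T *m A = l *: T -> exists z : 'cV_n.+1, T = z *m x.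
Proof.
move=> chA gl x0 xA TA.
have H i : exists c, row i T = c *: x.
  apply: (simple_root_eigenrow chA gl x0 xA).
  by rewrite -row_mul TA linearZ.
pose c i := sval (cid (H i)).
exists (\col_i c i); apply/row_matrixP => i.
rewrite (svalP (cid (H i))) -/(c i) row_mul.
by apply/rowP=> j; rewrite !mxE big_ord1 !mxE.
Qed.

Lemma root_prod_mx rs l rs' : char_poly A = rprod rs -> perm_eq rs (l :: rs') ->
  let T := horner_mx A (rprod rs') in T *m A = l *: T /\ A *m T = l *: T.
Proof.
move=> chA pe T; have /eqP := Cayley_Hamilton A.
rewrite chA (rprod_perm pe) rprod_cons rmorphM /= -/T linearB /= horner_mx_X horner_mx_C.
have cT : GRing.comm (A - l%:M) T.
  by rewrite -(horner_mx_C A l) -{1}(horner_mx_X A) -linearB /=; apply: comm_horner_mx2.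
move=> h; have := h; rewrite cT !mulmxE.
rewrite mulrBr -!mulmxE mul_mx_scalar subr_eq0 => /eqP ->; split=> //.
by move: h; rewrite mulrBl -!mulmxE mul_scalar_mx subr_eq0 => /eqP.
Qed.

(** The two eigenvectors can be normalized because their product is not 0: with f the product of the
    other factors, all rows of f(A) are multiples of x, so f(A) = z x, while f(A) multiplies the
    right eigenvector by f(l), which is not 0. *)
Lemma eigenpair_exists rs l rs' : char_poly A = rprod rs -> perm_eq rs (l :: rs') ->
  l \notin rs' -> exists x : 'rV_n.+1, exists y : 'cV_n.+1,
    [/\ x *m A = l *: x, A *m y = l *: y & x *m y = 1%:M].
Proof.
move=> chA pe lN; have [TA AT] := root_prod_mx chA pe.
set T := horner_mx A _ in TA AT.
have chA' : char_poly A = ('X - l%:P) * rprod rs' by rewrite chA (rprod_perm pe) rprod_cons.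
have gl : (rprod rs').[l] != 0 by rewrite rprod_eq0.
have : eigenvalue A l by rewrite eigenvalue_root_char chA' rootM root_XsubC eqxx.
case/eigenvalueP => x xA x0.
have : eigenvalue A^T l by rewrite eigenvalue_root_char char_poly_tr chA' rootM root_XsubC eqxx.
case/eigenvalueP => y' yA y0.
have Ay : A *m y'^T = l *: y'^T by rewrite -[LHS]trmxK trmx_mul trmxK yA linearZ.
have [z Tz] := rows_eigen chA' gl x0 xA TA.
have xy : (x *m y'^T) 0 0 != 0.
  apply: contra_neq y0 => xy.
  have := horner_mx_eigen_col (rprod rs') Ay; rewrite -/T Tz -mulmxA.
  rewrite (mx11_scalar (x *m _)) xy -scalemx1 scale0r mulmx0 => /esym/eqP.
  by rewrite scaler_eq0 (negPf gl) /= => /eqP/(congr1 trmx); rewrite trmxK trmx0.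
exists x, (((x *m y'^T) 0 0)^-1 *: y'^T); split=> //.
  by rewrite -scalemxAr Ay !scalerA mulrC.
by rewrite -scalemxAr {2}(mx11_scalar (x *m _)) -scalemx1 scalerA mulVf // scale1r.
Qed.

Lemma root_prod_mx_rank1 rs l rs' (x : 'rV_n.+1) (y : 'cV_n.+1) :
  char_poly A = rprod rs -> perm_eq rs (l :: rs') -> l \notin rs' ->
  x *m A = l *: x -> A *m y = l *: y -> x *m y = 1%:M ->
  horner_mx A (rprod rs') = (rprod rs').[l] *: (y *m x).
Proof.
move=> chA pe lN xA Ay xy; have [TA AT] := root_prod_mx chA pe.
have chA' : char_poly A = ('X - l%:P) * rprod rs' by rewrite chA (rprod_perm pe) rprod_cons.
have gl : (rprod rs').[l] != 0 by rewrite rprod_eq0.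
have x0 : x != 0.
  by apply: contra_eq_neq xy => ->; rewrite mul0mx eq_sym -scalemx1 scale1r; apply/eqP => /matrixP/(_ 0 0)/eqP; rewrite !mxE oner_eq0.
have [z Tz] := rows_eigen chA' gl x0 xA TA.
have := horner_mx_eigen_col (rprod rs') Ay; rewrite Tz -mulmxA xy mulmx1 => ->.
by rewrite scalemxAl.
Qed.

(** Multiplied by A - l or by A - m, the product T over [rs'] has rank one, and the difference of
    these two matrices is (l - m) T. Hence T lives on the two eigenlines, even if [rs'] has
    repetitions. *)
Lemma root_prod_mx_compl rs l m rs' (xl xm : 'rV_n.+1) (yl ym : 'cV_n.+1) :
  char_poly A = rprod rs -> perm_eq rs [:: l, m & rs'] ->
  l \notin m :: rs' -> m \notin rs' ->
  xl *m A = l *: xl -> A *m yl = l *: yl -> xl *m yl = 1%:M ->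
  xm *m A = m *: xm -> A *m ym = m *: ym -> xm *m ym = 1%:M ->
  horner_mx A (rprod rs') *m (1%:M - yl *m xl - ym *m xm) = 0 /\
  (1%:M - yl *m xl - ym *m xm) *m horner_mx A (rprod rs') = 0.
Proof.
move=> chA pe lN mN xAl Ayl xyl xAm Aym xym.
have lm : l - m != 0 by move: lN; rewrite inE negb_or subr_eq0 => /andP[].
have pe2 : perm_eq rs [:: m, l & rs'].
  by apply: (perm_trans pe); rewrite (perm_catCA [:: l] [:: m]).
have mlN : m \notin l :: rs'.
  by rewrite inE negb_or mN andbT; apply: contraNneq lm => ->; rewrite subrr.
have := root_prod_mx_rank1 chA pe2 mlN xAm Aym xym.
have := root_prod_mx_rank1 chA pe lN xAl Ayl xyl.
rewrite !rprod_cons !rmorphM /= !linearB /= !horner_mx_X !horner_mx_C !hornerE.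
set T := horner_mx A (rprod rs') => E1 E2.
have ET : T = (rprod rs').[l] *: (yl *m xl) + (rprod rs').[m] *: (ym *m xm).
  apply: (scalerI lm); rewrite scalerDr !scalerA -E1.
  rewrite -[(l - m) * (rprod rs').[m]]opprK -mulNr opprB scaleNr -E2.
  rewrite -!mulmxE !mulmxBl !mul_scalar_mx.
  by set AT := A *m T; apply/matrixP => i j; rewrite !mxE; ring.
split.
  rewrite mulmx1 !mulmxA (horner_mx_eigen_col _ Ayl) (horner_mx_eigen_col _ Aym).
  by rewrite -/T {1}ET -!scalemxAl addrAC addrK subrr.
rewrite !mulmxBl mul1mx -!mulmxA (horner_mx_eigen_row _ xAl) (horner_mx_eigen_row _ xAm).
by rewrite -/T {1}ET -!scalemxAr addrAC addrK subrr.
Qed.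

End EigenPair.

(** * Products of the operators ad A - c *)

Section AdProducts.
Variables (K : fieldType) (n : nat) (A : 'M[K]_n.+1).
Implicit Types (X Y Z : 'M[K]_n.+1).

Definition ad_step (c : K) X := A * X - X * A - c *: X.
Definition ad_prod (cs : seq K) X := foldr ad_step X cs.

Fact ad_step_linear c : linear (ad_step c).
Proof.
move=> a X Y; rewrite /ad_step mulrDr mulrDl !scalerDr -!scalerAl -!scalerAr.
by rewrite !scalerA mulrC -!scalerA -addrA; apply/matrixP => i j; rewrite !mxE; ring.
Qed.

Lemma ad_stepD c X Y : ad_step c (X + Y) = ad_step c X + ad_step c Y.
Proof. by have := ad_step_linear c 1 X Y; rewrite !scale1r. Qed.
Lemma ad_step0 c : ad_step c 0 = 0.
Proof. by rewrite /ad_step mulr0 mul0r scaler0 !subr0. Qed.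
Lemma ad_stepZ c a X : ad_step c (a *: X) = a *: ad_step c X.
Proof. by have := ad_step_linear c a X 0; rewrite !addr0 ad_step0 addr0. Qed.

Lemma ad_stepC c d X : ad_step c (ad_step d X) = ad_step d (ad_step c X).
Proof.
rewrite /ad_step !mulrBr !mulrBl !scalerBr !mulrA -!scalerAl -!scalerAr.
rewrite !scalerA (mulrC c d).
set t1 := A * A * X; set t2 := A * X * A; set t3 := A * X; set t4 := X * A * A.
by apply/matrixP => i j; rewrite !mxE; ring.
Qed.

Lemma ad_prodD cs X Y : ad_prod cs (X + Y) = ad_prod cs X + ad_prod cs Y.
Proof. by elim: cs => //= c cs ->; rewrite ad_stepD. Qed.
Lemma ad_prod0 cs : ad_prod cs 0 = 0.
Proof. by elim: cs => //= c cs ->; rewrite ad_step0. Qed.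
Lemma ad_prod_cat s t X : ad_prod (s ++ t) X = ad_prod s (ad_prod t X).
Proof. by rewrite /ad_prod foldr_cat. Qed.
Lemma ad_stepC_prod c s X : ad_step c (ad_prod s X) = ad_prod s (ad_step c X).
Proof. by elim: s => //= d s IH; rewrite ad_stepC IH. Qed.
Lemma ad_prodC s t X : ad_prod s (ad_prod t X) = ad_prod t (ad_prod s X).
Proof. by elim: s => //= c s ->; rewrite ad_stepC_prod. Qed.

(* Modulo left multiples of A - u, bracketing with A acts as X |-> u X - X A. *)
Lemma ad_prod_row (Q P : 'M[K]_n.+1) u vs X :
  GRing.comm A Q -> GRing.comm A P -> Q * X = 0 -> X * P = 0 ->
  exists Z, [/\ Q * Z = 0, Z * P = 0 & exists e : K,
    ad_prod [seq u - v | v <- vs] X =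
      (A - u%:M) * Z + e *: (X * horner_mx A (rprod vs))].
Proof.
move=> cQ cP QX XP; elim: vs => [|v vs [Z [QZ ZP [e IH]]]].
  exists 0; rewrite mulr0 mul0r; split=> //; exists 1.
  by rewrite mulr0 add0r scale1r /rprod big_nil rmorph1 mulr1.
rewrite rprod_cons rmorphM /= IH linearB /= horner_mx_X horner_mx_C.
set H := horner_mx A _.
have cH : GRing.comm A H by rewrite -{1}(horner_mx_X A); apply: comm_horner_mx2.
pose W := (A - u%:M) * Z + e *: (X * H).
exists (W - Z * (A - v%:M)); split.
- rewrite mulrBr mulrA QZ mul0r subr0 /W mulrDr mulrA.
  have -> : Q * (A - u%:M) = (A - u%:M) * Q.
    by rewrite mulrBr mulrBl cQ -!mulmxE scalar_mxC.
  by rewrite -mulrA QZ mulr0 add0r -scalerAr mulrA QX mul0r scaler0.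
- rewrite mulrBl -mulrA.
  have -> : (A - v%:M) * P = P * (A - v%:M).
    by rewrite mulrBr mulrBl cP -!mulmxE scalar_mxC.
  rewrite mulrA ZP mul0r subr0 /W mulrDl -mulrA ZP mulr0 add0r -scalerAl -mulrA.
  have -> : H * P = P * H by rewrite /H; apply/comm_horner_mx/comm_mx_sym.
  by rewrite mulrA XP mul0r scaler0.
exists (- e); rewrite -/W /ad_step.
have -> : X * ((A - v%:M) * H) = X * H * (A - v%:M).
  by rewrite -mulrA; congr (_ * _); rewrite mulrBl mulrBr cH -!mulmxE scalar_mxC.
rewrite mulrBr mulrA.
have -> : (A - u%:M) * Z = W - e *: (X * H) by rewrite /W addrK.
rewrite mulrBl [(W - _) * _]mulrBl -scalerAl !mulrBr -!mulmxE !mul_scalar_mx !mul_mx_scalar !mulmxE.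
set t1 := A * W; set t2 := W * A; set t3 := X * H * A.
by apply/matrixP => i j; rewrite !mxE; ring.
Qed.

(** Induction on the roots of the left annihilator. For a fixed u, running through all v turns X
    into (A - u) Z plus a multiple of X g(A) = 0, with g the polynomial of [vs]; this uses up the
    factor A - u of the left annihilator. *)
Lemma ad_prod_kill us vs X :
  horner_mx A (rprod us) * X = 0 -> X * horner_mx A (rprod vs) = 0 ->
  ad_prod [seq u - v | u <- us, v <- vs] X = 0.
Proof.
have cA p : GRing.comm A (horner_mx A p).
  by rewrite -{1}(horner_mx_X A); apply: comm_horner_mx2.
elim: us X => [|u us IH] X.
  by rewrite /rprod big_nil rmorph1 mul1r.
move=> LX XR; rewrite allpairs_cons ad_prod_cat ad_prodC.
have [Z [LZ ZR [e ->]]] := ad_prod_row u vs (cA _) (cA _) LX XR.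
rewrite XR scaler0 addr0; apply: IH.
  move: LZ; rewrite rprod_cons mulrC rmorphM /= linearB /= horner_mx_X horner_mx_C.
  by rewrite mulrA.
by rewrite -mulrA ZR mulr0.
Qed.

Lemma ad_prod_eigen cs d X : A * X - X * A = d *: X ->
  ad_prod cs X = (\prod_(c <- cs) (d - c)) *: X.
Proof.
move=> h; elim: cs => [|c cs IH] /=; first by rewrite big_nil scale1r.
rewrite IH ad_stepZ /ad_step h -scalerBl scalerA big_cons mulrC //.
Qed.

End AdProducts.

Section LieClosed.
Variables (K : fieldType) (n : nat).
Implicit Types (A B X Y C : 'M[K]_n.+1) (x : 'rV[K]_n.+1) (y : 'cV[K]_n.+1).

(** A predicate and not a finite set, because K will be an algebraic closure. *)
Definition lie_closed (S : 'M[K]_n.+1 -> Prop) :=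
  [/\ S 0, forall a X Y, S X -> S Y -> S (a *: X + Y)
    & forall X Y, S X -> S Y -> S (X *m Y - Y *m X)].

Definition dot x y : K := (x *m y) 0 0.

Lemma dotE x y : x *m y = (dot x y)%:M.
Proof. exact: mx11_scalar. Qed.

Lemma op_op x y x' y' : (y *m x) *m (y' *m x') = dot x y' *: (y *m x').
Proof. by rewrite mulmxA -(mulmxA y) dotE -scalemx1 -scalemxAr mulmx1 scalemxAl. Qed.

Definition subs (us vs : seq K) := [seq u - v | u <- us, v <- vs].

(** With E_l, E_m the eigenprojections and R = 1 - E_l - E_m, B splits into nine blocks; there is
    one family of differences for each block other than E_l B E_m and E_m B E_l. *)
Definition diffs (l m : K) (rest : seq K) : seq K :=
  subs [:: l] [:: l] ++ subs [:: m] [:: m] ++ subs [:: l] rest ++ subs [:: m] rest ++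
  subs rest [:: l] ++ subs rest [:: m] ++ subs rest rest.

Variable S : 'M[K]_n.+1 -> Prop.
Hypothesis clS : lie_closed S.

Lemma lie_closedZ a X : S X -> S (a *: X).
Proof. by case: clS => S0 SD _ SX; rewrite -[_ *: _]addr0; apply: SD. Qed.
Lemma lie_closedD X Y : S X -> S Y -> S (X + Y).
Proof. by case: clS => S0 SD _ SX SY; rewrite -[X]scale1r; apply: SD. Qed.
Lemma lie_closedB X Y : S X -> S Y -> S (X - Y).
Proof. by move=> SX SY; rewrite -scaleN1r; apply: lie_closedD => //; apply: lie_closedZ. Qed.
Lemma lie_closed_br X Y : S X -> S Y -> S (X *m Y - Y *m X).
Proof. by case: clS => _ _; apply. Qed.

Lemma ad_prod_closed A cs B : S A -> S B -> S (ad_prod A cs B).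
Proof.
move=> SA SB; elim: cs => //= c cs IH; rewrite /ad_step; apply: lie_closedB.
  exact: lie_closed_br.
exact: lie_closedZ.
Qed.

(** Each of the seven unwanted blocks of B is killed by its own family of differences through
    [ad_prod_kill]; on the two other blocks [ad A] acts by the scalars l - m and m - l. *)
Lemma extract_pair A B rs l m rest xl xm yl ym :
  S A -> S B ->
  char_poly A = rprod rs -> perm_eq rs [:: l, m & rest] ->
  l \notin m :: rest -> m \notin rest ->
  xl *m A = l *: xl -> A *m yl = l *: yl -> xl *m yl = 1%:M ->
  xm *m A = m *: xm -> A *m ym = m *: ym -> xm *m ym = 1%:M ->
  let h := fun d => \prod_(c <- diffs l m rest) (d - c) in
  S ((h (l - m) * dot xl (B *m ym)) *: (yl *m xm) +
     (h (m - l) * dot xm (B *m yl)) *: (ym *m xl)).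
Proof.
move=> SA SB chA pe lN mN xAl Ayl xyl xAm Aym xym h.
have [TR RT] := root_prod_mx_compl chA pe lN mN xAl Ayl xyl xAm Aym xym.
set R := 1%:M - _ - _ in TR RT.
have := ad_prod_closed (diffs l m rest) SA SB.
have opB x y x' y' : (y *m x) *m B *m (y' *m x') = dot x (B *m y') *: (y *m x').
  by rewrite -mulmxA (mulmxA B) op_op.
have h1 (r : K) : horner_mx A (rprod [:: r]) = A - r%:M.
  by rewrite /rprod big_seq1 linearB /= horner_mx_X horner_mx_C.
have kl x y r : A *m y = r *: y -> horner_mx A (rprod [:: r]) *m (y *m x) = 0.
  by move=> Ay; rewrite h1 mulmxA mulmxBl Ay mul_scalar_mx subrr mul0mx.
have kr x y r : x *m A = r *: x -> (y *m x) *m horner_mx A (rprod [:: r]) = 0.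
  by move=> xA; rewrite h1 -mulmxA mulmxBr xA mul_mx_scalar subrr mulmx0.
have cr s t X : ad_prod A s X = 0 -> ad_prod A (s ++ t) X = 0.
  by move=> e; rewrite ad_prod_cat ad_prodC e ad_prod0.
have cl s t X : ad_prod A t X = 0 -> ad_prod A (s ++ t) X = 0.
  by move=> e; rewrite ad_prod_cat e ad_prod0.
have kill us vs Y Z : horner_mx A (rprod us) *m Y = 0 -> Z *m horner_mx A (rprod vs) = 0 ->
    ad_prod A (subs us vs) (Y *m B *m Z) = 0.
  move=> PY ZP; apply: ad_prod_kill; rewrite -mulmxE; first by rewrite !mulmxA PY !mul0mx.
  by rewrite -mulmxA ZP mulmx0.
set El := yl *m xl; set Em := ym *m xm.
have sumE : El + Em + R = 1%:M.
  by rewrite /R -/El -/Em; apply/matrixP => i j; rewrite !mxE; ring.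
have eB : B = El *m B *m Em + Em *m B *m El +
    (El *m B *m El + Em *m B *m Em + El *m B *m R + Em *m B *m R + R *m B *m El + R *m B *m Em + R *m B *m R).
  have {1}-> : B = (El + Em + R) *m B *m (El + Em + R) by rewrite sumE mul1mx mulmx1.
  rewrite !mulmxDl !mulmxDr.
  set t1 := El *m B *m El; set t2 := El *m B *m Em; set t3 := El *m B *m R.
  set t4 := Em *m B *m El; set t5 := Em *m B *m Em; set t6 := Em *m B *m R.
  set t7 := R *m B *m El; set t8 := R *m B *m Em; set t9 := R *m B *m R.
  by apply/matrixP => i j; rewrite !mxE; ring.
rewrite {1}eB !ad_prodD.
have lE := kl xl _ _ Ayl; have mE := kl xm _ _ Aym.
have El_ := kr _ yl _ xAl; have Em_ := kr _ ym _ xAm.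
have -> : ad_prod A (diffs l m rest) (El *m B *m El) = 0 by apply/cr/kill.
have -> : ad_prod A (diffs l m rest) (Em *m B *m Em) = 0 by apply/cl/cr/kill.
have -> : ad_prod A (diffs l m rest) (El *m B *m R) = 0 by do 2! apply/cl; apply/cr/kill.
have -> : ad_prod A (diffs l m rest) (Em *m B *m R) = 0 by do 3! apply/cl; apply/cr/kill.
have -> : ad_prod A (diffs l m rest) (R *m B *m El) = 0 by do 4! apply/cl; apply/cr/kill.
have -> : ad_prod A (diffs l m rest) (R *m B *m Em) = 0 by do 5! apply/cl; apply/cr/kill.
have -> : ad_prod A (diffs l m rest) (R *m B *m R) = 0 by do 6! apply/cl; apply/kill.
rewrite !addr0 !opB.
have eig x y r s b : x *m A = s *: x -> A *m y = r *: y ->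
    ad_prod A (diffs l m rest) (b *: (y *m x)) = (h (r - s) * b) *: (y *m x).
  move=> xA Ay; rewrite (@ad_prod_eigen _ _ _ _ (r - s)) ?scalerA //.
  rewrite -!mulmxE -scalemxAl -scalemxAr mulmxA Ay -mulmxA xA -scalemxAl -scalemxAr.
  by rewrite -scalerBr -scalerBl !scalerA mulrC.
by rewrite (eig _ _ _ _ _ xAm Ayl) (eig _ _ _ _ _ xAl Aym).
Qed.

(* Bracketing u01 with u12 produces a second combination of E02 and E20, independent of u02. *)
Lemma split_pair (x0 x1 x2 : 'rV[K]_n.+1) (y0 y1 y2 : 'cV[K]_n.+1) a01 a10 a12 a21 a02 a20 :
  x1 *m y1 = 1%:M -> x0 *m y2 = 0 -> x2 *m y0 = 0 ->
  x0 *m y1 = 0 -> x1 *m y0 = 0 -> x1 *m y2 = 0 -> x2 *m y1 = 0 ->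
  S (a01 *: (y0 *m x1) + a10 *: (y1 *m x0)) ->
  S (a12 *: (y1 *m x2) + a21 *: (y2 *m x1)) ->
  S (a02 *: (y0 *m x2) + a20 *: (y2 *m x0)) ->
  a01 * a12 * a20 + a10 * a21 * a02 != 0 ->
  S (y0 *m x2) /\ S (y2 *m x0).
Proof.
move=> e11 e02 e20 e01 e10 e12 e21 S01 S12 S02 N0.
have := lie_closed_br S01 S12.
rewrite !mulmxDl !mulmxDr -!scalemxAl -!scalemxAr !mulmxA -!(mulmxA _ _ y0) -!(mulmxA _ _ y1) -!(mulmxA _ _ y2).
rewrite e11 e02 e20 e01 e10 e12 e21 ?mulmx0 ?mul0mx ?mulmx1 ?scaler0 ?addr0 ?add0r.
set E := y0 *m x2 in S02 *; set E' := y2 *m x0 in S02 *.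
rewrite !scalerA => Sbr.
set d := _ + _ in N0.
split.
  have -> : E = d^-1 *: (a20 *: ((a01 * a12) *: E - (a21 * a10) *: E') + (a21 * a10) *: (a02 *: E + a20 *: E')).
    apply: (scalerI N0); rewrite scalerA mulfV // scale1r /d.
    by apply/matrixP => i j; rewrite !mxE; ring.
  by apply/lie_closedZ/lie_closedD; apply/lie_closedZ.
have -> : E' = d^-1 *: ((- a02) *: ((a01 * a12) *: E - (a21 * a10) *: E') + (a01 * a12) *: (a02 *: E + a20 *: E')).
  apply: (scalerI N0); rewrite scalerA mulfV // scale1r /d.
  by apply/matrixP => i j; rewrite !mxE; ring.
by apply/lie_closedZ/lie_closedD; apply/lie_closedZ.
Qed.

End LieClosed.

(** * From off-diagonal matrix units to all trace zero matrices *)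

Section MatrixUnits.
Variables (K : fieldType) (n : nat).
Implicit Types (A B X Y C : 'M[K]_n.+1) (x : 'rV[K]_n.+1) (y : 'cV[K]_n.+1).

Definition subspace (V : lmodType K) (W : V -> Prop) :=
  W 0 /\ forall a u v, W u -> W v -> W (a *: u + v).

Let br X Y := X *m Y - Y *m X.

Lemma brBl X Y Z : br (X - Y) Z = br X Z - br Y Z.
Proof. by rewrite /br mulmxBl mulmxBr !opprB -!addrA; congr (_ + _); rewrite addrC [RHS]addrCA addrA. Qed.
Lemma brZl a X Y : br (a *: X) Y = a *: br X Y.
Proof. by rewrite /br -scalemxAl -scalemxAr scalerBr. Qed.
Lemma brBr X Y Z : br X (Y - Z) = br X Y - br X Z.
Proof. by rewrite /br mulmxBl mulmxBr !opprB -!addrA; congr (_ + _); rewrite addrC [RHS]addrCA addrA. Qed.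
Lemma brZr a X Y : br X (a *: Y) = a *: br X Y.
Proof. by rewrite /br -scalemxAl -scalemxAr scalerBr. Qed.
Lemma br_op C y x : br C (y *m x) = (C *m y) *m x - y *m (x *m C).
Proof. by rewrite /br !mulmxA. Qed.
Lemma op_br y x y' x' :
  br (y *m x) (y' *m x') = dot x y' *: (y *m x') - dot x' y *: (y' *m x).
Proof. by rewrite /br !op_op. Qed.

Lemma dotA x C y : dot (x *m C) y = dot x (C *m y).
Proof. by rewrite /dot mulmxA. Qed.

Lemma dotDr x a y y' : dot x (a *: y + y') = a * dot x y + dot x y'.
Proof. by rewrite /dot mulmxDr -scalemxAr !mxE. Qed.
Lemma dotDl a x x' y : dot (a *: x + x') y = a * dot x y + dot x' y.
Proof. by rewrite /dot mulmxDl -scalemxAl !mxE. Qed.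

Variable S : 'M[K]_n.+1 -> Prop.
Hypothesis clS : lie_closed S.
Variables (x_ : 'I_3 -> 'rV[K]_n.+1) (y_ : 'I_3 -> 'cV[K]_n.+1).
Let E i j := y_ i *m x_ j.
Hypothesis orth : forall i j, dot (x_ i) (y_ j) = (i == j)%:R.
Hypothesis SE : forall i j, i != j -> S (E i j).

Let SD := lie_closedD clS.
Let SB := lie_closedB clS.
Let SZ := lie_closedZ clS.
Let Sbr X Y : S X -> S Y -> S (br X Y).
Proof. exact: lie_closed_br. Qed.

Let third (i j : 'I_3) : i != j -> exists2 k : 'I_3, k != i & k != j.
Proof.
move=> ij; have /set0Pn[k] : ~: [set i; j] != set0.
  by have := cardsC [set i; j]; rewrite cards2 ij card_ord -card_gt0; case: #|_|.
by rewrite !inE negb_or => /andP[]; exists k.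
Qed.

Let another (i : 'I_3) : exists j : 'I_3, j != i.
Proof.
have /set0Pn[k] : ~: [set i] != set0 by rewrite -card_gt0 cardsC1 card_ord.
by rewrite !inE; exists k.
Qed.

Let SEB i j : S (E i i - E j j).
Proof.
have [-> | ij] := eqVneq i j; first by rewrite subrr; case: clS.
have -> : E i i - E j j = br (E i j) (E j i) by rewrite op_br !orth !eqxx !scale1r.
by apply: Sbr; apply: SE; rewrite // eq_sym.
Qed.

(** The trace of y x_i is [dot (x_ i) y], so this is y x_i made traceless by a multiple of E_jj.
    Whether it lies in S does not depend on i and j, by [G_move]. *)
Let G y i j := y *m x_ i - dot (x_ i) y *: E j j.

Let G_change y i j k : S (G y i j) -> S (G y i k).
Proof.
move=> SG; have -> : G y i k = G y i j + dot (x_ i) y *: (E j j - E k k).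
  by rewrite /G scalerBr addrA subrK.
by apply: SD => //; apply/SZ/SEB.
Qed.

Let G_move y i j k l : S (G y i j) -> S (G y k l).
Proof.
have [-> | ik] := eqVneq i k; first exact: G_change.
have [m mi mk] := third ik.
move=> /(G_change m) SG; apply: (@G_change y k i).
have -> : G y k i = br (G y i m) (E i k).
  rewrite /G brBl brZl !op_br !orth eqxx (negPf mi) (eq_sym k) (negPf mk).
  by rewrite !scale0r subrr scaler0 subr0 scale1r.
by apply: Sbr => //; apply: SE.
Qed.

Let i0 : 'I_3 := ord0.
(* U turns out to be stable under every element of S, so it is everything as soon as y_0 is cyclic. *)
Let U y := S (G y i0 i0).

Let U_sub : subspace U.
Proof.
split; first by rewrite /U /G mul0mx /dot mulmx0 mxE scale0r subrr; case: clS.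
move=> a u v Uu Uv; rewrite /U /G.
have -> : (a *: u + v) *m x_ i0 - dot (x_ i0) (a *: u + v) *: E i0 i0 = a *: G u i0 i0 + G v i0 i0.
  rewrite /G dotDr mulmxDl -scalemxAl scalerDl scalerBr scalerA.
  by set t1 := v *m x_ i0; set t2 := u *m _; apply/matrixP => i j; rewrite !mxE; ring.
by apply: SD => //; apply: SZ.
Qed.

Let U_y i : U (y_ i).
Proof.
apply: (@G_move _ i i); rewrite /G orth eqxx scale1r subrr.
by case: clS.
Qed.

Let U_Cy C i : S C -> U (C *m y_ i).
Proof.
move=> SC; have [j ji] := another i; have [k kj ki] := third ji.
apply: (@G_move _ k j).
have -> : G (C *m y_ i) k j = br (br C (E i j)) (E j k) + dot (x_ j) (C *m y_ j) *: E i k.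
  rewrite /G [br C _]br_op brBl !op_br dotA !orth eqxx (negPf ki) scale0r subr0 scale1r.
  set t1 := C *m y_ i *m x_ k.
  by apply/matrixP => a b; rewrite !mxE; ring.
apply: SD; last by apply/SZ/SE; rewrite eq_sym.
by apply: Sbr; [apply: Sbr => // |]; apply: SE; rewrite // eq_sym.
Qed.

Let U_C C y : S C -> U y -> U (C *m y).
Proof.
move=> SC.
have [i1 i10] := another i0; have [i2 i21 i20] := third i10.
(* Subtracting a multiple of y_{i1}, which [U_Cy] takes care of, makes the product of x_{i1} and y
   vanish; then y x_{i1} itself lies in S. *)
wlog y1 : y / dot (x_ i1) y = 0 => [H Uy|Uy].
  have [U0 UD] := U_sub.
  set z := (- dot (x_ i1) y) *: y_ i1 + y.
  have -> : C *m y = dot (x_ i1) y *: (C *m y_ i1) + C *m z.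
    by rewrite /z mulmxDr -scalemxAr scaleNr addrA subrr add0r.
  apply: (UD); first exact: U_Cy.
  apply: H; last by apply: UD => //; apply: U_y.
  by rewrite /z dotDr orth eqxx mulr1 addNr.
have SG : S (G y i0 i2) by apply: G_move Uy.
have SG1 : S (y *m x_ i1).
  by have := @G_move y i0 i0 i1 i0 Uy; rewrite /G y1 scale0r subr0.
apply: (@G_move _ i1 i0).
set a := dot (x_ i0) y.
have -> : G (C *m y) i1 i0 = br (br C (G y i0 i2)) (E i0 i1) +
   dot (x_ i0) (C *m y_ i0) *: (y *m x_ i1) - (a * dot (x_ i1) (C *m y_ i2)) *: E i0 i2
   - (a * dot (x_ i2) (C *m y_ i0)) *: E i2 i1.
  rewrite /G [br C _]brBr brZr ![br C _]br_op !(brBl, brZl) !op_br !dotA !orth y1 eqxx (negPf i20) (eq_sym i1) (negPf i21) -/a.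
  rewrite !scale0r !scale1r.
  set t1 := C *m y *m x_ i1; set t2 := y *m x_ i1; rewrite /E.
  by apply/matrixP => i j; rewrite !mxE; ring.
apply: (SB (SB (SD _ _) _) _).
- by apply: Sbr; [apply: Sbr | apply: SE; rewrite eq_sym].
- exact: SZ.
- by apply/SZ/SE; rewrite eq_sym.
- by apply/SZ/SE.
Qed.

Lemma column_closure :
  (forall W : 'cV[K]_n.+1 -> Prop, subspace W ->
     (forall C y, S C -> W y -> W (C *m y)) -> W (y_ i0) -> forall y, W y) ->
  forall y, S (y *m x_ i0 - dot (x_ i0) y *: E i0 i0).
Proof. by move=> cyc y; apply: (cyc U U_sub U_C (U_y _)). Qed.

End MatrixUnits.

Section Transitive.
Variables (K : fieldType) (n : nat).
Implicit Types (A B X Y C : 'M[K]_n.+1).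
Variable S : 'M[K]_n.+1 -> Prop.
Hypothesis clS : lie_closed S.
Variables (x_ : 'I_3 -> 'rV[K]_n.+1) (y_ : 'I_3 -> 'cV[K]_n.+1).
Hypothesis orth : forall i j, dot (x_ i) (y_ j) = (i == j)%:R.
Hypothesis SE : forall i j, i != j -> S (y_ i *m x_ j).

(** Cyclicity of y_0 puts every y x_0 in S up to a multiple of E_00, cyclicity of x_0 does the same
    for y_0 x, and a bracket of the two kinds gives y x up to a multiple of E_00. A trace zero
    matrix is a sum of such terms in which the multiples of E_00 cancel. *)
Theorem lie_closed_contains_sl :
  (forall W : 'cV[K]_n.+1 -> Prop, subspace W ->
     (forall C y, S C -> W y -> W (C *m y)) -> W (y_ ord0) -> forall y, W y) ->
  (forall W : 'rV[K]_n.+1 -> Prop, subspace W ->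
     (forall C x, S C -> W x -> W (x *m C)) -> W (x_ ord0) -> forall x, W x) ->
  forall Z, \tr Z = 0 -> S Z.
Proof.
move=> cycC cycR.
have SD := lie_closedD clS; have SB := lie_closedB clS; have SZ := lie_closedZ clS.
have H1 := column_closure clS orth SE cycC.
(* Transposition changes the bracket only by a sign, so the statement on rows follows from the one
   on columns. *)
have clT : lie_closed (fun X => S X^T).
  case: clS => S0 SL Sb; split=> [|a X Y SX SY|X Y SX SY].
  - by rewrite trmx0.
  - by rewrite linearP; apply: SL.
  - by rewrite linearB /= !trmx_mul; apply: Sb.
have dotT (x : 'rV[K]_n.+1) (y : 'cV[K]_n.+1) : dot y^T x^T = dot x y.
  by rewrite /dot -trmx_mul mxE.
have H2 : forall x, S (y_ ord0 *m x - dot x (y_ ord0) *: (y_ ord0 *m x_ ord0)).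
  move=> x; have := @column_closure _ _ _ clT (fun i => (y_ i)^T) (fun i => (x_ i)^T).
  move=> /(_ _ _ _ x^T) H.
  have := H _ _ _; rewrite linearB linearZ /= !trmx_mul !trmxK dotT; apply.
  - by move=> i j; rewrite dotT orth eq_sym.
  - by move=> i j ij; rewrite trmx_mul !trmxK; apply: SE; rewrite eq_sym.
  - move=> W [W0 WD] WC Wy y; rewrite -[y]trmxK.
    apply: (cycR (fun x => W x^T)) => //.
      by split=> [|a u v Wu Wv]; rewrite ?trmx0 // linearP; apply: WD.
    by move=> C x' SC Wx; rewrite trmx_mul; apply: WC; rewrite ?trmxK.
set x0 := x_ ord0 in H1 H2; set y0 := y_ ord0 in H1 H2; set E := y0 *m x0 in H1 H2.
have d00 : dot x0 y0 = 1 by rewrite orth eqxx.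
have H3 (y : 'cV_n.+1) (x : 'rV_n.+1) : S (y *m x - dot x y *: E).
  set y' := (- dot x0 y) *: y0 + y; set x' := (- dot x y0) *: x0 + x.
  have x0y' : dot x0 y' = 0 by rewrite dotDr d00 mulr1 addNr.
  have x'y0 : dot x' y0 = 0 by rewrite dotDl d00 mulr1 addNr.
  have Sy' : S (y' *m x0) by have := H1 y'; rewrite x0y' scale0r subr0.
  have Sx' : S (y0 *m x') by have := H2 x'; rewrite x'y0 scale0r subr0.
  have -> : y *m x - dot x y *: E =
     (y' *m x0 *m (y0 *m x') - y0 *m x' *m (y' *m x0)) + dot x0 y *: (y0 *m x') + dot x y0 *: (y' *m x0).
    rewrite !op_op d00 scale1r.
    have -> : dot x' y' = dot x y - dot x y0 * dot x0 y.
      by rewrite dotDl x0y' mulr0 add0r dotDr; ring.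
    rewrite /x' /y' !mulmxDl !mulmxDr -?scalemxAl -?scalemxAr -/E.
    set a := dot x0 y; set b := dot x y0; set c := dot x y.
    set t1 := y *m x; set t2 := y *m x0; set t3 := y0 *m x.
    by apply/matrixP => i j; rewrite !mxE; ring.
  apply: (SD); last exact: SZ.
  by apply: SD; [apply: lie_closed_br | apply: SZ].
move=> Z trZ.
have -> : Z = \sum_j (col j Z *m delta_mx 0 j - dot (delta_mx 0 j) (col j Z) *: E).
  rewrite big_split /= sumrN -scaler_suml.
  have -> : \sum_j dot (delta_mx 0 j) (col j Z) = \tr Z.
    by apply: eq_bigr => j _; rewrite /dot -rowE !mxE.
  rewrite trZ scale0r subr0.
  apply/matrixP => i j; rewrite summxE (bigD1 j) //= big1 => [|k kj].
    by rewrite addr0 !mxE big_ord1 !mxE !eqxx mulr1.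
  by rewrite !mxE big_ord1 !mxE eqxx eq_sym (negPf kj) mulr0.
elim/big_ind: _ => //; first by case: clS.
Qed.

End Transitive.

(** The equality l - m = m - l is allowed; it always holds in characteristic 2. *)
Definition sep (K : fieldType) (l m : K) (rest : seq K) :=
  (l - m \notin diffs l m rest) && (m - l \notin diffs l m rest).

Definition sep3 (K : fieldType) (l0 l1 l2 : K) (rest : seq K) :=
  [&& sep l0 l1 (l2 :: rest), sep l1 l2 (l0 :: rest) & sep l0 l2 (l1 :: rest)].

Lemma sep_notin (K : fieldType) (l m : K) rest :
  sep l m rest -> (l \notin m :: rest) && (m \notin rest).
Proof.
case/andP=> + _; apply: contraR.
rewrite negb_and !negbK inE /diffs !mem_cat => /orP[/orP[/eqP->|lr]|mr].
- by rewrite /subs /= !inE !subrr eqxx.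
- have -> : l - m \in [seq u - v | u <- rest, v <- [:: m]].
    by apply/allpairsP; exists (l, m); rewrite inE eqxx.
  by rewrite !orbT.
have -> : l - m \in [seq l - v | v <- rest] by apply: map_f.
by rewrite !orbT.
Qed.

Section Units.
Variables (K : fieldType) (n : nat).
Implicit Types (A B X Y C : 'M[K]_n.+1) (x : 'rV[K]_n.+1) (y : 'cV[K]_n.+1).

Lemma prod_sub_neq0 (d : K) cs : d \notin cs -> \prod_(c <- cs) (d - c) != 0.
Proof.
by move=> dN; rewrite prodf_seq_neq0; apply/allP => c cin /=; rewrite subr_eq0; apply: contraNneq dN => ->.
Qed.

Lemma eigen_orth A l m (x : 'rV[K]_n.+1) (y : 'cV[K]_n.+1) :
  l != m -> x *m A = l *: x -> A *m y = m *: y -> x *m y = 0.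
Proof.
move=> lm xA Ay; have : l *: (x *m y) = m *: (x *m y).
  by rewrite scalemxAl -xA -mulmxA Ay scalemxAr.
by move/eqP; rewrite -subr_eq0 -scalerBl scaler_eq0 subr_eq0 (negPf lm) => /eqP.
Qed.

(** The coefficients a and b are chosen before B, so that for fixed A the condition on B is the
    nonvanishing of one cubic form. Permuting the three indices at most exchanges its two terms, so
    the same condition lets [split_pair] treat all three pairs. *)
Lemma matrix_units A rs (l_ : 'I_3 -> K) rest
    (x_ : 'I_3 -> 'rV[K]_n.+1) (y_ : 'I_3 -> 'cV[K]_n.+1) :
  let i0 : 'I_3 := inord 0 in let i1 : 'I_3 := inord 1 in let i2 : 'I_3 := inord 2 in
  char_poly A = rprod rs -> perm_eq rs [:: l_ i0, l_ i1, l_ i2 & rest] ->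
  sep3 (l_ i0) (l_ i1) (l_ i2) rest ->
  (forall i, x_ i *m A = l_ i *: x_ i) -> (forall i, A *m y_ i = l_ i *: y_ i) ->
  (forall i, x_ i *m y_ i = 1%:M) ->
  exists a b : K, [/\ a != 0, b != 0 & forall B (S : 'M[K]_n.+1 -> Prop),
    let c i j := dot (x_ i) (B *m y_ j) in
    lie_closed S -> S A -> S B ->
    a * (c i0 i1 * c i1 i2 * c i2 i0) + b * (c i1 i0 * c i2 i1 * c i0 i2) != 0 ->
    forall i j, i != j -> S (y_ i *m x_ j)].
Proof.
move=> i0 i1 i2 chA pe /and3P[s01 s12 s02] xA Ay xy.
have [/andP[lN01 mN01] /andP[lN12 mN12] /andP[lN02 mN02]] :=
  And3 (sep_notin s01) (sep_notin s12) (sep_notin s02).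
have l01 : l_ i0 != l_ i1 by move: lN01; rewrite inE negb_or => /andP[].
have l12 : l_ i1 != l_ i2 by move: lN12; rewrite inE negb_or => /andP[].
have l02 : l_ i0 != l_ i2 by move: lN02; rewrite inE negb_or => /andP[].
have pe12 : perm_eq rs [:: l_ i1, l_ i2, l_ i0 & rest].
  by apply: (perm_trans pe); rewrite (perm_catCA [:: l_ i0] [:: l_ i1; l_ i2] rest).
have pe02 : perm_eq rs [:: l_ i0, l_ i2, l_ i1 & rest].
  by apply: (perm_trans pe); rewrite perm_cons (perm_catCA [:: l_ i1] [:: l_ i2]).
pose h (l m : K) rest' := \prod_(c <- diffs l m rest') (l - m - c).
pose h' (l m : K) rest' := \prod_(c <- diffs l m rest') (m - l - c).
set h01 := h (l_ i0) (l_ i1) (l_ i2 :: rest); set h10 := h' (l_ i0) (l_ i1) (l_ i2 :: rest).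
set h12 := h (l_ i1) (l_ i2) (l_ i0 :: rest); set h21 := h' (l_ i1) (l_ i2) (l_ i0 :: rest).
set h02 := h (l_ i0) (l_ i2) (l_ i1 :: rest); set h20 := h' (l_ i0) (l_ i2) (l_ i1 :: rest).
have [h01N h10N] : h01 != 0 /\ h10 != 0 by case/andP: s01 => ? ?; split; apply: prod_sub_neq0.
have [h12N h21N] : h12 != 0 /\ h21 != 0 by case/andP: s12 => ? ?; split; apply: prod_sub_neq0.
have [h02N h20N] : h02 != 0 /\ h20 != 0 by case/andP: s02 => ? ?; split; apply: prod_sub_neq0.
exists (h01 * h12 * h20), (h10 * h21 * h02); split; rewrite ?mulf_neq0 //.
move=> B S c clS SA SB N0.
have e01 := eigen_orth l01 (xA _) (Ay _); have e02 := eigen_orth l02 (xA _) (Ay _).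
have e12 := eigen_orth l12 (xA _) (Ay _).
have [l10 l20 l21] : [/\ l_ i1 != l_ i0, l_ i2 != l_ i0 & l_ i2 != l_ i1] by split; rewrite eq_sym.
have e10 := eigen_orth l10 (xA _) (Ay _); have e20 := eigen_orth l20 (xA _) (Ay _).
have e21 := eigen_orth l21 (xA _) (Ay _).
have S01 := extract_pair clS SA SB chA pe lN01 mN01 (xA _) (Ay _) (xy _) (xA _) (Ay _) (xy _).
have S12 := extract_pair clS SA SB chA pe12 lN12 mN12 (xA _) (Ay _) (xy _) (xA _) (Ay _) (xy _).
have S02 := extract_pair clS SA SB chA pe02 lN02 mN02 (xA _) (Ay _) (xy _) (xA _) (Ay _) (xy _).
rewrite /= -!/(h _ _ _) -!/(h' _ _ _) -!/(c _ _) in S01 S12 S02.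
have S10 := S01; have S21 := S12; have S20 := S02.
rewrite addrC in S10; rewrite addrC in S21; rewrite addrC in S20.
have E02 := split_pair clS (xy i1) e02 e20 e01 e10 e12 e21 S01 S12 S02.
have E01 := split_pair clS (xy i2) e01 e10 e02 e20 e21 e12 S02 S21 S01.
have E12 := split_pair clS (xy i0) e12 e21 e10 e01 e02 e20 S10 S02 S12.
have N1 : h01 * c i0 i1 * (h12 * c i1 i2) * (h20 * c i2 i0) +
  h10 * c i1 i0 * (h21 * c i2 i1) * (h02 * c i0 i2) != 0.
  by move: N0; congr (_ != 0); ring.
have N2 : h02 * c i0 i2 * (h21 * c i2 i1) * (h10 * c i1 i0) +
  h20 * c i2 i0 * (h12 * c i1 i2) * (h01 * c i0 i1) != 0.
  by move: N0; congr (_ != 0); ring.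
have N3 : h10 * c i1 i0 * (h02 * c i0 i2) * (h21 * c i2 i1) +
  h01 * c i0 i1 * (h20 * c i2 i0) * (h12 * c i1 i2) != 0.
  by move: N0; congr (_ != 0); ring.
have {}E02 := E02 N1; have {}E01 := E01 N2; have {}E12 := E12 N3.
have I3 (i : 'I_3) : [\/ i = i0, i = i1 | i = i2].
  case: i => [[|[|[|//]]] Hi]; [constructor 1|constructor 2|constructor 3];
  by apply: val_inj; rewrite /= inordK.
by move=> i j; case: (I3 i) => ->; case: (I3 j) => ->; rewrite ?eqxx // => _;
  case: E01; case: E02; case: E12.
Qed.

Lemma matrix_units_orth A (l_ : 'I_3 -> K) (x_ : 'I_3 -> 'rV[K]_n.+1) (y_ : 'I_3 -> 'cV[K]_n.+1) :
  injective l_ ->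
  (forall i, x_ i *m A = l_ i *: x_ i) -> (forall i, A *m y_ i = l_ i *: y_ i) ->
  (forall i, x_ i *m y_ i = 1%:M) -> forall i j, dot (x_ i) (y_ j) = (i == j)%:R.
Proof.
move=> inj xA Ay xy i j; rewrite /dot; have [<-|ij] := eqVneq; first by rewrite xy mxE.
rewrite (@eigen_orth A (l_ i) (l_ j)) ?mxE //.
by apply: contraNneq ij => /inj ->.
Qed.
End Units.

Section Generation.
Variables (F : finFieldType) (n : nat) (K : fieldType) (iota : {rmorphism F -> K}).

(** S is taken to be the K-span of L, again closed under the bracket. A matrix over F in the K-span
    of L lies in its F-span, as solvability of a linear system over F does not change in an
    extension. *)
Lemma sl_subset_span (L : {set 'M[F]_n.+1}) :
  lie_subalgebra (sl n.+1 F) L ->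
  (forall S : 'M[K]_n.+1 -> Prop, lie_closed S -> (forall X, X \in L -> S (map_mx iota X)) ->
     forall Z, \tr Z = 0 -> S Z) ->
  sl n.+1 F \subset L.
Proof.
move=> /and4P[_ L0 /forallP LL /forallP Lb] H.
have Llin a X Y : X \in L -> Y \in L -> a *: X + Y \in L.
  move=> XL YL; have /forallP/(_ X) := LL a; rewrite XL /= => /forallP/(_ Y).
  by rewrite YL.
have Lbr X Y : X \in L -> Y \in L -> X *m Y - Y *m X \in L.
  by move=> XL YL; have := Lb X; rewrite XL => /forallP/(_ Y); rewrite YL.
pose R := \matrix_(i < #|L|) mxvec (enum_val i).
pose S X := (mxvec X <= map_mx iota R)%MS.
have SL X : X \in L -> S (map_mx iota X).
  move=> XL; rewrite /S -map_mxvec map_submx.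
  have -> : mxvec X = row (enum_rank_in XL X) R by rewrite rowK enum_rankK_in.
  exact: row_sub.
have clS : lie_closed S.
  have SD a X Y : S X -> S Y -> S (a *: X + Y).
    by rewrite /S linearP => SX SY; apply: addmx_sub => //; apply: scalemx_sub.
  have S0 : S 0 by rewrite /S linear0 sub0mx.
  have SZ a X : S X -> S (a *: X) by move=> SX; rewrite -[_ *: _]addr0; apply: (SD).
  split=> // X Y SX SY.
  have gen X' : S X' -> exists c : 'I_#|L| -> K, X' = \sum_i c i *: map_mx iota (enum_val i).
    case/submxP => D eD; exists (D 0); apply: (can_inj mxvecK).
    rewrite eD mulmx_sum_row linear_sum; apply: eq_bigr => i _.
    by rewrite linearZ /= -map_row rowK map_mxvec.
  have [c ->] := gen _ SX; have [d ->] := gen _ SY.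
  have Ssum (I : finType) (f : I -> 'M[K]_n.+1) : (forall i, S (f i)) -> S (\sum_i f i).
    by move=> Sf; elim/big_ind: _ => // u v Su Sv; rewrite -[u]scale1r; apply: SD.
  rewrite mulmx_suml mulmx_sumr -sumrB; apply: (Ssum) => i.
  rewrite mulmx_sumr mulmx_suml -sumrB; apply: Ssum => j.
  rewrite -!scalemxAl -!scalemxAr !scalerA mulrC -scalerBr -!map_mxM -map_mxB.
  by apply: SZ; apply: SL; apply: Lbr; exact: (enum_valP _).
apply/subsetP => Z; rewrite inE => /eqP trZ.
have : S (map_mx iota Z) by apply: (H S clS SL); rewrite trace_map_mx trZ rmorph0.
rewrite /S -map_mxvec map_submx => /submxP[D eD].
have -> : Z = \sum_i D 0 i *: enum_val i.
  apply: (can_inj mxvecK); rewrite eD mulmx_sum_row linear_sum; apply: eq_bigr => i _.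
  by rewrite linearZ /= rowK.
elim/big_ind: _ => // [u v uL vL|i _]; first by rewrite -[u]scale1r; apply: Llin.
by rewrite -[_ *: _]addr0; apply: Llin => //; exact: (enum_valP _).
Qed.

Lemma lie_generate_closed (A B : 'M[F]_n.+1) :
  A \in sl n.+1 F -> B \in sl n.+1 F ->
  (forall S : 'M[K]_n.+1 -> Prop, lie_closed S -> S (map_mx iota A) -> S (map_mx iota B) ->
     forall Z, \tr Z = 0 -> S Z) ->
  lie_generate (sl n.+1 F) A B.
Proof.
move=> As Bs H; rewrite /lie_generate eqEsubset; apply/andP; split.
  apply: (bigcap_inf (sl n.+1 F)); rewrite subUset !sub1set As Bs !andbT.
  apply/and4P; split=> //.
  - by rewrite inE linear0.
  - apply/forallP => a; apply/forallP => X; apply/implyP; rewrite inE => /eqP X0.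
    apply/forallP => Y; apply/implyP; rewrite inE => /eqP Y0.
    by rewrite inE linearP /= X0 Y0 mulr0 addr0.
  apply/forallP => X; apply/implyP => _; apply/forallP => Y; apply/implyP => _.
  by rewrite inE /lie_bracket linearB /= mxtrace_mulC subrr.
apply/bigcapsP => L /andP[Lsub]; rewrite subUset !sub1set => /andP[AL BL].
by apply: sl_subset_span => // S clS SL; apply: H => //; apply: SL.
Qed.

End Generation.

(** * Frobenius descent *)

Lemma card_finField_pnat (F : finFieldType) : [pchar F].-nat #|F|.
Proof.
have [p pr chp] := finPcharP F; rewrite (eq_pnat _ (pcharf_eq chp)).
by rewrite (card_pprimeChar chp) pnatX pnat_id.
Qed.

Section Frobenius.
Variables (F : finFieldType) (K : fieldType) (iota : {rmorphism F -> K}).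

(** The embedding is an argument so that the ring morphism structure can be attached to the
    function: additivity holds because [iota] gives K the characteristic of F. *)
Definition frob of {rmorphism F -> K} := fun x : K => x ^+ #|F|.

Fact frob_zmod : zmod_morphism (frob iota).
Proof.
move=> x y; rewrite /frob.
have pn : [pchar K].-nat #|F|.
  by rewrite (eq_pnat _ (fmorph_pchar iota)) card_finField_pnat.
rewrite exprDn_pchar // exprNn; congr (_ + _).
have [p pr chp] := finPcharP F; have chK : p \in [pchar K] by rewrite (fmorph_pchar iota).
have qe := card_pprimeChar chp.
have [p2|po] := even_prime pr.
  have : (2%:R : K) = 0 by rewrite -p2 pcharf0.
  rewrite -[2%:R]/(1 + 1) => /eqP; rewrite addr_eq0 => /eqP e1.
  by rewrite -[RHS]mulN1r -!e1 expr1n.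
by rewrite -signr_odd qe oddX po orbT expr1 mulN1r.
Qed.

Fact frob_monoid : monoid_morphism (frob iota).
Proof. by split=> [|x y]; rewrite /frob ?expr1n ?exprMn. Qed.

HB.instance Definition _ := GRing.isZmodMorphism.Build K K (frob iota) frob_zmod.
HB.instance Definition _ := GRing.isMonoidMorphism.Build K K (frob iota) frob_monoid.

Lemma frob_iota a : frob iota (iota a) = iota a.
Proof. by rewrite /frob -rmorphXn expf_card. Qed.

Lemma frob_fixed x : frob iota x = x -> exists a, x = iota a.
Proof.
move=> /eqP; rewrite -subr_eq0 => xq.
have : root (map_poly iota ('X^#|F| - 'X)) x.
  by rewrite rmorphB /= map_polyXn map_polyX rootE !hornerE.
rewrite finField_genPoly rmorph_prod /= => /rootP; rewrite horner_prod => /eqP/prodf_eq0[a _].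
by rewrite rmorphB /= map_polyX map_polyC !hornerE subr_eq0 => /eqP ->; exists a.
Qed.

Lemma frobE i x : iter i (frob iota) x = x ^+ (#|F| ^ i)%N.
Proof. by elim: i => [|i IH] //=; rewrite IH /frob -exprM expnSr. Qed.

End Frobenius.

Definition irreducible_pair (F : fieldType) n (A B : 'M[F]_n) :=
  forall e (U : 'M[F]_(e, n)), (0 < e)%N -> row_free U ->
    (U *m A <= U)%MS -> (U *m B <= U)%MS -> e = n.

Section Descent.
Variables (F : finFieldType) (K : fieldType) (iota : {rmorphism F -> K}).
Notation frob := (frob iota).
Variable n : nat.

(* A vector of minimal support with an entry 1 differs from its Frobenius twist
   by a vector of smaller support. *)
Lemma frob_stable_vector (W : 'rV[K]_n -> Prop) :
  subspace W -> (forall w, W w -> W (map_mx frob w)) ->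
  forall w, W w -> w != 0 -> exists2 v : 'rV[F]_n, v != 0 & W (map_mx iota v).
Proof.
move=> [W0 WL] Wf w; have [m le_m] := ubnP #|[set i | w 0 i != 0]|.
elim: m w le_m => // m IH w le_m Ww w0.
have /existsP[r wr] : [exists r, w 0 r != 0].
  apply: contraNT w0; rewrite negb_exists => /forallP h.
  by apply/eqP/rowP => i; rewrite mxE; apply/eqP; rewrite -[_ == _]negbK.
have WZ a u : W u -> W (a *: u) by move=> Wu; rewrite -[_ *: _]addr0; apply: (WL).
pose u := (w 0 r)^-1 *: w.
have Wu : W u by exact: WZ.
have ur : u 0 r = 1 by rewrite mxE mulVf.
have u0 : u != 0 by apply/eqP => /rowP/(_ r)/eqP; rewrite ur mxE oner_eq0.
have [eu|nu] := eqVneq (map_mx frob u) u.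
  have h i : exists a, u 0 i = iota a.
    by apply: frob_fixed; move/rowP: eu => /(_ i); rewrite [LHS]mxE.
  have [v ev] : exists v : 'rV[F]_n, u = map_mx iota v.
    exists (\row_i sval (cid (h i))).
    by apply/rowP => i; rewrite [RHS]mxE [X in iota X]mxE; case: cid.
  exists v; last by rewrite -ev.
  by apply: contra_neq u0; rewrite ev => ->; rewrite map_mx0.
apply: (IH (map_mx frob u - u)); last 1 first.
- by rewrite subr_eq0.
- rewrite ltnS in le_m; apply: leq_trans le_m; rewrite (cardsD1 r [set i | w 0 i != 0]) inE wr add1n ltnS.
  apply: subset_leq_card; apply/subsetP => i; rewrite !inE => h.
  apply/andP; split.
    by apply: contraNneq h => ->; rewrite !mxE -[_ * _]/((w 0 r)^-1 * w 0 r) mulVf // rmorph1 subrr.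
  by apply: contraNneq h => wi; rewrite !mxE wi mulr0 rmorph0 subrr.
by rewrite addrC -scaleN1r; apply: WL => //; apply: Wf.
Qed.

(** Irreducibility over F does not survive extension to K; the hypothesis on the conjugate of x
    makes up for this. The least stable subspace containing x is then Frobenius stable, so it
    contains a nonzero vector over F; its vectors over F form a nonzero invariant subspace, which is
    everything. *)
Lemma irreducible_pair_orbit (A B : 'M[F]_n) (x : 'rV[K]_n) :
  irreducible_pair A B -> x != 0 ->
  let stable W := forall w, W w -> W (w *m map_mx iota A) /\ W (w *m map_mx iota B) in
  (forall W, subspace W -> stable W -> W x -> W (map_mx frob x)) ->
  forall W, subspace W -> stable W -> W x -> forall w, W w.
Proof.
move=> irr x0 stable Wx1 W sW stW Wx.
pose W0 w := forall W, subspace W -> stable W -> W x -> W w.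
have sW0 : subspace W0.
  split=> [|a u v Wu Wv] W' sW' stW' W'x; first by case: sW'.
  by case: (sW') => _; apply; [apply: Wu | apply: Wv].
have stW0 : stable W0.
  by move=> w Ww; split=> W' sW' stW' W'x; apply stW'; apply: Ww.
have frobM (w : 'rV[K]_n) (C : 'M[F]_n) :
    map_mx frob (w *m map_mx iota C) = map_mx frob w *m map_mx iota C.
  rewrite map_mxM; congr (_ *m _); apply/matrixP => i j; rewrite !mxE.
  exact: frob_iota.
have fW0 w : W0 w -> W0 (map_mx frob w).
  move=> Ww; apply: (Ww (fun w => W0 (map_mx frob w))).
  - split=> [|a u v Wu Wv]; first by rewrite map_mx0; case: sW0.
    by rewrite map_mxD map_mxZ; case: sW0 => _; apply.
  - by move=> u /stW0[h1 h2]; rewrite !frobM.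
  by move=> W' sW' stW' W'x; apply: Wx1.
have W0x : W0 x by [].
have [v v0 Wv] := frob_stable_vector sW0 fW0 W0x x0.
have [_ WL] := sW0.
pose D := [set v : 'rV[F]_n | `[< W0 (map_mx iota v) >]].
have DP u : reflect (W0 (map_mx iota u)) (u \in D) by rewrite inE; apply: asboolP.
have D0 : 0 \in D by apply/DP; rewrite map_mx0; case: sW0.
have DL a u u' : u \in D -> u' \in D -> a *: u + u' \in D.
  by move=> /DP Wu /DP Wu'; apply/DP; rewrite map_mxD map_mxZ; apply: WL.
pose R := \matrix_(i < #|D|) (enum_val i : 'rV[F]_n).
have RD u : (u <= R)%MS -> u \in D.
  case/submxP => c ->; rewrite mulmx_sum_row.
  elim/big_ind: _ => // [a b aD bD|i _]; first by rewrite -[a]scale1r; apply: DL.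
  by rewrite rowK -[_ *: _]addr0; apply: DL => //; apply: (enum_valP i).
have DR u : u \in D -> (u <= R)%MS.
  by move=> uD; rewrite -(enum_rankK_in uD uD) -(rowK (fun i => enum_val i : 'rV_n)); apply: row_sub.
have Rst C : (forall w, W0 w -> W0 (w *m map_mx iota C)) -> (row_base R *m C <= row_base R)%MS.
  move=> CW; rewrite (eqmxMr _ (eq_row_base R)) eq_row_base; apply/row_subP => i.
  rewrite row_mul rowK; apply: DR; apply/DP; rewrite map_mxM; apply: CW; apply/DP.
  exact: (enum_valP i).
have rR : \rank R = n.
  apply: (irr _ (row_base R)).
  - rewrite lt0n mxrank_eq0; apply: contraNneq v0 => R0.
    by have /submxP[c ->] : (v <= R)%MS by [apply/DR/DP]; rewrite R0 mulmx0.
  - exact: row_base_free.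
  - by apply: Rst => w /stW0[].
  - by apply: Rst => w /stW0[].
have all u : W0 (map_mx iota u).
  by apply/DP/RD/submx_full; rewrite /row_full rR.
move=> w; suff: W0 w by apply.
rewrite [w]row_sum_delta; case: sW0 => W00 _.
elim/big_ind: _ => // [a b Wa Wb|i _]; first by rewrite -[a]scale1r; apply: WL.
rewrite -[_ *: _]addr0; apply: WL => //.
by rewrite -(map_delta_mx iota); apply: all.
Qed.

End Descent.

Section GoodMatrix.
Variables (F : finFieldType) (K : fieldType) (iota : {rmorphism F -> K}).
Notation frob := (frob iota).
Variable n : nat.
Implicit Types (A B C : 'M[F]_n.+1).

(** The degree of l over F exceeds d, in the form in which it is used: evaluation at l is injective
    on polynomials of degree at most d. *)
Definition deg_gt (d : nat) (l : K) :=
  forall g : {poly F}, g != 0 -> root (map_poly iota g) l -> (d < (size g).-1)%N.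

Definition good_matrix (d : nat) A := exists (l : K) (rest : seq K),
  [/\ map_poly iota (char_poly A) = rprod [:: l, frob l, frob (frob l) & rest],
      sep3 l (frob l) (frob (frob l)) rest & deg_gt d l].

Definition conj_row (i : nat) (x : 'rV[K]_n.+1) := iter i (map_mx frob) x.
Definition conj_col (i : nat) (y : 'cV[K]_n.+1) := iter i (map_mx frob) y.

Definition corner (x : 'rV[K]_n.+1) (y : 'cV[K]_n.+1) B (i j : nat) :=
  dot (conj_row i x) (map_mx iota B *m conj_col j y).

(* The determinant that decides whether the combinations of the [y_i *m x_j] extracted from B separate. *)
Definition triangle_form (a b : K) x y B :=
  a * (corner x y B 0 1 * corner x y B 1 2 * corner x y B 2 0) +
  b * (corner x y B 1 0 * corner x y B 2 1 * corner x y B 0 2).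

Lemma map_frob_mul m (w : 'M[K]_(m, n.+1)) C :
  map_mx frob (w *m map_mx iota C) = map_mx frob w *m map_mx iota C.
Proof.
rewrite map_mxM; congr (_ *m _); apply/matrixP => i j; rewrite !mxE.
exact: frob_iota.
Qed.

Lemma map_frob_mulr m (w : 'M[K]_(n.+1, m)) C :
  map_mx frob (map_mx iota C *m w) = map_mx iota C *m map_mx frob w.
Proof.
rewrite map_mxM; congr (_ *m _); apply/matrixP => i j; rewrite !mxE.
exact: frob_iota.
Qed.

(** Since A has entries in F, the Frobenius conjugates of one dual pair (x, y) are dual eigenvectors
    for the conjugate eigenvalues. *)
Lemma good_matrix_generate d A : good_matrix d A -> A \in sl n.+1 F ->
  exists (l a b : K) (x : 'rV[K]_n.+1) (y : 'cV[K]_n.+1),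
  [/\ deg_gt d l, a != 0, b != 0 & [/\ x *m map_mx iota A = l *: x,
      map_mx iota A *m y = l *: y,
      forall i j : 'I_3, dot (conj_row i x) (conj_col j y) = (i == j)%:R
    & forall B, B \in sl n.+1 F -> irreducible_pair A B -> irreducible_pair A^T B^T ->
      triangle_form a b x y B != 0 -> lie_generate (sl n.+1 F) A B]].
Proof.
move=> [l [rest [chA s3 dl]]] As.
have chA' : char_poly (map_mx iota A) = rprod [:: l, frob l, frob (frob l) & rest].
  by rewrite -map_char_poly.
have lN : l \notin [:: frob l, frob (frob l) & rest].
  by case/and3P: (s3) => /sep_notin/andP[].
have [x [y [xA Ay xy]]] := eigenpair_exists chA' (perm_refl _) lN.
pose l_ (i : 'I_3) := iter i frob l.
pose x_ (i : 'I_3) := conj_row i x; pose y_ (i : 'I_3) := conj_col i y.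
have xA_ i : x_ i *m map_mx iota A = l_ i *: x_ i.
  rewrite /x_ /l_ /conj_row; elim: (nat_of_ord i) => //= m IH.
  by rewrite -map_frob_mul IH map_mxZ.
have Ay_ i : map_mx iota A *m y_ i = l_ i *: y_ i.
  rewrite /y_ /l_ /conj_col; elim: (nat_of_ord i) => //= m IH.
  by rewrite -map_frob_mulr IH map_mxZ.
have xy_ i : x_ i *m y_ i = 1%:M.
  rewrite /x_ /y_ /conj_row /conj_col; elim: (nat_of_ord i) => //= m IH.
  by rewrite -map_mxM IH map_mx1.
set i0 : 'I_3 := inord 0; set i1 : 'I_3 := inord 1; set i2 : 'I_3 := inord 2.
have [v0 v1 v2] : [/\ i0 = 0%N :> nat, i1 = 1%N :> nat & i2 = 2%N :> nat].
  by rewrite !inordK.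
have pe : perm_eq [:: l, frob l, frob (frob l) & rest] [:: l_ i0, l_ i1, l_ i2 & rest].
  by rewrite /l_ v0 v1 v2.
have s3' : sep3 (l_ i0) (l_ i1) (l_ i2) rest by rewrite /l_ v0 v1 v2.
have [a [b [a0 b0 units]]] := matrix_units chA' pe s3' xA_ Ay_ xy_.
have inj : injective l_.
  case/and3P: s3' => /sep_notin/andP[+ _] /sep_notin/andP[+ _] /sep_notin/andP[+ _].
  rewrite !inE !negb_or => /and3P[n01 _ _] /and3P[n12 _ _] /and3P[n02 _ _].
  have I3 (i : 'I_3) : [\/ i = i0, i = i1 | i = i2].
    case: i => [[|[|[|//]]] Hi]; [constructor 1|constructor 2|constructor 3];
    by apply: val_inj; rewrite /= inordK.
  by move=> i j; case: (I3 i) => ->; case: (I3 j) => -> // /eqP;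
    rewrite ?(negPf n01) ?(negPf n12) ?(negPf n02) // eq_sym ?(negPf n01) ?(negPf n12) ?(negPf n02).
have orth := matrix_units_orth inj xA_ Ay_ xy_.
exists l, a, b, x, y; split=> //; split=> // B Bs irr irrT N0.
apply: (lie_generate_closed (iota := iota)) => // S clS SA SB.
have N0' : a * (dot (x_ i0) (map_mx iota B *m y_ i1) * dot (x_ i1) (map_mx iota B *m y_ i2) *
      dot (x_ i2) (map_mx iota B *m y_ i0)) +
  b * (dot (x_ i1) (map_mx iota B *m y_ i0) * dot (x_ i2) (map_mx iota B *m y_ i1) *
      dot (x_ i0) (map_mx iota B *m y_ i2)) != 0.
  by move: N0; rewrite /triangle_form /corner /x_ /y_ v0 v1 v2.
have i0E : ord0 = i0 by apply: val_inj; rewrite /= v0.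
have x0n : x != 0.
  apply: contra_eq_neq xy => ->; rewrite mul0mx eq_sym -scalemx1 scale1r.
  by apply/eqP => /matrixP/(_ 0 0)/eqP; rewrite !mxE oner_eq0.
have y0n : y^T != 0.
  apply: contra_eq_neq xy => /(congr1 trmx); rewrite trmxK trmx0 => ->; rewrite mulmx0 eq_sym -scalemx1 scale1r.
  by apply/eqP => /matrixP/(_ 0 0)/eqP; rewrite !mxE oner_eq0.
have ne01 : i0 != i1 by rewrite -val_eqE /= v0 v1.
apply: (lie_closed_contains_sl clS orth).
- exact: units N0'.
- move=> W sW WS; rewrite i0E /y_ v0 => Wy w.
  have sT (W' : 'cV[K]_n.+1 -> Prop) : subspace W' -> subspace (fun u => W' u^T).
    by case=> W'0 W'L; split=> [|c u v Wu Wv]; rewrite ?trmx0 // linearP; apply: W'L.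
  rewrite -[w]trmxK.
  apply: (irreducible_pair_orbit (iota := iota) irrT y0n _ (sT _ sW)).
  + move=> W' sW' stW' W'y.
    (* The matrices preserving W' form a Lie closed set containing A and B, hence y_1 x_0, which
       sends y_0 to its Frobenius conjugate y_1. *)
    pose S0 (C : 'M[K]_n.+1) := forall u, W' u^T -> W' (C *m u)^T.
    have [W'0 W'L] := sW'.
    have clS0 : lie_closed S0.
      split=> [u Wu|c X Y SX SY u Wu|X Y SX SY u Wu].
      - by rewrite mul0mx trmx0.
      - by rewrite mulmxDl -scalemxAl linearP; apply: W'L; [apply: SX | apply: SY].
      - rewrite mulmxBl addrC -scaleN1r linearP -!mulmxA.
        by apply: W'L; [apply/SY/SX | apply/SX/SY].
    have tr_iota (C : 'M[F]_n.+1) (u : 'cV[K]_n.+1) :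
        (map_mx iota C *m u)^T = u^T *m map_mx iota C^T.
      by rewrite trmx_mul map_trmx.
    have S0A : S0 (map_mx iota A).
      by move=> u Wu; rewrite tr_iota; case: (stW' _ Wu).
    have S0B : S0 (map_mx iota B).
      by move=> u Wu; rewrite tr_iota; case: (stW' _ Wu).
    have ne10 : i1 != i0 by rewrite eq_sym.
    have := units _ _ clS0 S0A S0B N0' _ _ ne10 y W'y.
    rewrite -mulmxA; have -> : x_ i0 = x by rewrite /x_ v0.
    by rewrite xy mulmx1 /y_ v1 /= map_trmx.
  + move=> u Wu; split.
      by rewrite -[u *m _]trmxK trmx_mul trmxK map_trmx trmxK; apply: WS.
    by rewrite -[u *m _]trmxK trmx_mul trmxK map_trmx trmxK; apply: WS.
  by rewrite trmxK.
- move=> W sW WS; rewrite i0E /x_ v0 => Wx w.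
  apply: (irreducible_pair_orbit (iota := iota) irr x0n _ sW _ Wx); last first.
    by move=> u Wu; split; apply: WS.
  move=> W' sW' stW' W'x.
  pose S0 (C : 'M[K]_n.+1) := forall u, W' u -> W' (u *m C).
  have [W'0 W'L] := sW'.
  have clS0 : lie_closed S0.
    split=> [u Wu|c X Y SX SY u Wu|X Y SX SY u Wu].
    - by rewrite mulmx0.
    - by rewrite mulmxDr -scalemxAr; apply: W'L; [apply: SX | apply: SY].
    - rewrite mulmxBr addrC -scaleN1r !mulmxA.
      by apply: W'L; [apply/SX/SY | apply/SY/SX].
  have := units _ _ clS0 (fun u Wu => (stW' u Wu).1) (fun u Wu => (stW' u Wu).2) N0' _ _ ne01 x W'x.
  rewrite mulmxA; have -> : y_ i0 = y by rewrite /y_ v0.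
  by rewrite xy mul1mx /x_ v1.
Qed.

End GoodMatrix.

(** * Counting reducible pairs and zeros of the cubic form *)

Lemma leq_card_inj_set (T T' : finType) (f : T -> T') (X : {set T}) (Y : {set T'}) :
  {in X &, injective f} -> (forall x, x \in X -> f x \in Y) -> (#|X| <= #|Y|)%N.
Proof.
move=> inj sub; rewrite -(card_in_imset inj); apply: subset_leq_card.
by apply/subsetP => _ /imsetP[x Xx ->]; apply: sub.
Qed.

Section ReducibleCount.
Variables (F : finFieldType) (N : nat).
Local Notation q := #|F|.

(** In a basis extending U the stable matrices have zero upper right block; translating them by the
    q^(k m) matrices supported in that block gives disjoint sets. *)
Lemma card_stable k m (U : 'M[F]_(k, k + m)) : row_free U ->
  (#|[set A : 'M[F]_(k + m) | (U *m A <= U)%MS]| * q ^ (k * m) <= q ^ ((k + m) ^ 2))%N.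
Proof.
move=> fU; have [M uM MU] := row_free_completion fU.
rewrite -(card_mx F k m) -cardsT -cardsX -mulnn -card_mx -cardsT.
pose dl (Z : 'M[F]_(k, m)) := invmx M *m block_mx 0 Z 0 0 *m M.
apply: (@leq_card_inj_set _ _ (fun p => p.1 + dl p.2)) => [[A Z] [B Z']|p _]; last by rewrite inE.
rewrite !inE /= !andbT => UA UB e.
have UM : U *m invmx M = row_mx 1%:M 0.
  rewrite -MU mul_usub_mx mulmxV // (scalar_mx_block k m) block_mxEv.
  by rewrite col_mxKu.
have Udl W : U *m dl W = row_mx 0 W *m M.
  rewrite /dl !mulmxA UM mul_row_block !mul0mx !mulmx0 !mul1mx !addr0 //.
have dB : dl Z - dl Z' = dl (Z - Z').
  rewrite /dl -mulmxBl -mulmxBr opp_block_mx add_block_mx ?oppr0 ?subrr ?addr0 //.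
have : (U *m (B - A) <= U)%MS by rewrite mulmxBr addmx_sub // eqmx_opp.
have -> : B - A = dl (Z - Z').
  have h : B = A + (dl Z - dl Z') by rewrite addrA e addrK.
  by rewrite -dB {1}h addrC addKr.
rewrite Udl => /submxP[D eD].
have : row_mx 0 (Z - Z') = D *m row_mx 1%:M 0 :> 'M_(k, k + m).
  by rewrite -UM mulmxA -eD mulmxK.
rewrite mul_mx_row mulmx0 => /eq_row_mx[_ /eqP].
rewrite subr_eq0 => /eqP ZZ; congr (_, _) => //.
by move: e; rewrite ZZ => /addIr.
Qed.

Lemma card_stable_sub e N' (U : 'M[F]_(e, N')) : (e <= N')%N -> row_free U ->
  (#|[set A : 'M[F]_N' | (U *m A <= U)%MS]| * q ^ (e * (N' - e)) <= q ^ (N' ^ 2))%N.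
Proof.
move=> eN; have [m eN'] : exists m, N' = (e + m)%N by exists (N' - e)%N; rewrite subnKC.
move: U; rewrite eN' => U fU.
by rewrite addKn; apply: card_stable.
Qed.

(** After division, the product of the 1 - q^(-i) for i up to e is at least 1/4 + 1/(2 q^e). The
    second term makes the induction work; for q = 2 and e = 1 there is equality. *)
Lemma prod_expn_sub1 e : (1 < q -> 0 < e ->
  q ^ 'C(e.+1, 2) * (q ^ e + 2) <= (\prod_(1 <= i < e.+1) (q ^ i - 1)) * (4 * q ^ e))%N.
Proof.
move=> q1; case: e => // e _; elim: e => [|e IH].
  rewrite big_nat1 binn !expn1.
  nia.
rewrite big_nat_recr //= binS bin1.
have := IH; set P := \prod_(_ <= i < _) _; set c := 'C(_, _).
rewrite !(expnS q e.+1) expnD (expnS q e.+1).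
have t2 : (2 <= q ^ e.+1)%N by rewrite (leq_trans q1) // -{1}(expn1 q) leq_exp2l.
set t := (q ^ e.+1)%N in t2 *.
move=> H.
have : (q ^ c * (t + 2) * ((q * t - 1) * q) <= P * (4 * t) * ((q * t - 1) * q))%N by rewrite leq_mul2r H orbT.
move=> H2; apply: leq_trans (_ : q ^ c * (t + 2) * ((q * t - 1) * q) <= _)%N; last first.
  by apply: (leq_trans H2); rewrite leq_eqVlt; apply/orP; left; apply/eqP; lia.
have : (t * (q * t + 2) <= (t + 2) * (q * t - 1))%N by nia.
move=> H3; have := leq_mul (leqnn (q ^ c * q)%N) H3.
set s := (q * t - 1)%N => H4.
have -> : (q ^ c * (q * t) * (q * t + 2) = q ^ c * q * (t * (q * t + 2)))%N by ring.
by apply: (leq_trans H4); rewrite leq_eqVlt; apply/orP; left; apply/eqP; ring.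
Qed.

Lemma card_GL_ge e : (0 < e)%N -> (q ^ (e ^ 2) <= 4 * #|'GL_e[F]%g|)%N.
Proof.
move=> e0; have q1 := finRing_gt1 F.
have := prod_expn_sub1 q1 e0; rewrite card_GL //.
set P := \prod_(_ <= i < _) _ => H.
have qe : (0 < q ^ e)%N by rewrite expn_gt0 (ltnW q1).
have H1 : (q ^ 'C(e.+1, 2) <= P * 4)%N.
  rewrite -(leq_pmul2r qe); apply: leq_trans (_ : _ <= P * (4 * q ^ e))%N _; last by lia.
  by apply: leq_trans H; rewrite leq_mul2l leq_addr orbT.
have -> : (e ^ 2 = 'C(e, 2) + 'C(e.+1, 2))%N.
  elim: (e) => // k IH; rewrite (binS k.+1) bin1 (binS k) bin1.
  by move: IH; rewrite binS bin1 -!mulnn; lia.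
by rewrite expnD; have := leq_mul (leqnn (q ^ 'C(e, 2))%N) H1; lia.
Qed.

Definition stable_pair e (AB : 'M[F]_N * 'M[F]_N) (U : 'M[F]_(e, N)) :=
  [&& row_free U, (U *m AB.1 <= U)%MS & (U *m AB.2 <= U)%MS].

(** Count pairs together with a basis U of a stable subspace: there are at most q^(eN) choices of U,
    and each of the two matrices costs a factor q^(e(N-e)). Each reducible pair occurs at least
    |GL_e| times, which is at least q^(e^2)/4, and eN - e^2 = e(N-e) leaves one factor of gain. *)
Lemma card_reducible e : (0 < e < N)%N ->
  (#|[set AB | [exists U, stable_pair (e := e) AB U]]| * q ^ (e * (N - e)) <= 4 * q ^ (2 * N ^ 2))%N.
Proof.
move=> /andP[e0 eN]; set R := [set AB | _].
have q0 : (0 < q)%N := ltnW (finRing_gt1 F).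
pose T := [set t : 'M[F]_(e, N) * ('M[F]_N * 'M[F]_N) | stable_pair t.2 t.1].
have cT : (#|T| * q ^ (e * (N - e)) * q ^ (e * (N - e)) <= q ^ (e * N) * q ^ (2 * N ^ 2))%N.
  have -> : #|T| = (\sum_(U : 'M[F]_(e, N)) #|[set AB | stable_pair AB U]|)%N.
    rewrite -sum1_card (eq_bigl (fun t : _ * _ => predT t.1 && stable_pair t.2 t.1)).
      rewrite -(pair_big_dep predT (fun U AB => stable_pair AB U) (fun _ _ => 1%N)) /=.
      by apply: eq_bigr => U _; rewrite sum1dep_card.
    by move=> t; rewrite inE.
  apply: (@leq_trans (\sum_(U : 'M[F]_(e, N)) q ^ (2 * N ^ 2))%N); last first.
    by rewrite sum_nat_const card_mx.
  rewrite !big_distrl /=; apply: leq_sum => U _.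
  have [fU|nU] := boolP (row_free U); last first.
    rewrite (_ : [set AB | _] = set0) ?cards0 //; apply/setP => AB.
    by rewrite !inE /stable_pair (negPf nU).
  rewrite (_ : [set AB | _] = setX [set A | (U *m A <= U)%MS] [set A | (U *m A <= U)%MS]); last first.
    by apply/setP => AB; rewrite !inE /stable_pair fU.
  rewrite cardsX -mulnA mulnACA mul2n -addnn expnD.
  have : (#|[set A : 'M[F]_N | (U *m A <= U)%MS]| * q ^ (e * (N - e)) <= q ^ (N ^ 2))%N.
    exact: card_stable_sub (ltnW eN) fU.
  by move=> h; rewrite leq_mul.
have cR : (#|R| * #|'GL_e[F]%g| <= #|T|)%N.
  case: e e0 eN @R @T {cT} => // e _ eN R T; rewrite -cardsX.
  pose Uof AB := odflt 0 [pick U | stable_pair (e := e.+1) AB U].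
  have UofP AB : AB \in R -> stable_pair AB (Uof AB).
    rewrite inE => /existsP[U sU]; rewrite /Uof; case: pickP => //= /(_ U).
    by rewrite sU.
  apply: (@leq_card_inj_set _ _ (fun p : _ * {'GL_e.+1[F]} => (GLval p.2 *m Uof p.1, p.1))).
    move=> [AB g] [AB' g'] /setXP[hR _] _ /= [+ eAB]; rewrite -eAB.
    have /and3P[fU _ _] := UofP _ hR.
    by move/(row_free_inj fU) => eg; congr (_, _); apply: val_inj.
  move=> [AB g] /setXP[hR _]; rewrite inE /=.
  have /and3P[fU sA sB] := UofP AB hR.
  have gU := GL_unitmx g.
  have eqU : (GLval g *m Uof AB :=: Uof AB)%MS by apply: eqmxMfull; rewrite row_full_unit.
  apply/and3P; split => /=.
  - by rewrite /row_free eqU; apply: fU.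
  - by rewrite (eqmxMr _ eqU) eqU; apply: sA.
  - by rewrite (eqmxMr _ eqU) eqU; apply: sB.
have gl := card_GL_ge e0.
have qp k : (0 < q ^ k)%N by rewrite expn_gt0 q0.
rewrite -(leq_pmul2r (qp (e * N)%N)).
have eNE : (e * N = e ^ 2 + e * (N - e))%N by rewrite -mulnn -mulnDr subnKC // ltnW.
have h1 : (#|R| * q ^ (e ^ 2) <= 4 * #|T|)%N.
  apply: leq_trans (_ : #|R| * (4 * #|'GL_e[F]%g|) <= _)%N; first by rewrite leq_mul2l gl orbT.
  by rewrite mulnCA leq_mul2l cR orbT.
have h2 := leq_mul h1 (leqnn (q ^ (e * (N - e)) * q ^ (e * (N - e)))%N).
rewrite {1}eNE expnD.
apply: leq_trans (_ : 4 * (#|T| * q ^ (e * (N - e)) * q ^ (e * (N - e))) <= _)%N; first by lia.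
by rewrite -[X in (_ <= X)%N]mulnA leq_mul2l /= (mulnC (q ^ (2 * _))%N).
Qed.

End ReducibleCount.

Lemma card_bigcup_leq (T I : finType) (P : pred I) (E : I -> {set T}) :
  (#|\bigcup_(i | P i) E i| <= \sum_(i | P i) #|E i|)%N.
Proof.
elim/big_rec2: _ => [|i k X _ le]; first by rewrite cards0.
by apply: (leq_trans (leq_card_setU _ _)); rewrite leq_add2l.
Qed.

Lemma card_reducible_pairs (F : finFieldType) N :
  (#|[set AB : 'M[F]_N * 'M[F]_N | ~~ `[< irreducible_pair AB.1 AB.2 >]]| * #|F| ^ N.-1
    <= 4 * N * #|F| ^ (2 * N ^ 2))%N.
Proof.
set X := [set _ | _].
have sub : X \subset \bigcup_(e : 'I_N | (0 < e)%N)
    [set AB | [exists U, stable_pair (e := e) AB U]].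
  apply/subsetP => AB; rewrite inE => /asboolPn nirr.
  have [e [U [e0 fU UA UB eN]]] : exists e (U : 'M[F]_(e, N)),
      [/\ (0 < e)%N, row_free U, (U *m AB.1 <= U)%MS, (U *m AB.2 <= U)%MS & e <> N].
    apply: contrapT => h; apply: nirr => e U e0 fU UA UB.
    by apply: contrapT => eN; apply: h; exists e, U.
  have eltN : (e < N)%N.
    by rewrite ltn_neqAle; apply/andP; split; [apply/eqP | rewrite -(eqP fU) rank_leq_col].
  apply/bigcupP; exists (Ordinal eltN) => //.
  by rewrite inE; apply/existsP; exists U; apply/and3P.
apply: leq_trans (_ : (\sum_(e : 'I_N | (0 < e)%N)
    #|[set AB | [exists U, stable_pair (e := e) AB U]]|) * #|F| ^ N.-1 <= _)%N.
  by apply: leq_mul => //; apply: leq_trans (subset_leq_card sub) (card_bigcup_leq _ _).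
rewrite big_distrl /= -mulnA mulnCA -[X in (X * _)%N]card_ord -sum_nat_const.
rewrite big_mkcond; apply: leq_sum => e _; case: ifP => // e0.
have eN : (0 < e < N)%N by rewrite e0 ltn_ord.
apply: leq_trans (card_reducible F eN); rewrite leq_mul2l leq_pexp2l ?orbT //.
  exact: ltnW (finRing_gt1 F).
(* This is e (N - e) >= N - 1 for 0 < e < N. *)
by move: eN; move: (nat_of_ord e) => a; nia.
Qed.

(** The cubic form takes this shape along a line of matrices. The coefficient [c4] of t^(1+q)
    survives in the polynomial because 1 + q differs from the seven other exponents, for q = 2 as
    well. *)
Lemma sparse_poly_roots (K : fieldType) q (c0 c1 c2 c3 c4 c5 c6 c7 : K) (ts : seq K) :
  (1 < q)%N -> c4 != 0 -> uniq ts ->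
  {in ts, forall t, c0 + c1 * t + c2 * t ^+ q + c3 * t ^+ (q ^ 2) + c4 * (t * t ^+ q)
    + c5 * (t * t ^+ (q ^ 2)) + c6 * (t ^+ q * t ^+ (q ^ 2))
    + c7 * (t * t ^+ q * t ^+ (q ^ 2)) = 0} ->
  (size ts <= q ^ 2 + q + 1)%N.
Proof.
move=> q1 c40 uts rts.
pose es := [:: (0, c0); (1, c1); (q, c2); (q ^ 2, c3); (1 + q, c4); (1 + q ^ 2, c5);
  (q + q ^ 2, c6); (1 + q + q ^ 2, c7)]%N.
pose Q := \sum_(e <- es) e.2 *: 'X^(e.1).
have Q0 : Q != 0.
  apply: contra_neq c40 => /(congr1 (fun p : {poly K} => p`_(1 + q))).
  rewrite /Q /es !big_cons big_nil !coefD !coefZ !coefXn coef0 ![(_, _).1]/= ![(_, _).2]/=.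
  have q2 : (q + 2 <= q ^ 2)%N by rewrite -mulnn; nia.
  have -> : (1 + q == 0)%N = false by [].
  have -> : (1 + q == 1)%N = false by apply/eqP; lia.
  have -> : (1 + q == q)%N = false by apply/eqP; lia.
  have -> : (1 + q == q ^ 2)%N = false by apply/eqP; set Q2 := (q ^ 2)%N in q2 *; lia.
  have -> : (1 + q == 1 + q ^ 2)%N = false by apply/eqP; set Q2 := (q ^ 2)%N in q2 *; lia.
  have -> : (1 + q == q + q ^ 2)%N = false by apply/eqP; set Q2 := (q ^ 2)%N in q2 *; lia.
  have -> : (1 + q == 1 + q + q ^ 2)%N = false by apply/eqP; set Q2 := (q ^ 2)%N in q2 *; lia.
  by rewrite eqxx !mulr0 mulr1 !add0r !addr0.
have sQ : (size Q <= q ^ 2 + q + 2)%N.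
  apply: (leq_trans (size_sum _ _ _)); apply/bigmax_leqP_seq => e + _.
  rewrite /es !inE => h; apply: (leq_trans (size_scale_leq _ _)); rewrite size_polyXn.
  have : (e.1 <= q ^ 2 + q + 1)%N.
    by move: h; do 7! (case/orP; first by move=> /eqP -> /=; lia); move=> /eqP -> /=; lia.
  by rewrite addn1 addn2 ltnS.
have rQ : all (root Q) ts.
  apply/allP => t /rts h; rewrite rootE /Q /es; apply/eqP; rewrite -[RHS]h.
  rewrite !big_cons big_nil !hornerD !hornerZ !hornerXn horner0 ![(_, _).1]/= ![(_, _).2]/=.
  by rewrite !exprD expr0 !expr1; set T1 := t ^+ q; set T2 := t ^+ _; ring.
rewrite -ltnS -addnS; apply: leq_trans sQ; exact: max_poly_roots.
Qed.

Lemma card_fibers (T : finType) (R : eqType) (f : T -> R) (S : {set T}) (ts : seq R) Q M :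
  (forall z, z \in S -> f z \in ts) ->
  (forall t, #|[set z | f z == t]| * Q <= M)%N -> (#|S| * Q <= size ts * M)%N.
Proof.
move=> + fib; elim: ts S => [|t ts IH] S Sts.
  by rewrite (_ : S = set0) ?cards0 //; apply/setP => z; rewrite inE; apply/negP => /Sts.
rewrite -(cardsID [set z | f z == t]) mulnDl mulSn leq_add //.
  by apply: leq_trans (fib t); rewrite leq_mul2r subset_leq_card ?orbT ?subsetIr.
by apply: IH => z; rewrite !inE => /andP[/negPf ft /Sts]; rewrite inE ft.
Qed.

Lemma dotZr (K : fieldType) n (x : 'rV[K]_n.+1) c (y : 'cV[K]_n.+1) :
  dot x (c *: y) = c * dot x y.
Proof. by rewrite /dot -scalemxAr mxE. Qed.

Lemma dot_addr (K : fieldType) n (x : 'rV[K]_n.+1) (y y' : 'cV[K]_n.+1) :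
  dot x (y + y') = dot x y + dot x y'.
Proof. by rewrite /dot mulmxDr mxE. Qed.

(** * Zeros of the cubic form *)

Section TriangleCount.
Variables (F : finFieldType) (K : fieldType) (iota : {rmorphism F -> K}).
Local Notation q := #|F|.
Notation frob := (frob iota).
Variables (n d : nat).
Implicit Types (A B : 'M[F]_n.+1).

Lemma frob_inj i : injective (iter i frob).
Proof. by elim: i => //= i IH x y /fmorph_inj/IH. Qed.

Lemma conj_row_mul i (x : 'rV[K]_n.+1) (z : 'cV[F]_n.+1) :
  conj_row iota i x *m map_mx iota z = map_mx (iter i frob) (x *m map_mx iota z).
Proof.
rewrite /conj_row; elim: i => [|i IH] /=.
  by apply/matrixP => a b; rewrite !mxE.
have -> : map_mx (iter i.+1 frob) (x *m map_mx iota z) =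
    map_mx frob (map_mx (iter i frob) (x *m map_mx iota z)).
  by apply/matrixP => a b; rewrite !mxE.
rewrite -IH map_mxM; congr (_ *m _); apply/matrixP => a b; rewrite !mxE.
by apply/esym; exact: frob_iota.
Qed.

Lemma conj_colE i (y : 'cV[K]_n.+1) s : conj_col iota i y s 0 = iter i frob (y s 0).
Proof. by rewrite /conj_col; elim: i => //= i IH; rewrite mxE IH. Qed.

Lemma iter_frob_eq0 i x : (iter i frob x == 0) = (x == 0).
Proof. by elim: i => //= i IH; rewrite fmorph_eq0. Qed.

Variables (A : 'M[F]_n.+1) (l : K) (x : 'rV[K]_n.+1) (y : 'cV[K]_n.+1).
Hypothesis dl : deg_gt iota d l.
Hypothesis xA : x *m map_mx iota A = l *: x.
Hypothesis x_neq0 : x != 0.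
Hypothesis y_neq0 : y != 0.

Lemma row_entry_neq0 : exists r, x 0 r != 0.
Proof.
apply: contrapT => h; case/eqP: x_neq0; apply/rowP => r; rewrite mxE.
by apply: contrapT => /eqP h'; apply: h; exists r.
Qed.

Let r := sval (cid row_entry_neq0).
Let xr : x 0 r != 0. Proof. exact: (svalP (cid row_entry_neq0)). Qed.

(* The entries of x span an F[l]-module: x z = g(l) x_r for z = g(A) e_r. *)
Definition krylov_col (c : 'rV[F]_d.+1) : 'cV[F]_n.+1 :=
  horner_mx A (rVpoly c) *m delta_mx r 0.

Lemma krylov_colB c c' : krylov_col (c - c') = krylov_col c - krylov_col c'.
Proof. by rewrite /krylov_col linearB /= rmorphB /= mulmxBl. Qed.

Lemma row_krylov_eq0 c : x *m map_mx iota (krylov_col c) = 0 -> c = 0.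
Proof.
rewrite /krylov_col map_mxM mulmxA map_horner_mx (horner_mx_eigen_row _ xA).
rewrite -scalemxAl map_delta_mx -colE => /matrixP/(_ 0 0)/eqP.
rewrite !mxE mulf_eq0 (negPf xr) orbF => rt; apply: contraTeq isT => c0.
have g0 : rVpoly c != 0.
  by apply: contra_neq c0 => h; rewrite -[c]rVpolyK h linear0.
have := dl g0 rt; rewrite ltnNge -ltnS prednK ?size_poly_gt0 ?g0 //.
by rewrite size_poly.
Qed.

(** The translates of a fibre by the q^(d+1) columns g(A) e_r, with g of degree at most d, are
    disjoint, because x takes distinct values on these columns. *)
Lemma card_row_fiber (t : 'M[K]_1) :
  (#|[set z : 'cV[F]_n.+1 | x *m map_mx iota z == t]| * q ^ d.+1 <= q ^ n.+1)%N.
Proof.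
have -> : (q ^ d.+1 = #|[set: 'rV[F]_d.+1]|)%N by rewrite cardsT card_mx mul1n.
have -> : (q ^ n.+1 = #|[set: 'cV[F]_n.+1]|)%N by rewrite cardsT card_mx muln1.
rewrite -cardsX.
apply: (@leq_card_inj_set _ _ (fun p => p.1 + krylov_col p.2)) => [[z c] [z' c']|p _]; last by rewrite inE.
rewrite !inE /= !andbT => /eqP xz /eqP xz' e.
have cc : c = c'.
  apply/eqP; rewrite -subr_eq0; apply/eqP/row_krylov_eq0.
  have -> : krylov_col (c - c') = z' - z.
    by rewrite krylov_colB; apply/eqP; rewrite subr_eq addrAC eq_sym subr_eq -e addrC.
  by rewrite map_mxB mulmxBr xz xz' subrr.
by congr (_, _) => //; move: e; rewrite cc => /addIr.
Qed.

(** The same translations, placed in a column s with w_s nonzero. *)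
Lemma card_linear_form i (w : 'cV[K]_n.+1) : w != 0 ->
  (#|[set B | conj_row iota i x *m map_mx iota B *m w == 0%R]| * q ^ d.+1 <= q ^ (n.+1 ^ 2))%N.
Proof.
move=> w0; have [s ws] : exists s, w s 0 != 0.
  apply: contrapT => h; case/eqP: w0; apply/colP => s; rewrite mxE.
  by apply: contrapT => /eqP h'; apply: h; exists s.
have -> : (q ^ d.+1 = #|[set: 'rV[F]_d.+1]|)%N by rewrite cardsT card_mx mul1n.
have -> : (q ^ (n.+1 ^ 2) = #|[set: 'M[F]_n.+1]|)%N by rewrite cardsT card_mx mulnn.
rewrite -cardsX.
apply: (@leq_card_inj_set _ _ (fun p => p.1 + krylov_col p.2 *m delta_mx 0 s))
  => [[B c] [B' c']|p _]; last by rewrite inE.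
rewrite !inE /= !andbT => /eqP xB /eqP xB' e.
have cc : c = c'.
  apply/eqP; rewrite -subr_eq0; apply/eqP/row_krylov_eq0.
  have eB : krylov_col (c - c') *m delta_mx 0 s = B' - B.
    by rewrite krylov_colB mulmxBl; apply/eqP; rewrite subr_eq addrAC eq_sym subr_eq -e addrC.
  have : conj_row iota i x *m map_mx iota (krylov_col (c - c') *m delta_mx 0 s) *m w = 0.
    by rewrite eB map_mxB mulmxBr mulmxBl xB xB' subrr.
  rewrite map_mxM map_delta_mx mulmxA -mulmxA -rowE conj_row_mul => /matrixP/(_ 0 0)/eqP.
  rewrite mxE big_ord1 [X in X * _ == _]mxE [X in _ * X == _]mxE [X in _ == X]mxE.
  rewrite mulf_eq0 (negPf ws) orbF iter_frob_eq0 => /eqP h.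
  by apply/matrixP => a b; rewrite !ord1 h mxE.
by congr (_, _) => //; move: e; rewrite cc => /addIr.
Qed.

Variables (a b : K).
Hypothesis a0 : a != 0.
Hypothesis orth : forall i j : 'I_3, dot (conj_row iota i x) (conj_col iota j y) = (i == j)%:R.

(** Adding z to column s of B adds t^(q^i) e_j to the entry x_i B y_j, where t = x z, so the form
    becomes a polynomial in t with few roots, unless it is zero. Its top coefficient contains a + b,
    which may vanish; the coefficient of t^(1+q) is instead a nonzero linear form in B, which
    vanishes for few B by [card_linear_form]. Averaging over z then bounds the zeros. *)
Theorem card_triangle_form_zero :
  (#|[set B | triangle_form iota a b x y B == 0%R]| * q ^ d <= q ^ (n.+1 ^ 2 + 2))%N.
Proof.
have [s ys] : exists s, y s 0 != 0.
  apply: contrapT => h; case/eqP: y_neq0; apply/colP => s; rewrite mxE.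
  by apply: contrapT => /eqP h'; apply: h; exists s.
pose e i := iter i frob (y s 0).
have e0 i : e i != 0 by rewrite iter_frob_eq0.
pose eta : 'rV[F]_n.+1 := delta_mx 0 s.
pose T (z : 'cV[F]_n.+1) : K := (x *m map_mx iota z) 0 0.
have cornerD B z i j : corner iota x y (B + z *m eta) i j =
    corner iota x y B i j + T z ^+ (q ^ i) * e j.
  rewrite /corner /dot map_mxD mulmxDl mulmxDr mxE; congr (_ + _).
  rewrite map_mxM map_delta_mx -!mulmxA mulmxA -rowE conj_row_mul mxE big_ord1 [X in X * _]mxE [X in _ * X]mxE.
  by rewrite conj_colE frobE.
pose c4 B := a * (e 1%N * e 2) * corner iota x y B 2 0 + b * (e 0%N * e 2) * corner iota x y B 2 1.
pose Z := [set B | triangle_form iota a b x y B == 0].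
(* This w writes [c4 B] as x_2 B w; pairing it with x_0 gives a e_1 e_2, so it is not 0. *)
pose w := (a * (e 1%N * e 2)) *: conj_col iota 0 y + (b * (e 0%N * e 2)) *: conj_col iota 1 y.
have w0 : w != 0.
  have : dot (conj_row iota 0 x) w = a * (e 1%N * e 2).
    have o0 : dot (conj_row iota 0 x) (conj_col iota 0 y) = 1 by have := orth ord0 ord0; rewrite eqxx.
    have o1 : dot (conj_row iota 0 x) (conj_col iota 1 y) = 0.
      by have := orth ord0 (inord 1); rewrite -val_eqE /= inordK.
    by rewrite /w dot_addr !dotZr o0 o1 mulr1 mulr0 addr0.
  move=> h; apply: contraTneq isT => w0.
  move/eqP: h; rewrite w0 /dot mulmx0 mxE eq_sym !mulf_eq0.
  by rewrite (negPf a0) (negPf (e0 1%N)) (negPf (e0 2)).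
have wc4 B : c4 B = dot (conj_row iota 2 x *m map_mx iota B) w.
  by rewrite /w dot_addr !dotZr /c4 /corner !dotA.
have q1 := finRing_gt1 F.
have fib B : c4 B != 0 ->
    (#|[set z | (B + z *m eta)%R \in Z]| * q ^ d.+1 <= (q ^ 2 + q + 1) * q ^ n.+1)%N.
  move=> c40; set S := [set z | _].
  pose ts := undup [seq T z | z <- enum S].
  apply: (@leq_trans (size ts * q ^ n.+1)%N).
    apply: (card_fibers (f := T)) => [z zS|t].
      by rewrite mem_undup map_f ?mem_enum.
    apply: leq_trans (card_row_fiber t%:M); rewrite leq_mul2r.
    apply/orP; right; apply: subset_leq_card; apply/subsetP => z; rewrite !inE => /eqP <-.
    by rewrite /T -mx11_scalar.
  rewrite leq_mul2r; apply/orP; right.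
  pose cc := corner iota x y B.
  apply: (@sparse_poly_roots K q
    (a * (cc 0%N 1%N * cc 1%N 2 * cc 2 0%N) + b * (cc 1%N 0%N * cc 2 1%N * cc 0%N 2))
    (a * (e 1%N * cc 1%N 2 * cc 2 0%N) + b * (cc 1%N 0%N * cc 2 1%N * e 2))
    (a * (cc 0%N 1%N * e 2 * cc 2 0%N) + b * (e 0%N * cc 2 1%N * cc 0%N 2))
    (a * (cc 0%N 1%N * cc 1%N 2 * e 0%N) + b * (cc 1%N 0%N * e 1%N * cc 0%N 2))
    (c4 B)
    (a * (e 1%N * cc 1%N 2 * e 0%N) + b * (cc 1%N 0%N * e 1%N * e 2))
    (a * (cc 0%N 1%N * e 2 * e 0%N) + b * (e 0%N * e 1%N * cc 0%N 2))
    ((a + b) * (e 0%N * e 1%N * e 2))) => //; first exact: undup_uniq.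
  move=> t; rewrite mem_undup => /mapP[z]; rewrite mem_enum !inE => /eqP + ->.
  rewrite /triangle_form !cornerD !expn0 !expn1 !expr1 -/cc /c4 -/cc => h.
  rewrite -[RHS]h.
  set t1 := T z ^+ q; set t2 := T z ^+ (q ^ 2); set e1 := e 1%N; set e2 := e 2; set e0' := e 0%N.
  by rewrite -/(cc 2 0%N) -/(cc 2 1%N); ring.
have cZ z : #|[set B | (B + z *m eta)%R \in Z]| = #|Z|.
  rewrite -(card_imset [set B | (B + z *m eta)%R \in Z] (addIr (z *m eta))).
  congr #|pred_of_set _|; apply/setP => B; apply/imsetP/idP => [[B' + ->]|BZ]; first by rewrite inE.
  by exists (B - z *m eta); [rewrite inE subrK | rewrite subrK].
have sumZ : (q ^ n.+1 * #|Z| = \sum_(B : 'M[F]_n.+1) #|[set z | (B + z *m eta)%R \in Z]|)%N.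
  transitivity (\sum_(z : 'cV[F]_n.+1) #|[set B | (B + z *m eta)%R \in Z]|)%N.
    by under eq_bigr do rewrite cZ; rewrite sum_nat_const card_mx muln1.
  under eq_bigr do rewrite -sum1dep_card.
  rewrite (exchange_big_dep predT) //=.
  by apply: eq_bigr => B _; rewrite sum1dep_card.
pose Y := [set B | conj_row iota 2 x *m map_mx iota B *m w == 0].
have cY : (#|Y| * q ^ d.+1 <= q ^ (n.+1 ^ 2))%N by apply: card_linear_form.
have bound : (q ^ n.+1 * #|Z| * q ^ d.+1 <= q ^ n.+1 * (q ^ 2 + q + 2) * q ^ (n.+1 ^ 2))%N.
  rewrite sumZ big_distrl /=.
  apply: (@leq_trans (\sum_(B : 'M[F]_n.+1) ((q ^ 2 + q + 1) * q ^ n.+1 + (B \in Y) * (q ^ n.+1 * q ^ d.+1)))%N).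
    apply: leq_sum => B _; have [BY|BY] := boolP (B \in Y); last first.
      rewrite addn0; apply: fib; rewrite wc4; apply: contraNneq BY => h.
      by rewrite inE; apply/eqP/matrixP => i j; rewrite !ord1 [RHS]mxE.
    rewrite mul1n; apply: leq_trans (leq_addl _ _); rewrite leq_mul2r; apply/orP; right.
    by rewrite (leq_trans (max_card _)) // card_mx muln1.
  rewrite big_split /= sum_nat_const card_mx mulnn -big_distrl /=.
  have -> : (\sum_(B : 'M[F]_n.+1) (B \in Y) = #|Y|)%N by rewrite -sum1_card [RHS]big_mkcond.
  have := leq_mul (leqnn (q ^ n.+1)) cY.
  set t0 := (q ^ d.+1)%N; set t1 := (q ^ n.+1)%N; set t2 := (q ^ (n.+1 ^ 2))%N; set t3 := (q ^ 2)%N.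
  move=> h; have -> : (t1 * (t3 + q + 2) * t2 = t2 * ((t3 + q + 1) * t1) + t1 * t2)%N by ring.
  by rewrite leq_add2l (leq_trans _ h) // leq_eqVlt; apply/orP; left; apply/eqP; ring.
have qp k : (0 < q ^ k)%N by rewrite expn_gt0 (ltnW q1).
move: bound; rewrite -!mulnA leq_pmul2l // => bound.
rewrite -(leq_pmul2r (ltnW q1)) -mulnA -expnSr; apply: (leq_trans bound).
rewrite expnD -mulnA mulnC leq_mul2l; apply/orP; right.
(* It remains to see that q^2 + q + 2 <= q^3, an equality for q = 2. *)
have h1 : (2 * q <= q * q)%N by rewrite leq_mul2r q1 orbT.
have h2 : (2 * (q * q) <= q * (q * q))%N by rewrite leq_mul2r q1 orbT.
rewrite -mulnn -(mulnA q q); move: h1 h2; set qq := (q * q)%N; set qqq := (q * qq)%N.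
by move: q1; set k := q; lia.
Qed.

End TriangleCount.

(** * Random monic polynomials *)

Section Degrees.
Variables (F : finFieldType) (K : closedFieldType) (iota : {rmorphism F -> K}).
Local Notation q := #|F|.
Notation frob := (frob iota).
Implicit Types (l m : K) (P g : {poly F}).

Definition root_seq (p : {poly K}) : seq K := sval (closed_field_poly_normal p).

Lemma root_seqE (p : {poly K}) : p \is monic -> p = rprod (root_seq p).
Proof.
rewrite /root_seq => /monicP lp; case: closed_field_poly_normal => rs /= {1}->.
by rewrite lp scale1r.
Qed.

Lemma size_rprod (rs : seq K) : size (rprod rs) = (size rs).+1.
Proof. exact: size_prod_XsubC. Qed.

(** The degree of l over F is d, expressed as the exact period of l under Frobenius. *)
Definition has_deg d l :=
  [&& (0 < d)%N, iter d frob l == l & all (fun e => iter e frob l != l) (seq.iota 1 d.-1)].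

Lemma root_frob P l : root (map_poly iota P) l -> root (map_poly iota P) (frob l).
Proof.
move=> /rootP h; apply/rootP.
have -> : map_poly iota P = map_poly frob (map_poly iota P).
  by apply/polyP => i; rewrite !coef_map /=; apply/esym; exact: frob_iota.
by rewrite horner_map /= h rmorph0.
Qed.

Lemma root_iter_frob i P l : root (map_poly iota P) l -> root (map_poly iota P) (iter i frob l).
Proof. by move=> h; elim: i => //= i; apply: root_frob. Qed.

Lemma iter_frob_mod d i l : iter d frob l = l -> iter i frob l = iter (i %% d) frob l.
Proof.
move=> dl; rewrite {1}(divn_eq i d) addnC iterD; congr iter.
by elim: (i %/ d)%N => //= k IH; rewrite mulSn iterD IH.
Qed.

Lemma has_deg_uniq d l : has_deg d l -> uniq (mkseq (fun i => iter i frob l) d).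
Proof.
case/and3P=> d0 /eqP dl /allP h; rewrite map_inj_in_uniq ?iota_uniq // => i j.
rewrite !mem_iota /= !add0n.
wlog ij : i j / (i <= j)%N => [H id jd e|id jd].
  by case/orP: (leq_total i j) => ?; [exact: H | apply/esym; exact: H].
rewrite -{1}(subnKC ij) iterD => /(@frob_inj _ _ _ i)/esym/eqP e.
apply/eqP; rewrite eqn_leq ij /= -subn_eq0; apply: contraLR e => ne.
by apply: h; rewrite mem_iota; lia.
Qed.

Lemma has_deg_exists P l : P != 0 -> root (map_poly iota P) l ->
  exists2 d, (d < size P)%N & has_deg d l.
Proof.
move=> P0 rl; set s := mkseq (fun i => iter i frob l) (size P).
have nu : ~~ uniq s.
  apply/negP => us; have : (size s < size (map_poly iota P))%N.
    apply: max_poly_roots => //; first by rewrite map_poly_eq0.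
    by apply/allP => _ /mapP[i _ ->]; exact: root_iter_frob.
  by rewrite size_map_poly size_mkseq ltnn.
have [i [j [ij jP e]]] : exists i j, [/\ (i < j)%N, (j < size P)%N & iter i frob l = iter j frob l].
  apply: contrapT => h; case/negP: nu; rewrite map_inj_in_uniq ?iota_uniq // => i j.
  rewrite !mem_iota /= !add0n => iP jP e; apply: contrapT => nij; apply: h.
  by case: (ltngtP i j) => ij; [exists i, j | exists j, i | case: nij].
have ex : exists d, (0 < d)%N && (iter d frob l == l).
  exists (j - i)%N; rewrite subn_gt0 ij /=; apply/eqP/(@frob_inj _ _ iota i).
  by rewrite -iterD subnKC // ltnW.
case: (ex_minnP ex) => d /andP[d0 dl] dmin.
exists d.
  apply: leq_ltn_trans jP; apply: (leq_trans _ (leq_subr i j)); apply: dmin.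
  rewrite subn_gt0 ij /=; apply/eqP/(@frob_inj _ _ iota i).
  by rewrite -iterD subnKC // ltnW.
rewrite /has_deg d0 dl /=; apply/allP => e'; rewrite mem_iota => he; apply/negP => el.
by have := dmin e'; rewrite el andbT; lia.
Qed.

Lemma has_deg_gt d D l : has_deg d l -> (D < d)%N -> deg_gt iota D l.
Proof.
move=> dl Dd g g0 rg; apply: (leq_trans Dd).
have : (size (mkseq (fun i => iter i frob l) d) < size (map_poly iota g))%N.
  apply: max_poly_roots; rewrite ?map_poly_eq0 //; last exact: has_deg_uniq.
  by apply/allP => _ /mapP[i _ ->]; exact: root_iter_frob.
by rewrite size_map_poly size_mkseq; case: (size g).
Qed.

Definition conjs d l := mkseq (fun i => iter i frob l) d.

Lemma descent_poly (p : {poly K}) : map_poly frob p = p -> exists P, p = map_poly iota P.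
Proof.
move=> fp; have h i : exists a, p`_i = iota a.
  by apply: frob_fixed; rewrite -{2}fp coef_map.
exists (\poly_(i < size p) sval (cid (h i))); apply/polyP => i; rewrite coef_map coef_poly.
case: ltnP => [_|ip]; first by case: cid.
by rewrite nth_default //; apply/esym; exact: rmorph0.
Qed.

(** Frobenius permutes the conjugates of l cyclically, so the product over them has coefficients in
    F. *)
Lemma min_poly_exists d l : has_deg d l ->
  exists f : {poly F}, [/\ f \is monic, size f = d.+1 & map_poly iota f = rprod (conjs d l)].
Proof.
move=> /and3P[d0 /eqP dl _].
have [f ff] : exists f, rprod (conjs d l) = map_poly iota f.
  apply: descent_poly; rewrite /rprod rmorph_prod /=.
  under eq_bigr do rewrite rmorphB /= map_polyX map_polyC /=.
  rewrite -(big_map frob predT (fun z => 'X - z%:P)) -/(rprod _) -/(rprod _).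
  apply: rprod_perm; case: d d0 dl => // d _ dl.
  have -> : map frob (conjs d.+1 l) = rcons (mkseq (fun i => iter i.+1 frob l) d) l.
    rewrite /conjs /mkseq -map_comp -(addn1 d) iotaD map_cat cats1 add0n /=.
    by rewrite -[frob _]/(iter d.+1 frob l) dl.
  have -> : conjs d.+1 l = l :: mkseq (fun i => iter i.+1 frob l) d.
    by rewrite /conjs /mkseq /= -[in seq.iota 1](addn0 1%N) iotaDl -map_comp.
  by rewrite perm_rcons.
exists f; rewrite ff; split=> //.
  have := monic_prod_XsubC (conjs d l) predT id; rewrite -/(rprod _) ff.
  by rewrite !monicE lead_coef_map fmorph_eq1.
by rewrite -(size_map_poly iota) -ff size_rprod size_mkseq.
Qed.

Lemma dvdp_frob (j : nat) l P : ('X - l%:P) ^+ j %| map_poly iota P ->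
  ('X - (frob l)%:P) ^+ j %| map_poly iota P.
Proof.
have eP : map_poly frob (map_poly iota P) = map_poly iota P.
  by apply/polyP => i; rewrite !coef_map /=; exact: frob_iota.
have -> : ('X - (frob l)%:P) ^+ j = map_poly frob (('X - l%:P) ^+ j).
  by rewrite [RHS]rmorphXn /= rmorphB /= map_polyX map_polyC.
by move=> h; rewrite -eP dvdp_map.
Qed.

Lemma prod_dvdp_uniq (rs : seq K) (j : nat) (p : {poly K}) : uniq rs ->
  {in rs, forall r, ('X - r%:P) ^+ j %| p} -> rprod rs ^+ j %| p.
Proof.
elim: rs => [|r rs IH] /=; first by rewrite /rprod big_nil expr1n dvd1p.
case/andP=> rN urs h; rewrite rprod_cons exprMn Gauss_dvdp.
  rewrite h ?inE ?eqxx //=; apply: IH => // s sin; apply: h.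
  by rewrite inE sin orbT.
apply/coprimep_expl/coprimep_expr.
by rewrite coprimep_sym coprimep_XsubC /root rprod_eq0.
Qed.

(** P has coefficients in F, so conjugate roots have equal multiplicities. *)
Lemma min_poly_pow_dvd d l f j P : has_deg d l ->
  map_poly iota f = rprod (conjs d l) -> ('X - l%:P) ^+ j %| map_poly iota P -> f ^+ j %| P.
Proof.
move=> dl ff h; rewrite -(dvdp_map iota) rmorphXn /= ff.
apply: prod_dvdp_uniq; first exact: has_deg_uniq.
move=> _ /mapP[i _ ->]; elim: i => //= i; exact: dvdp_frob.
Qed.

Lemma count_dvdp (rs : seq K) l j : (j <= count_mem l rs)%N -> ('X - l%:P) ^+ j %| rprod rs.
Proof.
elim: rs j => [|r rs IH] j /=; first by rewrite leqn0 => /eqP ->; rewrite expr0 dvd1p.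
rewrite rprod_cons; case: eqP => [->|_] h.
  by case: j h => [|j] h; rewrite ?expr0 ?dvd1p // exprS dvdp_mul // IH.
by rewrite dvdp_mull // IH.
Qed.

(** A finite enumeration of all elements of degree d in K: they are roots of X^(q^d) - X. *)
Definition deg_list d : seq K := [seq l <- undup (root_seq ('X^(q ^ d) - 'X)) | has_deg d l].

Lemma mem_deg_list d l : (l \in deg_list d) = has_deg d l.
Proof.
rewrite mem_filter mem_undup andb_idr // => /and3P[d0 /eqP dl _].
have qd : (1 < q ^ d)%N by rewrite -(exp1n d) ltn_exp2r // finRing_gt1.
have mon : 'X^(q ^ d) - 'X \is @monic K.
  by rewrite monicE lead_coefDl ?lead_coefXn // size_polyN size_polyX size_polyXn.
rewrite -(root_prod_XsubC (root_seq _)) -[\prod_(a <- _) _]/(rprod _) -root_seqE //.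
by rewrite rootE !hornerE -(frobE iota) dl subrr.
Qed.

Lemma deg_list_uniq d : uniq (deg_list d).
Proof. exact/filter_uniq/undup_uniq. Qed.

Lemma size_deg_list d : (size (deg_list d) <= q ^ d)%N.
Proof.
have [->|d0] := posnP d; first by rewrite /deg_list (eq_filter (a2 := pred0)) ?filter_pred0.
have qd : (1 < q ^ d)%N by rewrite -(exp1n d) ltn_exp2r // finRing_gt1.
rewrite size_filter (leq_trans (count_size _ _)) // (leq_trans (size_undup _)) //.
have mon : 'X^(q ^ d) - 'X \is @monic K.
  by rewrite monicE lead_coefDl ?lead_coefXn // size_polyN size_polyX size_polyXn.
by rewrite -ltnS -size_rprod -root_seqE // size_polyDl ?size_polyXn // size_polyN size_polyX.
Qed.

End Degrees.

Section Smooth.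
Variables (F : finFieldType) (K : closedFieldType) (iota : {rmorphism F -> K}).
Local Notation q := #|F|.
Variable k' : nat.
Local Notation k := k'.+1.

Definition monic_of (c : 'rV[F]_k) : {poly F} := 'X^k - rVpoly c.

(** The last entry of c is the sum of the roots of [monic_of c], hence the trace of its companion
    matrix. *)
Definition traced (a : F) : {set 'rV[F]_k} := [set c : 'rV[F]_k | c 0 ord_max == a].

Lemma size_monic_of c : size (monic_of c) = k.+1.
Proof. by rewrite size_polyDl ?size_polyXn // size_polyN ltnS size_poly. Qed.

Lemma monic_monic_of c : monic_of c \is monic.
Proof.
by rewrite monicE lead_coefDl ?lead_coefXn // size_polyN size_polyXn ltnS size_poly.
Qed.

Lemma card_traced_ge a : (q ^ k' <= #|traced a|)%N.
Proof.
have -> : (q ^ k' = #|[set: 'rV[F]_k']|)%N by rewrite cardsT card_mx mul1n.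
pose f (c : 'rV[F]_k') : 'rV[F]_k := \row_i (if unlift ord_max i is Some j then c 0 j else a).
apply: (@leq_card_inj_set _ _ f)
  => [c c' _ _ /rowP e|c _]; last by rewrite inE mxE unlift_none.
by apply/rowP => j; have := e (lift ord_max j); rewrite !mxE liftK.
Qed.

(** Two such polynomials have the same two leading coefficients, so their difference is G times a
    polynomial of size at most k' - e. The subtraction is truncated: for e = k there is at most one
    polynomial. *)
Lemma card_multiples (G : {poly F}) e a : G \is monic -> size G = e.+1 -> (e <= k)%N ->
  (#|[set c in traced a | (G %| monic_of c)%R]| <= q ^ (k' - e))%N.
Proof.
move=> mG sG ek; set S := [set c in _ | _].
have [-> | [c0 c0S]] := set_0Vmem S; first by rewrite cards0.
have -> : (q ^ (k' - e) = #|[set: 'rV[F]_(k' - e)]|)%N by rewrite cardsT card_mx mul1n.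
have G0 : G != 0 by rewrite monic_neq0.
have key c : c \in S -> rVpoly (c - c0) = rVpoly (c - c0) %/ G * G /\
    (size (rVpoly (c - c0) %/ G)%R <= k' - e)%N.
  rewrite !inE in c0S *; case/andP: c0S => /eqP la0 G0c /andP[/eqP la Gc].
  have dv : G %| rVpoly (c - c0).
    have -> : rVpoly (c - c0) = monic_of c0 - monic_of c.
      by rewrite linearB /= /monic_of; ring.
    exact: dvdp_sub.
  split; first by rewrite divpK.
  have sk : (size (rVpoly (c - c0)) <= k')%N.
    apply/leq_sizeP => j kj; have [jk|jk] := ltnP j k; last first.
      by rewrite nth_default // (leq_trans (size_poly _ _)).
    rewrite coef_rVpoly; case: insubP => // i _ ij.
    have -> : i = ord_max by apply: val_inj; rewrite ij /=; lia.
    by rewrite !mxE la la0 subrr.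
  rewrite size_divp // sG /=; exact: leq_sub2r.
apply: (@leq_card_inj_set _ _ (fun c => poly_rV (rVpoly (c - c0) %/ G))) => [c c' cS c'S e'|c _]; last by rewrite inE.
have [e1 s1] := key c cS; have [e2 s2] := key c' c'S.
apply: (addIr (- c0)); apply: (can_inj (@rVpolyK _ _)).
by rewrite e1 e2 -(poly_rV_K s1) -(poly_rV_K s2) e'.
Qed.

Definition small_deg D (l : K) := has (fun d => has_deg iota d l) (seq.iota 1 D).

Definition smooth D a := [set c in traced a |
  all (small_deg D) (root_seq (map_poly iota (monic_of c)))].

Lemma card_count_mem d l j a : has_deg iota d l ->
  (#|[set c in traced a | (j < count_mem l (root_seq (map_poly iota (monic_of c))))%N]|
     <= if (d * j.+1 <= k)%N then q ^ (k' - d * j.+1) else 0)%N.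
Proof.
move=> dl; have [f [mf sf ff]] := min_poly_exists dl.
have dv c : (j < count_mem l (root_seq (map_poly iota (monic_of c))))%N -> f ^+ j.+1 %| monic_of c.
  move/count_dvdp; rewrite -root_seqE ?map_monic ?monic_monic_of // => h.
  exact: min_poly_pow_dvd dl ff h.
have mfj : f ^+ j.+1 \is monic by rewrite monic_exp.
have sfj : size (f ^+ j.+1) = (d * j.+1).+1.
  by rewrite -[LHS]prednK ?size_poly_gt0 ?monic_neq0 // size_exp sf.
case: (leqP (d * j.+1)%N k) => [dj|dj].
  rewrite /=; apply: leq_trans (card_multiples a mfj sfj dj); apply: subset_leq_card.
  by apply/subsetP => c; rewrite !inE => /andP[-> /dv].
rewrite leqn0 cards_eq0; apply/eqP/setP => c; rewrite !inE; apply/negP => /andP[_ /dv h].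
have := dvdp_leq _ h; rewrite monic_neq0 ?monic_monic_of // sfj size_monic_of => /(_ isT).
by rewrite ltnS leqNgt dj.
Qed.

Lemma geometric_sum (p N : nat) : (1 < p)%N -> (\sum_(j < N.+1) p ^ (N - j) <= 2 * p ^ N)%N.
Proof.
move=> p1; elim: N => [|N IH]; first by rewrite big_ord_recl big_ord0 expn0.
rewrite big_ord_recl subn0 /=; under eq_bigr do rewrite /bump /= add1n subSS.
apply: (leq_trans (leq_add (leqnn _) IH)); rewrite [X in (_ <= X)%N]mul2n -addnn leq_add2l.
by rewrite expnS leq_mul2r p1 orbT.
Qed.

(** First moment method. A smooth polynomial has k roots of degree at most D, counted with
    multiplicity, whereas for each degree d the average number of roots of degree d is at most 3: at
    most q^d elements, each of multiplicity greater than j with probability about q^(-d(j+1)). *)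
Lemma card_smooth D a : (D <= k')%N -> (#|smooth D a| * k <= 3 * D * q ^ k')%N.
Proof.
move=> Dk; have q1 := finRing_gt1 F.
pose R c := root_seq (map_poly iota (monic_of c)).
have sR c : size (R c) = k.
  have := size_rprod (R c); rewrite -root_seqE ?map_monic ?monic_monic_of //.
  by rewrite size_map_poly size_monic_of => -[].
have bound c : c \in smooth D a ->
    (k <= \sum_(d <- seq.iota 1 D) \sum_(l <- deg_list iota d) \sum_(j < k) (j < count_mem l (R c)))%N.
  rewrite inE => /andP[_ /allP sm].
  apply: (@leq_trans (\sum_(d <- seq.iota 1 D) \sum_(l <- deg_list iota d) count_mem l (R c))%N); last first.
    apply: leq_sum => d _; apply: leq_sum => l _.
    have ck : (count_mem l (R c) <= k)%N by rewrite -(sR c) count_size.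
    rewrite -{1}(card_ord (count_mem l (R c))) -sum1_card (big_ord_widen k (fun _ => 1%N) ck).
    by rewrite big_mkcond; apply: leq_sum => j _; case: ifP.
  rewrite -(sR c) -sum1_size.
  apply: (@leq_trans (\sum_(x <- R c) \sum_(d <- seq.iota 1 D) \sum_(l <- deg_list iota d) (x == l))%N).
    rewrite big_seq [X in (_ <= X)%N]big_seq; apply: leq_sum => x xR.
    have /hasP[d dD dx] := sm x xR.
    rewrite (big_rem d) //= (big_rem x) /= ?mem_deg_list // eqxx; lia.
  rewrite exchange_big /=; apply: leq_sum => d _; rewrite exchange_big /=; apply: leq_sum => l _.
  by rewrite -sum1_count [X in (_ <= X)%N]big_mkcond; apply: leq_sum => x _ /=; case: eqP.
rewrite -sum_nat_const.
apply: (@leq_trans (\sum_(c in smooth D a) \sum_(d <- seq.iota 1 D) \sum_(l <- deg_list iota d)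
   \sum_(j < k) (j < count_mem l (R c)))%N); first by apply: leq_sum => c /bound.
apply: (@leq_trans (\sum_(c in traced a) \sum_(d <- seq.iota 1 D) \sum_(l <- deg_list iota d)
   \sum_(j < k) (j < count_mem l (R c)))%N).
  rewrite [X in (_ <= X)%N](bigID (mem (smooth D a))) /=.
  apply: leq_trans (leq_addr _ _); rewrite leq_eqVlt; apply/orP; left; apply/eqP.
  by apply: eq_bigl => c; apply/idP/andP => [h|[]//]; split=> //; move: h; rewrite inE => /andP[].
rewrite exchange_big /= -mulnA mulnCA -[X in (X * _)%N](size_iota 1 D) -sum1_size big_distrl /=.
rewrite big_seq [X in (_ <= X)%N]big_seq; apply: leq_sum => d; rewrite mem_iota mul1n => /andP[d0 dD].
rewrite exchange_big /=.
apply: (@leq_trans (\sum_(l <- deg_list iota d) \sum_(j < k) if (d * j.+1 <= k)%N then q ^ (k' - d * j.+1) else 0)%N).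
  rewrite big_seq [X in (_ <= X)%N]big_seq; apply: leq_sum => l; rewrite mem_deg_list => dl.
  rewrite exchange_big /=; apply: leq_sum => j _.
  apply: leq_trans (card_count_mem j a dl).
  rewrite -sum1_card big_mkcond [X in (_ <= X)%N]big_mkcond /=; apply: leq_sum => c _.
  by rewrite !inE; case: (_ == a); case: (_ < _)%N.
rewrite big_const_seq count_predT iter_addn_0 mulnC.
apply: (@leq_trans (q ^ d * \sum_(j < k) if (d * j.+1 <= k)%N then q ^ (k' - d * j.+1) else 0)%N).
  by rewrite leq_mul2r size_deg_list orbT.
rewrite big_distrr /=.
(* If d (j + 1) = k, the exponent k' - k is truncated to 0. This happens for at most one j and costs
   at most q^k', as d <= k'; the geometric sum gives the other 2 q^k'. *)
apply: (@leq_trans (\sum_(j < k) (q ^ (k' - j) + (d * j.+1 == k) * q ^ k'))%N).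
  apply: leq_sum => j _; case: (ltngtP (d * j.+1)%N k) => dj /=; rewrite ?muln0 //.
    rewrite -expnD addn0 leq_pexp2l //; first exact: ltnW.
    by move: (nat_of_ord j) dj => i dj; nia.
  rewrite mul1n (_ : k' - _ = 0)%N ?expn0 ?muln1; last by rewrite dj; apply/eqP; rewrite subn_eq0.
  apply: leq_trans (leq_addl _ _); rewrite leq_pexp2l //; first exact: ltnW.
  by apply: leq_trans Dk; rewrite -ltnS -add1n.
rewrite big_split /= -big_distrl /= (_ : 3 * _ = 2 * q ^ k' + 1 * q ^ k')%N; last by rewrite -mulnDl.
apply: leq_add; first exact: geometric_sum.
rewrite leq_mul2r; apply/orP; right.
case: (pickP (fun j : 'I_k => d * j.+1 == k)%N) => [j0 e0|none]; last first.
  by rewrite big1 // => j _; rewrite none.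
rewrite (bigD1 j0) //= e0 big1 // => j jj0; apply/eqP; rewrite eqb0.
apply: contra jj0 => /eqP e1.
have /eqP : (d * j.+1 = d * j0.+1)%N by rewrite e1 (eqP e0).
by rewrite eqn_pmul2l // => /eqP[] /val_inj ->.
Qed.

End Smooth.

(* Four residues mod d, two of them in {0, 1, 2}, leave a cyclic gap of length (d - 2)/3;
   rotate so that this gap comes last. *)
Lemma cyclic_shift d i j : (3 <= d)%N -> (i < d)%N -> (j < d)%N ->
  exists s, forall z, [|| (z < 3)%N, z == i | z == j] -> ((z + s) %% d <= d - (d - 2) %/ 3)%N.
Proof.
move=> d3; wlog ij : i j / (i <= j)%N => [H id jd|id jd].
  case/orP: (leq_total i j) => ij; first exact: H.
  have [s hs] := H j i ij jd id; exists s => z hz; apply: hs; move: hz.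
  by case/or3P => ->; rewrite ?orbT.
set t := ((d - 2) %/ 3)%N.
have ht : (3 * t + 2 <= d)%N.
  by have := leq_trunc_div (d - 2) 3; rewrite -/t mulnC; lia.
have md z : (z < d)%N -> (z %% d = z)%N by exact: modn_small.
have mD z : (d <= z < d + d)%N -> (z %% d = z - d)%N.
  move=> /andP[h1 h2]; rewrite -{1}(subnK h1) modnDr modn_small //; lia.
have [jt|jt] := leqP j (d - t).
  exists 0%N => z hz; rewrite addn0 md; first by case/or3P: hz => [|/eqP ->|/eqP ->]; lia.
  by case/or3P: hz => [|/eqP ->|/eqP ->]; lia.
have [it|it] := leqP i (d - 2 * t).
  exists (d - j)%N => z /or3P[z3|/eqP ->|/eqP ->].
  - by rewrite md; lia.
  - by rewrite md; lia.
  - by rewrite subnKC ?modnn // ltnW.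
exists (d - i)%N => z /or3P[z3|/eqP ->|/eqP ->].
- by rewrite md; lia.
- by rewrite subnKC ?modnn // ltnW.
have -> : (j + (d - i) = (j - i) + d)%N by lia.
by rewrite modnDr md; lia.
Qed.

(** Differences are indexed by positions in the list of all roots, so that a repeated root is
    handled like two different ones. *)
Definition conflict_at (K : fieldType) (a b i j : nat) (L : seq K) :=
  [&& (i, j) != (a, b), (i, j) != (b, a) & L`_i - L`_j == L`_a - L`_b].

Lemma sep_of_no_conflict (K : fieldType) (L : seq K) a b rest :
  (a < size L)%N -> (b < size L)%N ->
  (forall i j, (i < size L)%N -> (j < size L)%N -> ~~ conflict_at a b i j L) ->
  (forall r, r \in rest -> exists i, [/\ (i < size L)%N, i != a, i != b & L`_i = r]) ->
  a != b -> sep L`_a L`_b rest.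
Proof.
move=> aL bL nc hrest ab.
have inD c : c \in diffs L`_a L`_b rest -> exists i j,
   [/\ (i < size L)%N, (j < size L)%N, (i, j) != (a, b), (i, j) != (b, a) & c = L`_i - L`_j].
  rewrite /diffs mem_cat => /orP[|].
    case/allpairsP=> -[u v] /= []; rewrite !inE => /eqP -> /eqP -> ->.
    by exists a, a; rewrite !xpair_eqE eqxx (negPf ab).
  rewrite mem_cat => /orP[|].
    case/allpairsP=> -[u v] /= []; rewrite !inE => /eqP -> /eqP -> ->.
    by exists b, b; rewrite !xpair_eqE eqxx (eq_sym b) (negPf ab).
  rewrite mem_cat => /orP[|].
    case/allpairsP=> -[u v] /= []; rewrite inE => /eqP -> /hrest[i [iL ia ib <-]] ->.
    by exists a, i; rewrite !xpair_eqE (negPf ib) (negPf ia) !andbF.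
  rewrite mem_cat => /orP[|].
    case/allpairsP=> -[u v] /= []; rewrite inE => /eqP -> /hrest[i [iL ia ib <-]] ->.
    by exists b, i; rewrite !xpair_eqE (negPf ib) (negPf ia) !andbF.
  rewrite mem_cat => /orP[|].
    case/allpairsP=> -[u v] /= [/hrest[i [iL ia ib <-]]]; rewrite inE => /eqP -> ->.
    by exists i, a; rewrite !xpair_eqE (negPf ib) (negPf ia).
  rewrite mem_cat => /orP[|].
    case/allpairsP=> -[u v] /= [/hrest[i [iL ia ib <-]]]; rewrite inE => /eqP -> ->.
    by exists i, b; rewrite !xpair_eqE (negPf ib) (negPf ia).
  case/allpairsP=> -[u v] /= [/hrest[i [iL ia ib <-]] /hrest[j [jL ja jb <-]] ->].
  by exists i, j; rewrite !xpair_eqE (negPf ib) (negPf ia).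
apply/andP; split; apply/negP => /inD[i [j [iL jL n1 n2 e]]].
  by have := nc i j iL jL; rewrite /conflict_at n1 n2 e eqxx.
have := nc j i jL iL; rewrite /conflict_at !xpair_eqE.
move: n1 n2; rewrite !xpair_eqE ![(j == _) && _]andbC => -> -> /=.
by rewrite -[L`_j - _]opprB -e opprB eqxx.
Qed.

(** * Coincidences between differences of roots *)

Section Conflicts.
Variables (F : finFieldType) (K : closedFieldType) (iota : {rmorphism F -> K}).
Local Notation q := #|F|.
Notation frob := (frob iota).

(** For fixed other roots [hs], a coincidence is a polynomial equation in l whose exponents are
    powers of q. Applying Frobenius s times and reducing by l^(q^d) = l lowers its degree to q^(d -
    (d-2)/3), so only a small fraction of the l of degree d solve it; unrotated, the degree could be
    as large as q^(d-1). *)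
Lemma count_conflict_at d (hs : seq K) a b i j : (3 <= d)%N -> (a < 3)%N -> (b < 3)%N -> a != b ->
  (count (fun l => conflict_at a b i j (conjs iota d l ++ hs)) (deg_list iota d)
    <= q ^ (d - (d - 2) %/ 3))%N.
Proof.
move=> d3 a3 b3 ab; have q1 := finRing_gt1 F.
rewrite -size_filter; set X := filter _ _.
have [/andP[ne1 ne2]|] := boolP (((i, j) != (a, b)) && ((i, j) != (b, a))); last first.
  move=> h; rewrite (_ : X = [::]) //; rewrite -(filter_pred0 (deg_list iota d)).
  by apply: eq_filter => l; rewrite /conflict_at andbA (negPf h).
(* A position beyond the d conjugates contributes a constant, so for the rotation it may be replaced
   by 0. *)
pose idx u := if (u < d)%N then u else 0%N.
have idxd u : (idx u < d)%N by rewrite /idx; case: ifP => //; lia.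
have [s hs'] := cyclic_shift d3 (idxd i) (idxd j).
pose r z := ((z + s) %% d)%N.
have qinj : {in gtn d &, injective (fun z => q ^ r z)%N}.
  move=> u v ud vd /eqP; rewrite eqn_exp2l // => /eqP/eqP; rewrite /r.
  by rewrite eqn_modDr !modn_small // => /eqP.
have qr0 z : (0 == q ^ r z)%N = false by apply/eqP => h; have := expn_gt0 q (r z); rewrite -h (ltnW q1).
pose pol u : {poly K} := if (u < d)%N then 'X^(q ^ r u) else (iter s frob hs`_(u - d))%:P.
pose Q := pol i - pol j - ('X^(q ^ r a) - 'X^(q ^ r b)).
have ad : (a < d)%N by lia.
have bd : (b < d)%N by lia.
have coefp u z : (z < d)%N -> (pol u)`_(q ^ r z) = (u == z)%:R.
  move=> zd; rewrite /pol; case: ltnP => ud.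
    by rewrite coefXn (inj_in_eq qinj) // eq_sym.
  by rewrite coefC eq_sym qr0; case: eqP => // uz; lia.
have Xp z : (z < d)%N -> 'X^(q ^ r z) = pol z by rewrite /pol => ->.
(* If a is i or j, the coefficient at q^(r a) may be 0 or -2, but the one at q^(r b) is 1, since (i,
   j) is neither (a, b) nor (b, a). Otherwise the coefficient at q^(r a) is -1. *)
have Q0 : Q != 0.
  rewrite /Q !Xp //; move: ne1 ne2; rewrite !xpair_eqE => ne1 ne2.
  have [ea|ia] := boolP ((i == a) || (j == a)).
    apply/eqP => /(congr1 (fun p : {poly K} => p`_(q ^ r b))).
    rewrite !coefB coef0 !coefp // eqxx (negPf ab).
    have -> : (i == b) = false.
      apply/eqP => ib; case/orP: ea => /eqP e; first by rewrite -e ib eqxx in ab.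
      by rewrite ib e !eqxx in ne2.
    have -> : (j == b) = false.
      apply/eqP => jb; case/orP: ea => /eqP e; last by rewrite -e jb eqxx in ab.
      by rewrite jb e !eqxx in ne1.
    by rewrite !subr0 !sub0r opprK => /eqP; rewrite oner_eq0.
  apply/eqP => /(congr1 (fun p : {poly K} => p`_(q ^ r a))).
  rewrite !coefB coef0 !coefp // eqxx (eq_sym b) (negPf ab).
  move: ia; rewrite negb_or => /andP[/negPf -> /negPf ->].
  by rewrite !subr0 !sub0r => /eqP; rewrite oppr_eq0 oner_eq0.
have rk u : [|| (u < 3)%N, u == i | u == j] -> (u < d)%N -> (q ^ r u <= q ^ (d - (d - 2) %/ 3))%N.
  move=> hu ud; rewrite leq_pexp2l //; first exact: ltnW.
  apply: hs'; case/or3P: hu => [->//|/eqP e|/eqP e]; rewrite e /idx -?e ud eqxx ?orbT //.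
have spol u : [|| (u < 3)%N, u == i | u == j] -> (size (pol u) <= (q ^ (d - (d - 2) %/ 3)).+1)%N.
  move=> hu; rewrite /pol; case: ifP => ud; first by rewrite size_polyXn ltnS rk.
  by apply: (leq_trans (size_polyC_leq1 _)).
have sB (p p' : {poly K}) N : (size p <= N -> size p' <= N -> size (p - p')%R <= N)%N.
  by move=> h1 h2; apply: (leq_trans (size_polyD _ _)); rewrite size_polyN geq_max h1.
have sQ : (size Q <= (q ^ (d - (d - 2) %/ 3)).+1)%N.
  by rewrite /Q !Xp //; apply: (sB); apply: (sB); apply: spol; rewrite ?a3 ?b3 ?eqxx ?orbT.
rewrite -ltnS; apply: leq_trans sQ; apply: max_poly_roots => //; last first.
  exact/filter_uniq/deg_list_uniq.
apply/allP => l; rewrite mem_filter mem_deg_list => /andP[/and3P[_ _ /eqP e] dl].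
have dl' : iter d frob l = l by case/and3P: dl => _ /eqP.
have Lu u : iter s frob (conjs iota d l ++ hs)`_u = (pol u).[l].
  rewrite /pol nth_cat size_mkseq; case: ifP => ud; last by rewrite hornerC.
  rewrite nth_mkseq // -iterD addnC hornerXn -(frobE iota).
  by rewrite (iter_frob_mod (u + s) dl').
have iterB (u v : K) : iter s frob (u - v) = iter s frob u - iter s frob v.
  by elim: (s) => //= s' ->; rewrite rmorphB.
have := congr1 (iter s frob) e; rewrite !iterB !Lu => e'.
by rewrite rootE /Q !Xp // !(hornerD, hornerN) e' subrr.
Qed.

Definition pairs3 := [:: (0, 1); (1, 2); (0, 2)]%N.

Definition conflict d (l : K) (hs : seq K) :=
  let L := conjs iota d l ++ hs in
  has (fun ab => has (fun ij => conflict_at ab.1 ab.2 ij.1 ij.2 L)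
    [seq (i, j) | i <- seq.iota 0 (size L), j <- seq.iota 0 (size L)]) pairs3.

Lemma count_has_le (T U : Type) (P : T -> U -> bool) (s : seq U) (X : seq T) M :
  (forall u, count (P^~ u) X <= M)%N -> (count (fun x => has (P x) s) X <= size s * M)%N.
Proof.
move=> h; elim: s => [|u s IH] /=; first by rewrite count_pred0.
rewrite mulSn; apply: leq_trans (leq_add (h u) IH).
by rewrite -count_predUI leq_addr.
Qed.

Lemma count_conflict d hs n : (3 <= d)%N -> (d + size hs = n)%N ->
  (count (fun l => conflict d l hs) (deg_list iota d) <= 3 * (n * n * q ^ (d - (d - 2) %/ 3)))%N.
Proof.
move=> d3 dn.
(* The guard holds for all members of [pairs3]; it makes the bound hold for every pair ab, as
   [count_has_le] demands. *)
have -> : count (fun l => conflict d l hs) (deg_list iota d) =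
  count (fun l => has (fun ab => ((ab.1 < 3) && (ab.2 < 3) && (ab.1 != ab.2))%N && 
     has (fun ij => conflict_at ab.1 ab.2 ij.1 ij.2 (conjs iota d l ++ hs))
    [seq (i, j) | i <- seq.iota 0 n, j <- seq.iota 0 n]) pairs3) (deg_list iota d).
  by apply: eq_count => l; rewrite /conflict size_cat size_mkseq dn /pairs3 /=.
apply: (@count_has_le _ _ _ pairs3) => -[a b] /=.
have [/andP[/andP[a3 b3] ab]|] := boolP ((a < 3) && (b < 3) && (a != b))%N; last first.
  by move=> _; rewrite (eq_count (a2 := pred0)) ?count_pred0.
have := @count_has_le _ _ (fun l ij => conflict_at a b ij.1 ij.2 (conjs iota d l ++ hs))
  [seq (i, j) | i <- seq.iota 0 n, j <- seq.iota 0 n] (deg_list iota d) _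
  (fun ij => count_conflict_at hs ij.1 ij.2 d3 a3 b3 ab).
by rewrite size_allpairs size_iota; apply.
Qed.

End Conflicts.

Section PolyGood.
Variables (F : finFieldType) (K : closedFieldType) (iota : {rmorphism F -> K}).
Local Notation q := #|F|.
Notation frob := (frob iota).

Definition min_poly d l : {poly F} :=
  if pselect (exists f : {poly F},
    [/\ f \is monic, size f = d.+1 & map_poly iota f = rprod (conjs iota d l)]) is left h
  then sval (cid h) else 1.

Lemma min_polyP d l : has_deg iota d l -> [/\ min_poly d l \is monic,
  size (min_poly d l) = d.+1 & map_poly iota (min_poly d l) = rprod (conjs iota d l)].
Proof.
by move=> /min_poly_exists h; rewrite /min_poly; case: pselect => // h'; case: cid.
Qed.

Lemma min_poly_dvd d l P : has_deg iota d l -> root (map_poly iota P) l -> min_poly d l %| P.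
Proof.
move=> dl rl; have [_ _ ff] := min_polyP dl.
by have := min_poly_pow_dvd (P := P) (j := 1%N) dl ff; rewrite !expr1 dvdp_XsubCl; apply.
Qed.

Lemma size_root_seq (p : {poly K}) : p \is monic -> size (root_seq p) = (size p).-1.
Proof. by move=> mp; rewrite {2}(root_seqE mp) size_rprod. Qed.

Lemma rprod_cat (s t : seq K) : rprod (s ++ t) = rprod s * rprod t.
Proof. by rewrite /rprod big_cat. Qed.

Variables (k' m : nat) (H : {poly F}).
Hypotheses (monH : H \is monic) (sizeH : size H = m.+1).
Local Notation k := k'.+1.
Local Notation n := (k + m)%N.

(** H will be the characteristic polynomial on the quotient by the cyclic subspace: fixed, while c
    is random. *)
Definition poly_good D (c : 'rV[F]_k) := exists l rest,
  [/\ map_poly iota (monic_of c * H) = rprod [:: l, frob l, frob (frob l) & rest],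
      sep3 l (frob l) (frob (frob l)) rest & deg_gt iota D l].

Definition conflicting d a : {set 'rV[F]_k} := [set c in traced k' a |
  has (fun l => root (map_poly iota (monic_of c)) l &&
    conflict iota d l (root_seq (map_poly iota (monic_of c %/ min_poly d l * H)))) (deg_list iota d)].

(** Such a polynomial is g times the minimal polynomial of l. The cofactor g is chosen first, in
    q^(k-d) ways; then the roots of g H are fixed and [count_conflict] bounds the number of l.
    Forgetting the trace costs only a factor q. *)
Lemma card_conflicting d a : (3 <= d <= k)%N ->
  (#|conflicting d a| <= q ^ (k - d) * (3 * (n * n * q ^ (d - (d - 2) %/ 3))))%N.
Proof.
move=> /andP[d3 dk].
pose g (e : 'rV[F]_(k - d)) : {poly F} := 'X^(k - d) - rVpoly e.
have mg e : g e \is monic.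
  by rewrite monicE lead_coefDl ?lead_coefXn // size_polyN size_polyXn ltnS size_poly.
have sg e : size (g e) = (k - d).+1.
  by rewrite size_polyDl ?size_polyXn // size_polyN ltnS size_poly.
pose hs e := root_seq (map_poly iota (g e * H)).
pose E e := [set c : 'rV[F]_k | c \in
  map (fun l => poly_rV ('X^k - min_poly d l * g e)) (filter (fun l => conflict iota d l (hs e)) (deg_list iota d))].
have sub : conflicting d a \subset \bigcup_(e : 'rV[F]_(k - d)) E e.
  apply/subsetP => c; rewrite inE => /andP[_ /hasP[l]].
  rewrite mem_deg_list => dl /andP[rl cf].
  have fP := min_poly_dvd dl rl; have [mf sf ff] := min_polyP dl.
  set f := min_poly d l in mf sf ff fP cf.
  have Pf : monic_of c %/ f * f = monic_of c by rewrite divpK.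
  have mq : monic_of c %/ f \is monic.
    by have := monic_monic_of c; rewrite -{1}Pf monicMr.
  have sq : size (monic_of c %/ f) = (k - d).+1.
    have := size_monic_of c; rewrite -{1}Pf size_proper_mul; last first.
      by rewrite (monicP mq) (monicP mf) mulr1 oner_eq0.
    rewrite sf addnS /= => sk.
    by rewrite -[LHS](addnK d) -[X in (X - d)%N]/((size (monic_of c %/ f)%R + d)%N) sk subSn.
  pose e := poly_rV ('X^(k - d) - monic_of c %/ f) : 'rV[F]_(k - d).
  have ge : g e = monic_of c %/ f.
    rewrite /g /e poly_rV_K; first by rewrite opprB addrCA subrr addr0.
    apply/leq_sizeP => j; rewrite leq_eqVlt => /orP[/eqP <-|jk].
      rewrite coefB coefXn eqxx; have := monicP mq; rewrite lead_coefE sq /= => ->.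
      by rewrite subrr.
    rewrite coefB coefXn gtn_eqF // nth_default ?subrr // sq //.
  apply/bigcupP; exists e => //; rewrite inE; apply/mapP; exists l.
    by rewrite mem_filter mem_deg_list dl andbT /hs ge.
  by rewrite ge mulrC Pf /monic_of opprB addrCA subrr addr0 rVpolyK.
apply: (leq_trans (subset_leq_card sub)); apply: (leq_trans (card_bigcup_leq _ _)).
apply: (@leq_trans (\sum_(e : 'rV[F]_(k - d)) 3 * (n * n * q ^ (d - (d - 2) %/ 3)))%N); last first.
  by rewrite sum_nat_const card_mx mul1n.
apply: leq_sum => e _; rewrite cardsE; apply: (leq_trans (card_size _)); rewrite size_map size_filter.
apply: (count_conflict _ d3).
have mgH : map_poly iota (g e * H) \is monic by rewrite map_monic rpredM.
rewrite size_root_seq // size_map_poly size_proper_mul; last first.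
  by rewrite (monicP (mg e)) (monicP monH) mulr1 oner_eq0.
by rewrite sg sizeH addnS /= addSn /= addnA subnKC.
Qed.

Lemma poly_good_of_no_conflict D d a c l : (3 <= d)%N -> (D < d)%N -> (d <= k)%N ->
  c \in traced k' a -> has_deg iota d l -> root (map_poly iota (monic_of c)) l ->
  c \notin conflicting d a -> poly_good D c.
Proof.
move=> d3 Dd dk cT dl rl; rewrite inE cT /= => /hasPn/(_ l).
rewrite mem_deg_list => /(_ dl); rewrite rl /=.
have fP := min_poly_dvd dl rl; have [mf sf ff] := min_polyP dl.
set f := min_poly d l in mf sf ff fP *.
have Pf : monic_of c %/ f * f = monic_of c by rewrite divpK.
have mq : monic_of c %/ f \is monic.
  by have := monic_monic_of c; rewrite -{1}Pf monicMr.
set hs := root_seq _ => nc.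
have mQ : map_poly iota (monic_of c %/ f * H) \is monic by rewrite map_monic rpredM.
set L := conjs iota d l ++ hs.
have eL : map_poly iota (monic_of c * H) = rprod L.
  by rewrite -Pf mulrAC rmorphM /= ff mulrC (root_seqE mQ) -rprod_cat.
have sL : size L = (d + size hs)%N by rewrite size_cat size_mkseq.
have Ln i : (i < d)%N -> L`_i = iter i frob l.
  by move=> id; rewrite nth_cat size_mkseq id nth_mkseq.
have L3 : L = [:: l, frob l, frob (frob l) & drop 3 L].
  rewrite -[RHS]/([:: l; frob l; frob (frob l)] ++ drop 3 L) -{1}(cat_take_drop 3 L).
  congr (_ ++ _).
  apply: (@eq_from_nth _ 0) => [|i]; rewrite size_takel ?sL //; try lia.
  by move=> i3; rewrite nth_take // Ln; [case: i i3 => [|[|[|]]] | lia].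
have nc' a' b' i j : (a', b') \in pairs3 -> (i < size L)%N -> (j < size L)%N -> ~~ conflict_at a' b' i j L.
  move=> ab iL jL; apply: contra nc => cf; rewrite /conflict -/L.
  apply/hasP; exists (a', b') => //; apply/hasP; exists (i, j) => //=.
  by apply/allpairsP; exists (i, j); rewrite !mem_iota.
have restP r : r \in drop 3 L -> exists2 i, (3 <= i < size L)%N & L`_i = r.
  move=> rin; exists (3 + index r (drop 3 L))%N; last by rewrite -nth_drop nth_index.
  by rewrite leq_addr /=; have := rin; rewrite -index_mem size_drop; move: (index _ _) (size L) => u v; lia.
have [h0 h1 h2] : [/\ L`_0 = l, L`_1 = frob l & L`_2 = frob (frob l)].
  by split; rewrite Ln //; lia.
have sepL a' b' z : (a', b') \in pairs3 -> (z < 3)%N -> z != a' -> z != b' -> 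
    sep L`_a' L`_b' (L`_z :: drop 3 L).
  move=> ab z3 za zb.
  have [a3 b3 ne] : [/\ (a' < 3)%N, (b' < 3)%N & a' != b'].
    by move: ab; rewrite !inE !xpair_eqE => /or3P[] /andP[/eqP -> /eqP ->].
  have aL : (a' < size L)%N by rewrite sL; apply: (leq_trans a3); apply: (leq_trans d3); exact: leq_addr.
  have bL : (b' < size L)%N by rewrite sL; apply: (leq_trans b3); apply: (leq_trans d3); exact: leq_addr.
  have zL : (z < size L)%N by rewrite sL; apply: (leq_trans z3); apply: (leq_trans d3); exact: leq_addr.
  apply: (sep_of_no_conflict aL bL _ _ ne) => [i j|r]; first exact: nc'.
  rewrite inE => /orP[/eqP ->|/restP[i /andP[i3 iL] <-]]; first by exists z.
  exists i; split=> //; rewrite neq_ltn; first by rewrite (leq_trans a3 i3) orbT.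
  by rewrite (leq_trans b3 i3) orbT.
exists l, (drop 3 L); split.
- by rewrite eL {1}L3.
- rewrite /sep3; have := sepL 0 1 2; have := sepL 1 2 0; have := sepL 0 2 1.
  by rewrite h0 h1 h2 => -> // -> // ->.
- exact: has_deg_gt dl Dd.
Qed.

(** Any root of degree greater than D must take part in a conflict, and if there is no such root,
    then c is smooth. *)
Lemma poly_bad_subset D a : (2 <= D)%N ->
  [set c in traced k' a | ~~ `[< poly_good D c >]] \subset
    smooth iota k' D a :|: \bigcup_(d : 'I_k.+1 | (D < d)%N) conflicting d a.
Proof.
move=> D2; apply/subsetP => c; rewrite inE => /andP[cT /asboolPn bad]; rewrite inE.
apply/orP; case: (boolP (c \in smooth iota k' D a)) => [|ns]; [by left | right].
have : ~~ all (small_deg iota D) (root_seq (map_poly iota (monic_of c))).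
  by apply: contra ns => h; rewrite inE cT.
case/allPn => l lin lsm.
have rl : root (map_poly iota (monic_of c)) l.
  by rewrite (root_seqE (p := map_poly _ _)) ?map_monic ?monic_monic_of // -[rprod _]/(\prod_(_ <- _) _) root_prod_XsubC.
have [d dk dl] := has_deg_exists (monic_neq0 (monic_monic_of c)) rl.
rewrite size_monic_of ltnS in dk.
have d0 : (0 < d)%N by case/and3P: dl.
have Dd : (D < d)%N.
  rewrite ltnNge; apply: contra lsm => dD; apply/hasP; exists d => //.
  by rewrite mem_iota; lia.
apply/bigcupP; exists (Ordinal (dk : (d < k.+1)%N)) => //=.
apply: contrapT => /negP nc; apply: bad.
by apply: (poly_good_of_no_conflict (d := d) (a := a) (l := l)) => //; lia.
Qed.

Theorem card_poly_bad D a : (2 <= D <= k')%N ->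
  (#|[set c in traced k' a | ~~ `[< poly_good D c >]]| * k <=
   3 * D * q ^ k' + k * (k.+1 * (3 * (n * n * q ^ (k - D.-1 %/ 3)))))%N.
Proof.
move=> /andP[D2 Dk]; have q1 := finRing_gt1 F.
have sub := subset_leq_card (poly_bad_subset a D2).
apply: (@leq_trans ((#|smooth iota k' D a| +
    \sum_(d : 'I_k.+1 | (D < d)%N) #|conflicting d a|) * k)%N).
  rewrite leq_mul2r; apply/orP; right; apply: (leq_trans sub).
  by apply: (leq_trans (leq_card_setU _ _)); rewrite leq_add2l card_bigcup_leq.
rewrite mulnDl leq_add ?card_smooth // mulnC leq_mul2l; apply/orP; right.
rewrite -[X in (_ <= X * _)%N]card_ord -sum_nat_const big_mkcond /=.
apply: leq_sum => d _; case: ifP => // Dd.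
have dk : (d <= k)%N by rewrite -ltnS.
have d3 : (3 <= d <= k)%N by rewrite dk andbT; lia.
apply: (leq_trans (card_conflicting a d3)).
rewrite mulnCA leq_mul2l mulnCA leq_mul2l -expnD leq_pexp2l ?orbT //; first exact: ltnW.
have h1 : (D.-1 %/ 3 <= (d - 2) %/ 3)%N by apply: leq_div2r; lia.
have h2 : ((d - 2) %/ 3 <= d - 2)%N by apply: leq_div.
lia.
Qed.

End PolyGood.

(** * Cyclic subspaces of random matrices *)

Section Krylov.
Variables (F : finFieldType).
Local Notation q := #|F|.

Definition krylov n (A : 'M[F]_n.+1) k : 'M[F]_(k, n.+1) :=
  \matrix_(i < k) (delta_mx 0 0 *m A ^+ i).

(** k is the dimension of the cyclic subspace of the first basis vector. *)
Definition krylov_dim n (A : 'M[F]_n.+1) k :=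
  row_free (krylov A k) && ((delta_mx 0 0 : 'rV_n.+1) *m A ^+ k <= krylov A k)%MS.

Lemma krylov_row n (A : 'M[F]_n.+1) k i : (i < k)%N ->
  ((delta_mx 0 0 : 'rV_n.+1) *m A ^+ i <= krylov A k)%MS.
Proof. by move=> ik; rewrite -(rowK (fun i : 'I_k => delta_mx 0 0 *m A ^+ i) (Ordinal ik)) row_sub. Qed.

Lemma krylov_rowS n (A : 'M[F]_n.+1) i (v : 'rV[F]_n.+1) :
  v *m A ^+ i *m A = v *m A ^+ i.+1.
Proof. by rewrite exprSr -mulmxE mulmxA. Qed.

Lemma krylov_dim_all n (A : 'M[F]_n.+1) k i : krylov_dim A k ->
  ((delta_mx 0 0 : 'rV_n.+1) *m A ^+ i <= krylov A k)%MS.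
Proof.
case/andP=> _ h.
have st : (krylov A k *m A <= krylov A k)%MS.
  apply/row_subP => j; rewrite row_mul rowK -mulmxA mulmxE -exprSr.
  have := ltn_ord j; rewrite leq_eqVlt => /orP[/eqP ->|jk]; first exact: h.
  exact: krylov_row.
have k0 : (0 < k)%N.
  rewrite lt0n; apply/eqP => k0; move: h; subst k; case/submxP => D; rewrite flatmx0 mulmx0 expr0 mulmx1.
  by move/matrixP/(_ 0 0)/eqP; rewrite !mxE oner_eq0.
elim: i => [|i IH]; first exact: krylov_row.
rewrite exprSr -mulmxE mulmxA; exact: submx_trans (submxMr A IH) st.
Qed.

Lemma krylov_dim_uniq n (A : 'M[F]_n.+1) k k2 :
  krylov_dim A k -> krylov_dim A k2 -> k = k2.
Proof.
wlog le : k k2 / (k <= k2)%N => [H h1 h2|h1 h2].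
  by case/orP: (leq_total k k2) => ?; [exact: H | apply/esym/H].
apply/eqP; rewrite eqn_leq le /=; case/andP: (h2) => /eqP <- _.
apply: (leq_trans (mxrankS (_ : krylov A k2 <= krylov A k)%MS)); last exact: rank_leq_row.
by apply/row_subP => i; rewrite rowK krylov_dim_all.
Qed.

Lemma krylov_dim_exists n (A : 'M[F]_n.+1) : exists2 k', (k' <= n)%N & krylov_dim A k'.+1.
Proof.
have ex : exists k, row_free (krylov A k) by exists 0%N; rewrite /row_free -leqn0 rank_leq_row.
have bd k : row_free (krylov A k) -> (k <= n.+1)%N by move=> /eqP {1}<-; exact: rank_leq_col.
case: (ex_maxnP ex bd) => k fk kmax.
have k0 : (0 < k)%N.
  apply: kmax; rewrite /row_free eqn_leq rank_leq_row lt0n mxrank_eq0.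
  apply/eqP => /matrixP/(_ 0 0)/eqP; rewrite mxE expr0 mulmx1 !mxE oner_eq0 //.
case: k k0 fk kmax => // k' _ fk kmax; exists k'; first exact: bd fk.
rewrite /krylov_dim fk /=.
have nf : ~~ row_free (krylov A k'.+2) by apply/negP => /kmax; rewrite ltnn.
have sub : (krylov A k'.+1 <= krylov A k'.+2)%MS.
  by apply/row_subP => i; rewrite rowK; apply: krylov_row; rewrite ltnS ltnW.
have : (krylov A k'.+2 <= krylov A k'.+1)%MS.
  rewrite -(mxrank_leqif_sup sub).2 (eqP fk) eqn_leq.
  have := rank_leq_row (krylov A k'.+2); rewrite leq_eqVlt => /orP[h|]; first by case/negP: nf.
  by rewrite ltnS => ->; rewrite andbT -{1}(eqP fk) mxrankS.
exact: submx_trans (krylov_row A (ltnSn _)).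
Qed.

End Krylov.

Section Companion.
Variables (F : finFieldType) (k' : nat).
Local Notation k := k'.+1.

(** The companion matrix of [monic_of c], typed with dimension k so that it fits into block matrices
    without casts. *)
Definition comp_mx (c : 'rV[F]_k) : 'M[F]_k :=
  \matrix_(i, j) (if i == ord_max then c 0 j else (i.+1 == j :> nat)%:R).

Lemma char_poly_comp_mx c : char_poly (comp_mx c) = monic_of c.
Proof.
have e : (size (monic_of c)).-1 = k by rewrite size_monic_of.
rewrite -[RHS](companionmxK (monic_monic_of c)).
have -> : comp_mx c = castmx (e, e) (companionmx (monic_of c)).
  apply/matrixP => i j; rewrite castmxE !mxE /= size_monic_of /=.
  rewrite -val_eqE /=; case: eqP => // _.
  rewrite coefB coefXn ltn_eqF // sub0r opprK coef_rVpoly.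
  by case: insubP => [i' _ /val_inj -> //|]; rewrite ltn_ord.
by case: k / e.
Qed.

Lemma trace_comp_mx c : \tr (comp_mx c) = c 0 ord_max.
Proof.
rewrite /mxtrace (bigD1 ord_max) //= mxE eqxx big1 ?addr0 // => i /negPf im.
by rewrite mxE im eqn_leq ltnn.
Qed.

End Companion.

Section Fibers.
Variables (F : finFieldType) (k' m : nat).
Local Notation q := #|F|.
Local Notation k := k'.+1.
Local Notation N := (k + m)%N.
Implicit Types (U : 'M[F]_(k, N)) (W : 'M[F]_(m, N)) (c : 'rV[F]_k) (A : 'M[F]_N).

(** A basis extending the rows of U. The choice depends on U alone, so all matrices with the same
    Krylov basis are described in the same frame. *)
Definition frame U : 'M[F]_N := odflt 1%:M [pick M : 'M[F]_N | (M \in unitmx) && (usubmx M == U)].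

Lemma frameP U : row_free U -> frame U \in unitmx /\ usubmx (frame U) = U.
Proof.
move=> /row_free_completion[M uM MU]; rewrite /frame; case: pickP => [M' /andP[? /eqP]|/(_ M)] //=.
by rewrite uM MU eqxx.
Qed.

(* Block form of a matrix in a basis extending the Krylov basis U: a companion block over arbitrary rows W. *)
Definition assemble U W c : 'M[F]_N :=
  invmx (frame U) *m col_mx (row_mx (comp_mx c) 0) W *m frame U.

Lemma tr_assemble U W c : row_free U -> \tr (assemble U W c) = c 0 ord_max + \tr (rsubmx W).
Proof.
move=> /frameP[uM _]; rewrite /assemble -mulmxA mxtrace_mulC -mulmxA mulmxV // mulmx1.
rewrite -{1}[W]hsubmxK -[col_mx _ _]/(block_mx _ _ _ _) mxtrace_block trace_comp_mx //.
Qed.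

Lemma char_poly_assemble U W c : row_free U ->
  char_poly (assemble U W c) = monic_of c * char_poly (rsubmx W).
Proof.
move=> /frameP[uM _]; rewrite /assemble -{2}(invmxK (frame U)) char_poly_conj ?unitmx_inv //.
rewrite -{1}[W]hsubmxK -[col_mx _ _]/(block_mx _ _ _ _) -char_poly_comp_mx.
rewrite /char_poly /char_poly_mx (map_block_mx polyC) map_mx0.
rewrite (scalar_mx_block k m) opp_block_mx add_block_mx oppr0 addr0.
by rewrite det_lblock.
Qed.

Lemma frame_inv U : row_free U -> U *m invmx (frame U) = row_mx 1%:M 0.
Proof.
move=> /frameP[uM MU]; rewrite -{1}MU mul_usub_mx mulmxV //.
by rewrite (scalar_mx_block k m) block_mxEv col_mxKu.
Qed.

Lemma row_mul_assemble U W c i : row_free U ->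
  row i U *m assemble U W c = row i (comp_mx c) *m U.
Proof.
move=> fU; have [uM MU] := frameP fU.
rewrite -row_mul /assemble !mulmxA frame_inv // mul_row_col mul1mx mul0mx addr0.
rewrite -{1}(vsubmxK (frame U)) MU mul_row_col mul0mx addr0 row_mul //.
Qed.

Lemma assemble_inj U W : row_free U -> injective (assemble U W).
Proof.
move=> fU c c' e; have [uM _] := frameP fU.
have /(row_free_inj fU) : row ord_max (comp_mx c) *m U = row ord_max (comp_mx c') *m U.
  by rewrite -!(row_mul_assemble W) // e.
by move=> /rowP h; apply/rowP => j; have := h j; rewrite !mxE eqxx.
Qed.

Lemma row_comp_mx c (i j : 'I_k) : i.+1 = j :> nat -> row i (comp_mx c) = delta_mx 0 j.
Proof.
move=> ij; apply/rowP => l; rewrite !mxE eqxx /= -val_eqE /=.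
case: eqP => [im|_]; first by have := ltn_ord j; rewrite -ij im ltnn.
by rewrite ij eq_sym.
Qed.

Lemma krylov_assemble U W c : row_free U -> row 0 U = delta_mx 0 0 ->
  krylov (n := k' + m) (assemble U W c) k = U /\ krylov_dim (n := k' + m) (assemble U W c) k.
Proof.
move=> fU U0; set A := assemble U W c.
have step i (ik : (i < k)%N) : delta_mx 0 0 *m (A : 'M_((k' + m).+1)) ^+ i = row (Ordinal ik) U.
  elim: i ik => [|i IH] ik.
    by rewrite expr0 mulmx1 -U0; congr (row _ U); apply: val_inj.
  rewrite exprSr -mulmxE mulmxA (IH (ltnW ik)) row_mul_assemble //.
  by rewrite (@row_comp_mx c _ (Ordinal ik)) // -rowE.
have kU : krylov (n := k' + m) A k = U.
  by apply/row_matrixP => i; rewrite rowK (step _ (ltn_ord i)); congr (row _ U); apply: val_inj.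
split=> //; rewrite /krylov_dim kU fU /=.
rewrite exprSr -mulmxE mulmxA (step k' (ltnSn k')) row_mul_assemble //.
exact: submxMl.
Qed.

Definition lower_rows A : 'M[F]_(m, N) :=
  let M := frame (krylov (n := k' + m) A k) in dsubmx (M *m A *m invmx M).
Definition last_row A : 'rV[F]_k :=
  let U := krylov (n := k' + m) A k in
  lsubmx (row ord_max (usubmx (frame U *m A *m invmx (frame U)))).

Lemma assembleK A : krylov_dim (n := k' + m) A k ->
  A = assemble (krylov (n := k' + m) A k) (lower_rows A) (last_row A).
Proof.
case/andP; rewrite /lower_rows /last_row; set U := krylov _ _ => fU vk.
have [uM MU] := frameP fU; set M := frame U in uM MU *.
set X := M *m A *m invmx M; set c := lsubmx _.
have eX : usubmx X = row_mx (comp_mx c) 0.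
  have rowX i : row i (usubmx X) = row i U *m A *m invmx M.
    by rewrite /X -mulmxA -mul_usub_mx MU mulmxA !row_mul.
  have rU (i : 'I_k) : row i U = delta_mx 0 0 *m (A : 'M_((k' + m).+1)) ^+ i by rewrite rowK.
  apply/row_matrixP => i; rewrite row_row_mx row0.
  have [im|im] := eqVneq i ord_max.
    have r0 : rsubmx (row i (usubmx X)) = 0.
      rewrite rowX rU.
      have -> : (delta_mx 0 0 : 'rV_((k' + m).+1)) *m (A : 'M_((k' + m).+1)) ^+ i *m A =
         (delta_mx 0 0 : 'rV_((k' + m).+1)) *m (A : 'M_((k' + m).+1)) ^+ k by rewrite im; exact: krylov_rowS.
      by case/submxP: vk => D ->; rewrite -mulmxA frame_inv // mul_mx_row mulmx0 row_mxKr.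
    rewrite -[row i (usubmx X)]hsubmxK r0; congr row_mx.
    by rewrite im; apply/rowP => j; rewrite [RHS]mxE [RHS]mxE eqxx.
  have ik : (i.+1 < k)%N.
    by have := ltn_ord i; rewrite [(i < k)%N]leq_eqVlt => /orP[/eqP[h]|//]; case/eqP: im; apply: val_inj.
  have e : row i U *m A = row (Ordinal ik) U by rewrite !rU; exact: krylov_rowS.
  rewrite rowX e.
  by rewrite -row_mul frame_inv // row_row_mx row0 row1 (@row_comp_mx c i (Ordinal ik)).
rewrite /assemble -/M -eX vsubmxK /X !mulmxA mulVmx // mul1mx -mulmxA mulVmx // mulmx1 //.
Qed.

End Fibers.

Lemma card_sl (F : finFieldType) n : (#|sl n.+1 F| * #|F| = #|F| ^ (n.+1 ^ 2))%N.
Proof.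
rewrite -mulnn -(card_mx F n.+1 n.+1) -!cardsT -cardsX; apply/eqP; rewrite eqn_leq; apply/andP; split.
  apply: (@leq_card_inj_set _ _ (fun p : _ * F => p.1 + p.2 *: delta_mx 0 0)) => [[A t] [B u]|p _]; last by rewrite inE.
  move=> /setXP[As _] /setXP[Bs _] /= e; move: As Bs; rewrite !inE => /eqP trA /eqP trB.
  have tr1 : \tr (delta_mx 0 0 : 'M[F]_n.+1) = 1.
    rewrite /mxtrace (bigD1 0) //= big1 ?addr0 ?mxE ?eqxx // => i /negPf i0.
    by rewrite mxE i0.
  have := congr1 mxtrace e; rewrite !linearD !linearZ /= trA trB tr1 !add0r !mulr1 => tu.
  by congr (_, _) => //; move: e; rewrite tu => /addIr.
pose E : 'M[F]_n.+1 := delta_mx 0 0.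
have tr1 : \tr E = 1.
  rewrite /mxtrace (bigD1 0) //= big1 ?addr0 ?mxE ?eqxx // => i /negPf i0.
  by rewrite mxE i0.
apply: (@leq_card_inj_set _ _ (fun A => (A - \tr A *: E, \tr A))) => [A B _ _ [e t]|A _].
  by move: e; rewrite t => /addIr.
by rewrite !inE andbT linearB linearZ /= tr1 mulr1 subrr.
Qed.

Section BadFibers.
Variables (F : finFieldType) (K : closedFieldType) (iota : {rmorphism F -> K}).
Variables (k' m : nat).
Local Notation q := #|F|.
Local Notation k := k'.+1.
Local Notation N := (k + m)%N.
Local Notation n := (k' + m)%N.

Definition krylov_class : {set 'M[F]_n.+1} := [set A in sl n.+1 F | krylov_dim A k].
Definition bad_class D : {set 'M[F]_n.+1} :=
  [set A in krylov_class | ~~ `[< good_matrix iota D A >]].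

Lemma lower_rows_assemble U W c : row_free U -> row 0 U = delta_mx 0 0 ->
  lower_rows (@assemble F k' m U W c) = W.
Proof.
move=> fU U0; have [kU _] := krylov_assemble W c fU U0.
rewrite /lower_rows kU; have [uM _] := frameP fU.
by rewrite /assemble !mulmxA mulmxV // mul1mx mulmxK // col_mxKd.
Qed.

(** The class is partitioned by the Krylov basis U and the lower rows W. In a nonempty part,
    [assemble] identifies the matrices with the vectors c whose trace is minus that of the quotient
    block, so the proportion of bad matrices is that of bad polynomials. *)
Lemma card_bad_class D : (2 <= D <= k')%N ->
  (#|bad_class D| * (k * q ^ k') <=
   (3 * D * q ^ k' + k * (k.+1 * (3 * (N * N * q ^ (k - D.-1 %/ 3))))) * #|krylov_class|)%N.
Proof.
move=> hD; set C := (3 * D * q ^ k' + _)%N.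
pose key (A : 'M[F]_n.+1) : 'M[F]_(k, N) * 'M[F]_(m, N) :=
  (krylov A k, lower_rows (k' := k') (m := m) A).
have part (S : {set 'M[F]_n.+1}) : #|S| = (\sum_p #|[set A in S | key A == p]|)%N.
  rewrite -sum1_card (partition_big key predT) //=; apply: eq_bigr => p _.
  by rewrite -sum1_card; apply: eq_bigl => A; rewrite inE.
rewrite (part (bad_class D)) (part krylov_class) big_distrl big_distrr /=.
apply: leq_sum => -[U W] _.
have [-> | [A0]] := set_0Vmem [set A in bad_class D | key A == (U, W)].
  by rewrite cards0 mul0n.
rewrite !inE => /andP[/andP[/andP[A0s kA0] _] /eqP[eU eW]].
have fU : row_free U by rewrite -eU; case/andP: kA0.
have U0 : row 0 U = delta_mx 0 0 by rewrite -eU rowK expr0 mulmx1.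
pose a := - \tr (rsubmx W); pose H := char_poly (rsubmx W).
have monH : H \is monic := char_poly_monic _.
have sH : size H = m.+1 := size_char_poly _.
have h1 : (#|[set A in bad_class D | key A == (U, W)]| <=
    #|[set c in traced k' a | ~~ `[< poly_good iota H D c >]]|)%N.
  have asm A : A \in [set A in bad_class D | key A == (U, W)] -> A = assemble U W (last_row A).
    rewrite !inE => /andP[/andP[/andP[_ kA] _] /eqP[<- <-]]; exact: assembleK kA.
  apply: (@leq_card_inj_set _ _ (fun A : 'M[F]_n.+1 => last_row (k' := k') (m := m) A)) => [A B AS BS e|A AS].
    by rewrite (asm A AS) (asm B BS) e.
  have eA := asm A AS; move: AS; rewrite !inE => /andP[/andP[/andP[/eqP trA kA] nb] _].
  apply/andP; split.
    by rewrite -subr_eq0 opprK -(tr_assemble W _ fU) -eA; apply/eqP.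
  apply: contra nb => /asboolP[l [rest [ch s3 dl]]]; apply/asboolP; exists l, rest; split=> //.
  by rewrite -ch /H -(char_poly_assemble W _ fU) -eA.
have h2 : (q ^ k' <= #|[set A in krylov_class | key A == (U, W)]|)%N.
  apply: (leq_trans (card_traced_ge k' a)).
  apply: (@leq_card_inj_set _ _ (assemble U W)) => [c c' _ _|c]; first exact: assemble_inj.
  rewrite inE => /eqP ca; have [kU kd] := krylov_assemble W c fU U0.
  rewrite !inE kd (tr_assemble W c fU) ca addNr eqxx /=.
  by rewrite /key kU lower_rows_assemble.
have h3 := card_poly_bad iota monH sH a hD.
rewrite mulnA; apply: leq_mul h2.
by apply: leq_trans h3; rewrite leq_mul2r h1 orbT.
Qed.

Lemma card_krylov_class : (#|krylov_class| <= q ^ (k' * N + m * N + k))%N.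
Proof.
have -> : (q ^ (k' * N + m * N + k) = #|{: 'M[F]_(k', N)}| * #|{: 'M[F]_(m, N)}| * #|{: 'rV[F]_k}|)%N.
  by rewrite !card_mx mul1n !expnD.
rewrite -!cardsT -!cardsX.
(* The first Krylov row is always the first basis vector, so k' rows suffice to record the Krylov
   basis. *)
apply: (@leq_card_inj_set _ _ (fun A : 'M[F]_n.+1 =>
  (\matrix_(i < k') row (lift ord0 i) (krylov A k), lower_rows (k' := k') (m := m) A,
   last_row (k' := k') (m := m) A))) => [A B|A _]; last by rewrite !inE.
move=> hA hB [eU eW ec].
have kA : krylov_dim A k by move: hA; rewrite inE => /andP[].
have kB : krylov_dim B k by move: hB; rewrite inE => /andP[].
have eK : krylov A k = krylov B k.
  apply/row_matrixP => i; case: (unliftP ord0 i) => [j ->|->]; last by rewrite !rowK !expr0.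
  by move/row_matrixP: eU => /(_ j); rewrite !rowK.
exact: etrans (assembleK kA) (etrans (f_equal3 (@assemble F k' m) eK eW ec) (esym (assembleK kB))).
Qed.

End BadFibers.

Section BadTotal.
Variables (F : finFieldType) (K : closedFieldType) (iota : {rmorphism F -> K}).
Variable n : nat.
Local Notation q := #|F|.

Definition kclass k' : {set 'M[F]_n.+1} := [set A in sl n.+1 F | krylov_dim A k'.+1].
Definition bad_kclass D k' : {set 'M[F]_n.+1} :=
  [set A in kclass k' | ~~ `[< good_matrix iota D A >]].
Definition bad_sl D : {set 'M[F]_n.+1} := [set A in sl n.+1 F | ~~ `[< good_matrix iota D A >]].

Lemma card_bad_kclass D k' : (k' <= n)%N -> (2 <= D <= k')%N ->
  (#|bad_kclass D k'| * (k'.+1 * q ^ k') <=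
   (3 * D * q ^ k' + k'.+1 * (k'.+2 * (3 * (n.+1 * n.+1 * q ^ (k'.+1 - D.-1 %/ 3))))) * #|kclass k'|)%N.
Proof.
rewrite /bad_kclass /kclass => kn hD; have [m nE] : exists m, n = (k' + m)%N by exists (n - k')%N; rewrite subnKC.
rewrite nE; exact: card_bad_class.
Qed.

Lemma card_kclass k' : (k' <= n)%N -> (#|kclass k'| <= q ^ (n * n.+1 + k'.+1))%N.
Proof.
rewrite /kclass => kn; have [m nE] : exists m, n = (k' + m)%N by exists (n - k')%N; rewrite subnKC.
rewrite nE; apply: (leq_trans (card_krylov_class F k' m)); rewrite mulnDl //.
Qed.

Lemma sum_kclass : (\sum_(k' < n.+1) #|kclass k'| <= #|sl n.+1 F|)%N.
Proof.
have -> : (\sum_(k' < n.+1) #|kclass k'| = \sum_(k' < n.+1) \sum_(A in sl n.+1 F) krylov_dim A k'.+1)%N.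
  apply: eq_bigr => k' _; rewrite -sum1_card [RHS]big_mkcond [LHS]big_mkcond /=.
  by apply: eq_bigr => A _; rewrite [in LHS]inE; case: (A \in _) => //=; case: krylov_dim.
rewrite exchange_big /= -sum1_card; apply: leq_sum => A _.
case: (pickP (fun k' : 'I_n.+1 => krylov_dim A k'.+1)) => [k0 h0|none]; last first.
  by rewrite big1 // => k' _; rewrite none.
rewrite (bigD1 k0) //= h0 big1 // => k' kk0; apply/eqP; rewrite eqb0.
by apply: contra kk0 => h; have [/val_inj ->] := krylov_dim_uniq h0 h.
Qed.

(** D is the degree threshold and h separates small from large cyclic subspaces. Few matrices have
    k' < h, by [card_kclass] and the last hypothesis. For larger k', smooth polynomials and
    conflicts each contribute a proportion of at most 1/E. This gives 3 = 1 + 2. *)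
Lemma card_bad_sl D E h : (2 <= D <= h)%N -> (h <= n)%N -> (3 * D * E <= h)%N ->
  (n.+2 * (3 * (n.+1 * n.+1)) * q * E <= q ^ (D.-1 %/ 3))%N -> (E * h <= q ^ (n - h))%N ->
  (#|bad_sl D| * E <= 3 * #|sl n.+1 F|)%N.
Proof.
move=> /andP[D2 Dh] hn c1 c2 c3; have q1 := finRing_gt1 F; have q0 : (0 < q)%N := ltnW q1.
have qp x : (0 < q ^ x)%N by rewrite expn_gt0 q0.
have cover : (#|bad_sl D| <= \sum_(k' < n.+1) #|bad_kclass D k'|)%N.
  apply: leq_trans (card_bigcup_leq predT (fun k' : 'I_n.+1 => bad_kclass D k')).
  apply: subset_leq_card; apply/subsetP => A; rewrite inE => /andP[As nA].
  have [k' kn kd] := krylov_dim_exists A.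
  by apply/bigcupP; exists (Ordinal (kn : (k' < n.+1)%N)) => //; rewrite !inE in As *; rewrite As kd nA.
have slE : #|sl n.+1 F| = (q ^ (n * n.+1 + n))%N.
  apply/eqP; rewrite -(eqn_pmul2r q0) card_sl -expnSr; apply/eqP; congr (_ ^ _)%N.
  by rewrite -mulnn; lia.
have small k' : (k' < h)%N -> (#|bad_kclass D k'| <= q ^ (n * n.+1 + h))%N.
  move=> kh; have kn : (k' <= n)%N by lia.
  apply: (leq_trans (subset_leq_card (_ : bad_kclass D k' \subset kclass k'))).
    by apply/subsetP => A; rewrite inE => /andP[].
  apply: (leq_trans (card_kclass kn)); rewrite leq_pexp2l //; lia.
have large k' : (h <= k' <= n)%N -> (#|bad_kclass D k'| * E <= 2 * #|kclass k'|)%N.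
  move=> /andP[hk kn]; have hD : (2 <= D <= k')%N by rewrite D2 (leq_trans Dh).
  have := card_bad_kclass kn hD; set C := (3 * D * q ^ k' + _)%N => hC.
  have T_le : (D.-1 %/ 3 <= k')%N by apply: (leq_trans (leq_div _ _)); lia.
  have CE : (C * E <= 2 * (k'.+1 * q ^ k'))%N.
    rewrite mulnDl mul2n -addnn; apply: leq_add.
      rewrite mulnAC leq_mul2r; apply/orP; right; lia.
    rewrite -!mulnA leq_mul2l /=; rewrite subSn // expnS.
    set t := (D.-1 %/ 3)%N in c2 T_le *.
    have -> : (q ^ k' = q ^ t * q ^ (k' - t))%N by rewrite -expnD subnKC.
    have : (k'.+2 * (3 * (n.+1 * n.+1)) * q * E <= q ^ t)%N.
      by apply: leq_trans c2; rewrite !leq_mul2r ltnS ltnS kn !orbT.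
    move=> c2'; have := leq_mul c2' (leqnn (q ^ (k' - t))%N).
    apply: leq_trans; rewrite leq_eqVlt; apply/orP; left; apply/eqP.
    by set u := (q ^ (k' - t))%N; set k2 := k'.+2; set nn := n.+1; ring.
  have p0 : (0 < k'.+1 * q ^ k')%N by rewrite muln_gt0 qp.
  rewrite -(leq_pmul2r p0) mulnAC.
  apply: (leq_trans (leq_mul hC (leqnn E))).
  by rewrite mulnAC (mulnAC 2) leq_mul2r CE orbT.
apply: (leq_trans (leq_mul cover (leqnn E))).
rewrite big_distrl /=.
apply: (@leq_trans (\sum_(k' < n.+1) ((k' < h) * (q ^ (n * n.+1 + h) * E) + 2 * #|kclass k'|))%N).
  apply: leq_sum => k' _; case: ltnP => hk.
    by rewrite mul1n; apply: leq_trans (leq_addr _ _); rewrite leq_mul2r small ?orbT.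
  by rewrite add0n large // hk -ltnS ltn_ord.
rewrite big_split /= -big_distrl -big_distrr /= (_ : 3 = 1 + 2)%N // mulnDl mul1n.
apply: leq_add; last by rewrite leq_mul2l sum_kclass orbT.
have -> : (\sum_(k' < n.+1) (k' < h) = h)%N.
  rewrite -big_mkcond /= -(big_ord_widen n.+1 (fun _ => 1%N)) ?sum1_card ?card_ord //; lia.
have -> : #|sl n.+1 F| = (q ^ (n * n.+1 + h) * q ^ (n - h))%N.
  by rewrite slE -expnD -addnA subnKC.
by rewrite mulnCA leq_mul2l (mulnC h) c3 orbT.
Qed.

End BadTotal.

(** * Large rank *)

Definition nongenerating (F : finFieldType) n : {set 'M[F]_n * 'M[F]_n} :=
  [set AB in setX (sl n F) (sl n F) | ~~ lie_generate (sl n F) AB.1 AB.2].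

Section LargeRank.
Variables (F : finFieldType) (n : nat).
Local Notation q := #|F|.
Local Notation N := n.+1.

Lemma card_reducible_sl E : (4 * N * (q * q) * E <= q ^ n)%N ->
  (#|[set AB : 'M[F]_N * 'M[F]_N | ~~ `[< irreducible_pair AB.1 AB.2 >]]| * E <= #|sl N F| ^ 2)%N.
Proof.
move=> hE; have qn : (0 < q ^ n)%N by rewrite expn_gt0 (ltnW (finRing_gt1 F)).
have := card_reducible_pairs F N; set X := #|_|; rewrite /= => h.
rewrite -(leq_pmul2r qn) mulnAC; apply: (leq_trans (leq_mul h (leqnn E))).
rewrite mulnC in hE; apply: (@leq_trans (#|sl N F| ^ 2 * (4 * N * (q * q) * E))%N); last first.
  by rewrite leq_mul2l mulnC hE orbT.
by rewrite mul2n -addnn expnD -card_sl -mulnn leq_eqVlt; apply/orP; left; apply/eqP; ring.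
Qed.

(** The constant 6 is 3 for a bad A, 1 for a reducible pair, 1 for a reducible transposed pair and 1
    for the zeros of the cubic form. *)
Lemma card_nongenerating_large D E h : (2 <= D <= h)%N -> (h <= n)%N -> (3 * D * E <= h)%N ->
  (n.+2 * (3 * (N * N)) * q * E <= q ^ (D.-1 %/ 3))%N -> (E * h <= q ^ (n - h))%N ->
  (4 * N * (q * q) * E <= q ^ n)%N -> (q ^ 3 * E <= q ^ D)%N ->
  (#|nongenerating F N| * E <= 6 * #|sl N F| ^ 2)%N.
Proof.
move=> hD hn c1 c2 c3 c4 c5.
have [K [iota _]] := countable_algebraic_closure F.
have q1 := finRing_gt1 F; have q0 : (0 < q)%N := ltnW q1.
have hbad := card_bad_sl iota hD hn c1 c2 c3.
set bad := bad_sl _ _ _ in hbad.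
pose R := [set AB : 'M[F]_N * 'M[F]_N | ~~ `[< irreducible_pair AB.1 AB.2 >]].
pose RT := [set AB : 'M[F]_N * 'M[F]_N | ~~ `[< irreducible_pair AB.1^T AB.2^T >]].
have hR : (#|R| * E <= #|sl N F| ^ 2)%N := card_reducible_sl c4.
have hRT : (#|RT| * E <= #|sl N F| ^ 2)%N.
  apply: leq_trans hR; rewrite leq_mul2r; apply/orP; right.
  apply: (@leq_card_inj_set _ _ (fun p : 'M[F]_N * 'M[F]_N => (p.1^T, p.2^T))) => [[A B] [A' B'] _ _|p].
    by move=> [/trmx_inj -> /trmx_inj ->].
  by rewrite !inE.
pose Z (A : 'M[F]_N) := [set B in sl N F | [&& `[< irreducible_pair A B >],
   `[< irreducible_pair A^T B^T >] & ~~ lie_generate (sl N F) A B]].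
have hZ A : A \in sl N F -> A \notin bad -> (#|Z A| * E <= #|sl N F|)%N.
  move=> As; rewrite inE As /= negbK => /asboolP gA.
  have [l [a [b [x [y [dl a0 _ [xA Ay orth gen]]]]]]] := good_matrix_generate gA As.
  have x0 : x != 0.
    apply/eqP => x0; have := orth ord0 ord0; rewrite eqxx /= x0 /dot mul0mx mxE => /esym/eqP.
    by rewrite oner_eq0.
  have y0 : y != 0.
    apply/eqP => y0; have := orth ord0 ord0; rewrite eqxx /= y0 /dot mulmx0 mxE => /esym/eqP.
    by rewrite oner_eq0.
  have := card_triangle_form_zero dl xA x0 y0 b a0 orth; set Y := [set B | _] => hY.
  have ZY : (#|Z A| <= #|Y|)%N.
    apply: subset_leq_card; apply/subsetP => B; rewrite inE => /andP[Bs /and3P[/asboolP i1 /asboolP i2 ng]].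
    by rewrite inE; apply: contraNT ng => N0; apply: gen.
  have qD : (0 < q ^ D)%N by rewrite expn_gt0 q0.
  rewrite -(leq_pmul2r qD); apply: (@leq_trans (#|Y| * q ^ D * E)%N).
    by rewrite mulnAC !leq_mul2r ZY !orbT.
  apply: (leq_trans (leq_mul hY (leqnn E))).
  rewrite expnD -card_sl; apply: (@leq_trans (#|sl N F| * (q ^ 3 * E))%N); last by rewrite leq_mul2l c5 orbT.
  by rewrite leq_eqVlt; apply/orP; left; apply/eqP; rewrite (expnS q 2); ring.
pose X4 := [set AB : 'M[F]_N * 'M[F]_N | [&& AB.1 \in sl N F, AB.1 \notin bad & AB.2 \in Z AB.1]].
have hX4 : (#|X4| * E <= #|sl N F| ^ 2)%N.
  have -> : #|X4| = (\sum_(A in sl N F) (A \notin bad) * #|Z A|)%N.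
    rewrite -sum1_card (eq_bigl (fun p : _ * _ => ((p.1 \in sl N F) && (p.1 \notin bad)) && (p.2 \in Z p.1))); last first.
      by move=> p; rewrite [in LHS]inE andbA.
    rewrite -(pair_big_dep (fun A => (A \in sl N F) && (A \notin bad)) (fun A B => B \in Z A) (fun _ _ => 1%N)) /=.
    rewrite big_mkcondr /=; apply: eq_bigr => A _; rewrite sum1_card.
    by case: (A \notin bad); rewrite ?mul1n.
  rewrite big_distrl /= -mulnn -sum_nat_const; apply: leq_sum => A As.
  by case: (boolP (A \in bad)) => nA; rewrite ?mul0n // mul1n hZ.
have sub : nongenerating F N \subset (setX bad (sl N F) :|: R) :|: (RT :|: X4).
  apply/subsetP => -[A B]; rewrite inE => /andP[/setXP[As Bs] /= ng].
  rewrite 3!in_setU in_setX Bs andbT.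
  case: (boolP (A \in bad)) => //= nbad; case: (boolP ((A, B) \in R)) => //=.
  rewrite inE negbK /= => i1; case: (boolP ((A, B) \in RT)) => //=.
  rewrite inE negbK /= => i2.
  by rewrite inE /= As nbad inE Bs i1 i2 ng.
apply: (@leq_trans ((#|bad| * #|sl N F| + #|R| + (#|RT| + #|X4|)) * E)%N).
  rewrite leq_mul2r; apply/orP; right; apply: (leq_trans (subset_leq_card sub)).
  apply: (leq_trans (leq_card_setU _ _)); apply: leq_add; last exact: leq_card_setU.
  by apply: (leq_trans (leq_card_setU _ _)); rewrite cardsX.
have hb : (#|bad| * #|sl N F| * E <= 3 * #|sl N F| ^ 2)%N.
  by rewrite mulnAC -mulnn mulnA leq_mul2r hbad orbT.
move: hb hR hRT hX4; rewrite !mulnDl; set s2 := (#|sl N F| ^ 2)%N; lia.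
Qed.

End LargeRank.

(** * Bounded rank *)

Section Words.
Variable n : nat.
Local Notation N := n.+1.

(** Over any commutative ring, so that the words in A0 + t C and B0 + t E can be formed over F[t]
    and then specialized. *)
Fixpoint lie_words (R : comNzRingType) (A B : 'M[R]_N) (k : nat) : seq 'M[R]_N :=
  if k is k'.+1 then
    let w := lie_words A B k' in w ++ [seq X *m Y - Y *m X | X <- w, Y <- w]
  else [:: A; B].

Fixpoint num_words k := if k is k'.+1 then (num_words k' + num_words k' * num_words k')%N else 2%N.

Lemma size_lie_words (R : comNzRingType) (A B : 'M[R]_N) k : size (lie_words A B k) = num_words k.
Proof. by elim: k => //= k IH; rewrite size_cat size_allpairs IH. Qed.

Lemma map_lie_words (R R' : comNzRingType) (f : {rmorphism R -> R'}) (A B : 'M[R]_N) k :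
  map (map_mx f) (lie_words A B k) = lie_words (map_mx f A) (map_mx f B) k.
Proof.
elim: k => //= k IH; rewrite map_cat IH; congr (_ ++ _).
rewrite -{}IH map_allpairs allpairs_mapl allpairs_mapr.
by apply: eq_allpairs => // X Y; rewrite map_mxB !map_mxM.
Qed.

Definition word_mx (R : comNzRingType) (A B : 'M[R]_N) k : 'M[R]_(num_words k, N * N) :=
  \matrix_(i < num_words k) mxvec (nth 0 (lie_words A B k) i).

Lemma map_word_mx (R R' : comNzRingType) (f : {rmorphism R -> R'}) (A B : 'M[R]_N) k :
  map_mx f (word_mx A B k) = word_mx (map_mx f A) (map_mx f B) k.
Proof.
apply/row_matrixP => i; rewrite -map_row !rowK map_mxvec -map_lie_words.
by rewrite (nth_map 0) // size_lie_words.
Qed.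

Definition deg_le (R : idomainType) m m' (d : nat) (M : 'M[{poly R}]_(m, m')) :=
  forall i j, (size (M i j) <= d.+1)%N.

Lemma deg_le_mul (R : idomainType) (d d' : nat) (X Y : 'M[{poly R}]_N) :
  deg_le d X -> deg_le d' Y -> deg_le (d + d') (X *m Y).
Proof.
move=> hX hY i j; rewrite mxE; apply: (leq_trans (size_sum _ _ _)).
apply/bigmax_leqP => l _; apply: (leq_trans (size_polyMleq _ _)).
rewrite -subn1 leq_subLR; apply: (leq_trans (leq_add (hX i l) (hY l j))); lia.
Qed.

Lemma deg_le_words (R : idomainType) (A B : 'M[{poly R}]_N) k X :
  deg_le 1 A -> deg_le 1 B -> X \in lie_words A B k -> deg_le (2 ^ k) X.
Proof.
move=> hA hB; elim: k X => [|k IH] X /=.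
  by rewrite !inE => /orP[] /eqP ->.
rewrite mem_cat => /orP[/IH h i j|].
  by apply: (leq_trans (h i j)); rewrite ltnS leq_exp2l.
case/allpairsP => -[Y Z] /= [/IH hY /IH hZ ->] i j.
rewrite !mxE; apply: (leq_trans (size_polyD _ _)); rewrite size_polyN geq_max.
have e : (2 ^ k.+1 = 2 ^ k + 2 ^ k)%N by rewrite expnS mul2n addnn.
have := deg_le_mul hY hZ i j; have := deg_le_mul hZ hY i j.
by rewrite !mxE e => -> ->.
Qed.

Lemma size_det_le (R : idomainType) r d (M : 'M[{poly R}]_r) :
  deg_le d M -> (size (\det M) <= (r * d).+1)%N.
Proof.
move=> hM; rewrite /determinant; apply: (leq_trans (size_sum _ _ _)).
apply/bigmax_leqP => s _.
have sgn (b : bool) (p : {poly R}) : size ((-1) ^+ b * p) = size p.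
  by case: b; rewrite ?expr1 ?expr0 ?mulN1r ?mul1r ?size_polyN.
rewrite sgn.
apply: (leq_trans (size_poly_prod_leq _ _)).
rewrite leq_subLR card_ord; apply: (@leq_trans (\sum_(i < r) d.+1).+1).
  by rewrite ltnS; apply: leq_sum => i _.
by rewrite sum_nat_const card_ord mulnS addnS.
Qed.

Lemma lie_words_trace (R : comNzRingType) (A B : 'M[R]_N) k X :
  \tr A = 0 -> \tr B = 0 -> X \in lie_words A B k -> \tr X = 0.
Proof.
move=> tA tB; elim: k X => [|k IH] X /=; first by rewrite !inE => /orP[] /eqP ->.
rewrite mem_cat => /orP[/IH //|/allpairsP[[Y Z] /= [_ _ ->]]].
by rewrite linearB /= mxtrace_mulC subrr.
Qed.

Section RankStable.
Variables (F : fieldType) (A B : 'M[F]_N).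

Lemma word_mx_mem k X : X \in lie_words A B k -> (mxvec X <= word_mx A B k)%MS.
Proof.
move=> Xk; have ik : (index X (lie_words A B k) < num_words k)%N.
  by rewrite -(size_lie_words A B) index_mem.
have -> : mxvec X = row (Ordinal ik) (word_mx A B k) by rewrite rowK /= nth_index.
exact: row_sub.
Qed.

Lemma word_mx_sub k : (word_mx A B k <= word_mx A B k.+1)%MS.
Proof.
apply/row_subP => i; rewrite rowK; apply: word_mx_mem => /=.
by rewrite mem_cat mem_nth ?size_lie_words.
Qed.

Lemma word_mx_span k X : (mxvec X <= word_mx A B k)%MS ->
  exists c : 'I_(num_words k) -> F, X = \sum_i c i *: nth 0 (lie_words A B k) i.
Proof.
case/submxP => D eD; exists (D 0); apply: (can_inj mxvecK).
rewrite eD mulmx_sum_row linear_sum; apply: eq_bigr => i _.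
by rewrite linearZ /= rowK.
Qed.

Lemma word_mx_stable k : (word_mx A B k.+1 <= word_mx A B k)%MS ->
  lie_closed (fun X => (mxvec X <= word_mx A B k)%MS).
Proof.
move=> st.
have SD a X Y : (mxvec X <= word_mx A B k)%MS -> (mxvec Y <= word_mx A B k)%MS ->
    (mxvec (a *: X + Y) <= word_mx A B k)%MS.
  by rewrite linearP => SX SY; apply: addmx_sub => //; apply: scalemx_sub.
have S0 : (mxvec (0 : 'M[F]_N) <= word_mx A B k)%MS by rewrite linear0 sub0mx.
have Ssum (I : finType) (f : I -> 'M[F]_N) : (forall i, (mxvec (f i) <= word_mx A B k)%MS) ->
    (mxvec (\sum_i f i) <= word_mx A B k)%MS.
  by move=> Sf; rewrite linear_sum; apply: summx_sub => i _; exact: Sf.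
split=> // X Y /word_mx_span[c ->] /word_mx_span[d ->].
rewrite mulmx_suml mulmx_sumr -sumrB; apply: (Ssum) => i.
rewrite mulmx_sumr mulmx_suml -sumrB; apply: (Ssum) => j.
rewrite -!scalemxAl -!scalemxAr !scalerA mulrC -scalerBr linearZ /=; apply: scalemx_sub.
apply: submx_trans st; apply: word_mx_mem; rewrite /= mem_cat; apply/orP; right.
by apply/allpairsP; exists (nth 0 (lie_words A B k) i, nth 0 (lie_words A B k) j);
  rewrite !mem_nth ?size_lie_words.
Qed.

(** Until it stabilizes, the span of the words gains a dimension at each level, and the dimension is
    at most N^2. The bound on k makes the later degree bound uniform in q. *)
Lemma word_mx_stabilizes : exists2 k, (k <= N * N)%N & (word_mx A B k.+1 <= word_mx A B k)%MS.
Proof.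
apply: contrapT => h.
have inc k : (k <= N * N)%N -> (k < \rank (word_mx A B k.+1))%N.
  elim: k => [|k IH] kN.
    apply: (@leq_ltn_trans (\rank (word_mx A B 0))) => //; apply: rank_ltmx.
    by rewrite ltmxE word_mx_sub; apply/negP => st; apply: h; exists 0%N.
  apply: (leq_ltn_trans (IH (ltnW kN))); apply: rank_ltmx.
  by rewrite ltmxE word_mx_sub; apply/negP => st; apply: h; exists k.+1.
by have := inc (N * N)%N (leqnn _); rewrite ltnNge rank_leq_col.
Qed.

End RankStable.

Section Line.
Variable F : finFieldType.
Local Notation q := #|F|.
Variables (A0 B0 : 'M[F]_N).
Hypotheses (A0s : \tr A0 = 0) (B0s : \tr B0 = 0).
Hypothesis gen0 : forall S : 'M[F]_N -> Prop, lie_closed S -> S A0 -> S B0 ->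
  forall Z, \tr Z = 0 -> S Z.

(** Bounds the degree in t of a minor: at most N^2 rows, with entries of degree at most 2^k for some
    k <= N^2. *)
Definition line_bound := (N * N * 2 ^ (N * N))%N.

Lemma lie_generate_of_word_mx (A B : 'M[F]_N) k : \tr A = 0 -> \tr B = 0 ->
  (forall Z, \tr Z = 0 -> (mxvec Z <= word_mx A B k)%MS) -> lie_generate (sl N F) A B.
Proof.
move=> tA tB H; apply: (lie_generate_closed (iota := idfun)); rewrite ?inE ?tA ?tB //.
move=> S clS SA SB Z /H /word_mx_span[c ->].
have SW X : X \in lie_words A B k -> S X.
  elim: k X {H c} => [|k IH] X /=.
    by rewrite !inE => /orP[] /eqP ->; [move: SA | move: SB]; rewrite map_mx_id.
  rewrite mem_cat => /orP[/IH //|/allpairsP[[Y Y'] /= [/IH h1 /IH h2 ->]]].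
  exact: lie_closed_br.
elim/big_ind: _ => [|X Y|i _]; first by case: clS.
  exact: lie_closedD.
by apply: lie_closedZ => //; apply: SW; rewrite mem_nth ?size_lie_words.
Qed.

(** A maximal minor of the words in (A0, B0) that is nonzero at t = 0 is a nonzero polynomial in t.
    Where it does not vanish, the words span as many dimensions as at t = 0; they have trace zero,
    and the span at t = 0 contains all trace zero matrices, so the two spans agree. *)
Lemma card_line_bad (C E : 'M[F]_N) : \tr C = 0 -> \tr E = 0 ->
  (#|[set t | ~~ lie_generate (sl N F) (A0 + t *: C) (B0 + t *: E)]| <= line_bound)%N.
Proof.
move=> tC tE; have [k kN st] := word_mx_stabilizes A0 B0.
have clS := word_mx_stable st.
have full0 Z : \tr Z = 0 -> (mxvec Z <= word_mx A0 B0 k)%MS.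
  apply: (gen0 clS); apply: word_mx_mem; elim: (k) => [|k' IH] /=;
    by rewrite ?inE ?eqxx ?orbT // mem_cat IH.
set W0 := word_mx A0 B0 k in full0; set r := \rank W0.
have [f [g fg]] : exists (f : 'I_r -> 'I_(num_words k)) (g : 'I_r -> 'I_(N * N)),
    \det (mxsub f g W0) != 0.
  pose W1 := rowsub (maxrankfun W0) W0.
  have fW1 : row_full W1^T.
    by rewrite /row_full mxrank_tr; have := maxrowsub_free W0.
  exists (maxrankfun W0), (fullrankfun fW1).
  have := fullrowsub_unit fW1; rewrite unitmxE unitfE -det_tr.
  by congr (\det _ != 0); apply/matrixP => i j; rewrite !mxE.
pose At : 'M[{poly F}]_N := map_mx polyC A0 + 'X *: map_mx polyC C.
pose Bt : 'M[{poly F}]_N := map_mx polyC B0 + 'X *: map_mx polyC E.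
pose P := \det (mxsub f g (word_mx At Bt k)).
have evl (t : F) (X Y : 'M[F]_N) :
    map_mx (horner_eval t) (map_mx polyC X + 'X *: map_mx polyC Y) = X + t *: Y.
  by apply/matrixP => i j; rewrite !mxE /horner_eval !hornerE.
have Pt t : P.[t] = \det (mxsub f g (word_mx (A0 + t *: C) (B0 + t *: E) k)).
  rewrite -[LHS]/(horner_eval t P) /P -det_map_mx map_mxsub map_word_mx.
  by rewrite !evl.
have P0 : P != 0.
  apply: contra_neq fg => P0; have := Pt 0; rewrite P0 horner0 !scale0r !addr0 => <- //.
have degl (X Y : 'M[F]_N) : deg_le 1 (map_mx polyC X + 'X *: map_mx polyC Y).
  move=> i j; rewrite !mxE; apply: (leq_trans (size_polyD _ _)); rewrite geq_max.
  rewrite (leq_trans (size_polyC_leq1 _)) //= mulrC; apply: (leq_trans (size_polyMleq _ _)).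
  by rewrite size_polyX addn2 /= ltnS size_polyC_leq1.
have sP : (size P <= (r * 2 ^ k).+1)%N.
  apply: size_det_le => i j; 
  have -> : mxsub f g (word_mx At Bt k) i j = mxvec (nth 0 (lie_words At Bt k) (f i)) 0 (g j).
    by rewrite [LHS]mxE [LHS]mxE.
  case/mxvec_indexP: (g j) => a b; rewrite mxvecE.
  apply: (deg_le_words (degl A0 C) (degl B0 E)).
  by rewrite mem_nth // size_lie_words.
have sub : {subset [set t | ~~ lie_generate (sl N F) (A0 + t *: C) (B0 + t *: E)] <= root P}.
  move=> t; rewrite inE; apply: contraR; rewrite -topredE /= rootE Pt => Wt.
  set A := A0 + t *: C in Wt *; set B := B0 + t *: E in Wt *.
  have tA : \tr A = 0 by rewrite linearD linearZ /= A0s tC mulr0 addr0.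
  have tB : \tr B = 0 by rewrite linearD linearZ /= B0s tE mulr0 addr0.
  have W0W : (word_mx A B k <= W0)%MS.
    apply/row_subP => i; rewrite rowK; apply: full0.
    by apply: (lie_words_trace tA tB (k := k)); rewrite mem_nth ?size_lie_words.
  have rW : (r <= \rank (word_mx A B k))%N.
    have e : mxsub f g (word_mx A B k) = rowsub f 1%:M *m word_mx A B k *m colsub g 1%:M.
      by rewrite -rowsubE mulmx_colsub mulmx1; apply/matrixP => i j; rewrite !mxE.
    have <- : \rank (mxsub f g (word_mx A B k)) = r.
      by apply: mxrank_unit; rewrite unitmxE unitfE.
    by rewrite e; apply: (leq_trans (mxrankM_maxl _ _)); apply: mxrankM_maxr.
  apply: (lie_generate_of_word_mx (k := k) tA tB) => Z /full0 ZW; apply: submx_trans ZW _.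
  by rewrite -(mxrank_leqif_sup W0W).2 eqn_leq mxrankS.
rewrite cardE; apply: (@leq_trans (r * 2 ^ k)%N).
  rewrite -ltnS; apply: leq_trans sP; apply: max_poly_roots => //; last exact: enum_uniq.
  by apply/allP => t; rewrite mem_enum => /sub.
by rewrite /line_bound leq_mul ?rank_leq_col // leq_exp2l.
Qed.

Theorem card_nongenerating_line :
  (#|nongenerating F N| * q.-1 <= line_bound * #|sl N F| ^ 2)%N.
Proof.
set X := nongenerating F N; set S2 := setX (sl N F) (sl N F).
pose pt (t : F) (p : 'M[F]_N * 'M[F]_N) := (A0 + t *: p.1, B0 + t *: p.2).
(* For t != 0 the map p -> (A0, B0) + t p permutes the pairs of trace zero matrices, so each such t
   meets the nongenerating pairs equally often. *)
have h1 t : t != 0 -> (#|X| <= #|[set p in S2 | pt t p \in X]|)%N.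
  move=> t0; pose inv (p : 'M[F]_N * 'M[F]_N) := (t^-1 *: (p.1 - A0), t^-1 *: (p.2 - B0)).
  have ptK p : pt t (inv p) = p.
    by case: p => A B; rewrite /pt /inv /= !scalerA mulfV // !scale1r addrC subrK [B0 + _]addrC subrK.
  apply: (@leq_card_inj_set _ _ inv) => [p p' _ _ e|[A B] pX]; first by rewrite -(ptK p) e ptK.
  rewrite inE ptK pX andbT; move: pX; rewrite inE => /andP[/setXP[]]; rewrite !inE => /eqP h /eqP h' _.
  by rewrite /inv /= !linearZ !linearB /= h h' A0s B0s !subrr !mulr0 eqxx.
apply: (@leq_trans (\sum_(t : F | t != 0%R) #|[set p in S2 | pt t p \in X]|)%N).
  apply: (@leq_trans (\sum_(t : F | t != 0%R) #|X|)%N); last by apply: leq_sum => t /h1.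
  by rewrite sum_nat_const mulnC cardC1.
apply: (@leq_trans (\sum_(t : F) \sum_(p in S2) (pt t p \in X))%N).
  rewrite big_mkcond; apply: leq_sum => t _; case: ifP => // _.
  rewrite -sum1_card big_mkcond [X in (_ <= X)%N]big_mkcond; apply: leq_sum => p _.
  by rewrite [in X in (X <= _)%N]inE; case: (p \in S2) => //=; case: (_ \in X).
rewrite exchange_big /= -mulnn -cardsX mulnC -sum_nat_const; apply: leq_sum => -[C E] /setXP[].
rewrite !inE => /eqP tC /eqP tE.
apply: leq_trans (card_line_bad tC tE).
rewrite -sum1_card [X in (_ <= X)%N]big_mkcond; apply: leq_sum => t _.
by case: (boolP (pt t (C, E) \in X)) => // pX; rewrite inE ifT //; move: pX; rewrite inE => /andP[].
Qed.

End Line.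

End Words.

(** * Generating pairs over large fields *)

Lemma avoid_forms (F : finFieldType) (V : lmodType F) (H : V -> Prop) (T : eqType)
    (f : T -> V -> F) (ts : seq T) :
  H 0 -> (forall s u v, H u -> H v -> H (u + s *: v)) ->
  (forall t s u v, f t (u + s *: v) = f t u + s * f t v) ->
  {in ts, forall t, exists2 h, H h & f t h != 0} ->
  (size ts < #|F|)%N -> exists2 v, H v & {in ts, forall t, f t v != 0}.
Proof.
move=> H0 HD fD; elim: ts => [|t ts IH] nz sz; first by exists 0.
have [v Hv fv] : exists2 v, H v & {in ts, forall t, f t v != 0}.
  by apply: IH (ltnW sz) => t' t'in; apply: nz; rewrite inE t'in orbT.
have [w Hw fw] := nz t (mem_head _ _).
(* Each form excludes one value of s on the line v + s w. If it vanishes on w, then it is constant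
   along the line and already nonzero at v; the division by 0 only excludes the value 0
   needlessly. *)
have [s sN] : exists s, s \notin [seq - f t' v / f t' w | t' <- t :: ts].
  apply: contrapT => h; move: sz; rewrite ltnNge => /negP; apply.
  rewrite -(size_map (fun t' => - f t' v / f t' w)) cardE; apply: uniq_leq_size; first exact: enum_uniq.
  by move=> s _; apply: contrapT => /negP sN; apply: h; exists s.
exists (v + s *: w) => [|t' t'in]; first exact: HD.
rewrite fD; have [w0|w0] := eqVneq (f t' w) 0.
  rewrite w0 mulr0 addr0; apply: fv; move: t'in; rewrite inE => /orP[/eqP e|//].
  by rewrite -e w0 eqxx in fw.
apply: contra sN => /eqP e; apply/mapP; exists t' => //.
by apply: (mulIf w0); rewrite mulfVK //; apply/eqP; rewrite -addr_eq0 addrC e.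
Qed.

Section SpreadDiagonal.
Variables (F : finFieldType) (n p : nat).
Local Notation N := n.+1.
Hypotheses (n2 : (2 <= n)%N) (chF : p \in [pchar F]).
Hypotheses (n3p3 : (N, p) <> (3, 3)%N) (n4p2 : (N, p) <> (4, 2)%N).

Definition diff_form (t : ('I_N * 'I_N) * ('I_N * 'I_N)) (a : 'rV[F]_N) : F :=
  a 0 t.1.1 - a 0 t.1.2 - a 0 t.2.1 + a 0 t.2.2.

Definition proper_quad (t : ('I_N * 'I_N) * ('I_N * 'I_N)) :=
  [&& t.1.1 != t.1.2, t.2 != t.1 & t.2 != (t.1.2, t.1.1)].

Let fresh (s : seq 'I_N) : (size s <= n)%N -> exists v, v \notin s.
Proof.
move=> sn; apply: contrapT => h; move: sn; rewrite leqNgt => /negP; apply.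
rewrite -[X in (X <= _)%N](card_ord N) cardE; apply: uniq_leq_size; first exact: enum_uniq.
by move=> v _; apply: contrapT => /negP vN; apply: h; exists v.
Qed.

Let natr_neq0 (k : nat) : prime k -> p != k -> (k%:R : F) != 0.
Proof.
move=> pk pnk; rewrite -(dvdn_pcharf chF); apply: contra pnk.
by rewrite dvdn_prime2 // (pcharf_prime chF).
Qed.

(* A difference form fails to vanish on the trace zero diagonals unless its coefficients
   are all equal, which happens only in the two excluded cases. *)
Lemma diff_form_neq0 t : proper_quad t ->
  exists2 h : 'rV[F]_N, \sum_i h 0 i = 0 & diff_form t h != 0.
Proof.
case: t => -[i j] [k l] /and3P[/= ij ne1 ne2].
have e0 u v : \sum_i0 (delta_mx 0 u - delta_mx 0 v : 'rV[F]_N) 0 i0 = 0.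
  rewrite (eq_bigr (fun i0 => (delta_mx 0 u : 'rV[F]_N) 0 i0 - (delta_mx 0 v : 'rV[F]_N) 0 i0)); last first.
    by move=> i0 _; rewrite !mxE.
  have sd (w : 'I_N) : \sum_i0 (delta_mx 0 w : 'rV[F]_N) 0 i0 = 1.
    rewrite (bigD1 w) //= big1 ?addr0 ?mxE ?eqxx // => i0 /negPf i0w.
    by rewrite mxE i0w andbF.
  by rewrite big_split /= sumrN !sd subrr.
(* The value w u is the coefficient of coordinate u, and the form takes the value w u - w v at the
   trace zero vector e_u - e_v. *)
pose w u : F := (u == i)%:R - (u == j)%:R - (u == k)%:R + (u == l)%:R.
suff [u [v uv]] : exists u v, w u - w v != 0.
  exists (delta_mx 0 u - delta_mx 0 v) => //; move: uv; congr (_ != 0).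
  rewrite /diff_form /w !mxE /= ?eqxx !(eq_sym _ u) !(eq_sym _ v) /=; ring.
have ji : j != i by rewrite eq_sym.
have [kl|kl] := eqVneq k l.
  have [v] := @fresh [:: i; j] n2; rewrite !inE !negb_or => /andP[vi vj].
  exists i, v; rewrite /w kl eqxx (negPf ij) (negPf vi) (negPf vj).
  by rewrite /= (_ : _ - _ = 1) ?oner_eq0 //; ring.
have lk : l != k by rewrite eq_sym.
have [ik|ik] := eqVneq i k.
  have lj : l != j by apply: contra_neq ne1 => ->; rewrite ik.
  have [jl jk] : j != l /\ j != k by rewrite eq_sym -ik.
  exists i, j; rewrite /w !eqxx (negPf ij) (negPf ji) ik eqxx (negPf kl) (negPf jl) (negPf jk).
  by rewrite /= (_ : _ - _ = 1) ?oner_eq0 //; ring.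
have ki : k != i by rewrite eq_sym.
have [jl|jl] := eqVneq j l.
  exists i, j; rewrite /w !eqxx (negPf ij) (negPf ji) jl eqxx (negPf ik) -jl (negPf ij).
  have -> : (j == k) = false by rewrite jl (negPf lk).
  by rewrite /= (_ : _ - _ = 1) ?oner_eq0 //; ring.
have lj : l != j by rewrite eq_sym.
have [il|il] := eqVneq i l.
  have jk : j != k by apply: contra_neq ne2 => ->; rewrite il.
  have [n3|n3] := leqP 3 n.
    have [v] := @fresh [:: i; j; k] n3; rewrite !inE !negb_or => /and3P[vi vj vk].
    exists v, j; rewrite /w -il eqxx (negPf vi) (negPf vj) (negPf vk) (negPf ji) (negPf jk).
    by rewrite /= (_ : _ - _ = 1) ?oner_eq0 //; ring.
  (* Here N = 3 and the coefficients are 2, -1, -1, which agree only modulo 3. *)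
  have p3 : p != 3 by apply/eqP => p3; apply: n3p3; rewrite p3; congr (_.+1, _); apply/eqP; rewrite eqn_leq n2 andbT.
  exists i, j; rewrite /w -il !eqxx (negPf ij) (negPf ji) (negPf ik) (negPf jk).
  by rewrite /= (_ : _ - _ = 3%:R) ?natr_neq0 //; ring.
have li : l != i by rewrite eq_sym.
have [jk|jk] := eqVneq j k.
  have [n3|n3] := leqP 3 n.
    have [v] := @fresh [:: i; j; l] n3; rewrite !inE !negb_or => /and3P[vi vj vl].
    exists i, v; rewrite /w -jk eqxx (negPf vi) (negPf vj) (negPf vl) (negPf ij) (negPf il).
    by rewrite /= (_ : _ - _ = 1) ?oner_eq0 //; ring.
  have p3 : p != 3 by apply/eqP => p3; apply: n3p3; rewrite p3; congr (_.+1, _); apply/eqP; rewrite eqn_leq n2 andbT.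
  exists i, j; rewrite /w -jk !eqxx (negPf ij) (negPf ji) (negPf il) (negPf jl).
  by rewrite /= (_ : _ - _ = 3%:R) ?natr_neq0 //; ring.
have n3 : (3 <= n)%N.
  have : uniq [:: i; j; k; l] by rewrite /= !inE !negb_or ij ik il jk jl kl.
  by move/card_uniqP => /= e; have := max_card (mem [:: i; j; k; l]); rewrite e card_ord.
have [n4|n4] := leqP 4 n.
  have [v] := @fresh [:: i; j; k; l] n4; rewrite !inE !negb_or => /and4P[vi vj vk vl].
  exists i, v; rewrite /w eqxx (negPf vi) (negPf vj) (negPf vk) (negPf vl) (negPf ij) (negPf ik) (negPf il).
  by rewrite /= (_ : _ - _ = 1) ?oner_eq0 //; ring.
(* Here N = 4 and the coefficients are 1, -1, -1, 1, which agree only modulo 2. *)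
have p2 : p != 2 by apply/eqP => p2; apply: n4p2; rewrite p2; congr (_.+1, _); apply/eqP; rewrite eqn_leq n3 andbT.
exists i, j; rewrite /w !eqxx (negPf ij) (negPf ji) (negPf ik) (negPf il) (negPf jk) (negPf jl).
by rewrite /= (_ : _ - _ = 2%:R) ?natr_neq0 //; ring.
Qed.

Lemma spread_diagonal : (N ^ 4 < #|F|)%N -> exists2 a : 'rV[F]_N, \sum_i a 0 i = 0 &
  forall i j k l : 'I_N, i != j -> (k, l) != (i, j) -> (k, l) != (j, i) ->
    a 0 i - a 0 j != a 0 k - a 0 l.
Proof.
move=> qN; pose ts := enum proper_quad.
have [|s u v hu hv|t s u v|t||a Ha fa] := @avoid_forms F 'rV[F]_N (fun a => \sum_i a 0 i = 0)
  _ diff_form ts _ _ _ _ _.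
- by rewrite big1 // => i _; rewrite mxE.
- under eq_bigr do rewrite !mxE.
  by rewrite big_split /= -big_distrr /= hu hv mulr0 addr0.
- by rewrite /diff_form !mxE; ring.
- by rewrite mem_enum => /diff_form_neq0.
- rewrite -cardE; apply: leq_ltn_trans qN; apply: (leq_trans (max_card _)).
  by rewrite !card_prod !card_ord !expnS expn0 muln1 !mulnA.
exists a => // i j k l ij n1 n2'; rewrite -subr_eq0.
have h : ((i, j), (k, l)) \in ts by rewrite mem_enum -topredE /= /proper_quad /= ij n1 n2'.
by have := fa _ h; rewrite /diff_form /= opprB addrA addrAC.
Qed.

End SpreadDiagonal.

Section Witness.
Variables (F : finFieldType) (n : nat).
Local Notation N := n.+1.

Definition generating_pair (A B : 'M[F]_N) := forall S : 'M[F]_N -> Prop,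
  lie_closed S -> S A -> S B -> forall Z, \tr Z = 0 -> S Z.

Lemma subspaceZ (V : lmodType F) (W : V -> Prop) c v : subspace W -> W v -> W (c *: v).
Proof. by case=> W0 WL Wv; rewrite -[_ *: _]addr0; apply: WL. Qed.

Lemma subspace_sum (V : lmodType F) (W : V -> Prop) (I : finType) (f : I -> V) :
  subspace W -> (forall i, W (f i)) -> W (\sum_i f i).
Proof.
case=> W0 WL Wf; elim/big_ind: _ => // u v Wu Wv.
by rewrite -[u]scale1r; apply: WL.
Qed.

(** Applying A - a_i to w for all i != j erases the other coordinates and rescales coordinate j by a
    nonzero factor. *)
Lemma diag_spread_rows (a : 'rV[F]_N) (W : 'rV[F]_N -> Prop) (w : 'rV[F]_N) j :
  (forall i, i != j -> a 0 i != a 0 j) -> subspace W ->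
  (forall v, W v -> W (v *m diag_mx a)) -> W w -> w 0 j != 0 -> W (delta_mx 0 j).
Proof.
move=> inj sW Wd Ww wj.
have main (s : seq 'I_N) : j \notin s -> exists2 v, W v & v 0 j != 0 /\ {in s, forall i, v 0 i = 0}.
  elim: s => [|i s IH]; first by exists w.
  rewrite inE negb_or => /andP[ji /IH[v Wv [vj vs]]].
  exists (v *m diag_mx a - a 0 i *: v).
    by rewrite addrC -scaleNr; case: (sW) => _; apply; [|apply: Wd].
  have e x : (v *m diag_mx a - a 0 i *: v) 0 x = (a 0 x - a 0 i) * v 0 x.
    by rewrite mul_mx_diag !mxE; ring.
  split; first by rewrite e mulf_neq0 // subr_eq0 eq_sym inj // eq_sym.
  by move=> x; rewrite inE e => /orP[/eqP ->|/vs ->]; rewrite ?subrr ?mul0r ?mulr0.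
have [|v Wv [vj vs]] := main (enum (predC1 j)); first by rewrite mem_enum inE eqxx.
have -> : delta_mx 0 j = (v 0 j)^-1 *: v.
  apply/rowP => x; rewrite !mxE /=; have [-> | xj] := eqVneq x j; first by rewrite mulVf.
  have -> : v 0 x = 0 by apply: vs; rewrite mem_enum inE.
  by rewrite mulr0.
exact: subspaceZ.
Qed.

(** B has ones off the diagonal, except for a 0 at position (1, 0). That 0 removes the second term
    of the cubic form, which is therefore nonzero for any nonzero coefficients. Row 2 and column 2
    have no zero off the diagonal, so the basis vector of index 2 is cyclic on both sides. *)
Lemma generating_pair_spread (a : 'rV[F]_N) : (2 <= n)%N -> \sum_i a 0 i = 0 ->
  (forall i j k l : 'I_N, i != j -> (k, l) != (i, j) -> (k, l) != (j, i) ->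
    a 0 i - a 0 j != a 0 k - a 0 l) ->
  exists B : 'M[F]_N, \tr B = 0 /\ generating_pair (diag_mx a) B.
Proof.
move=> n2 a0 spread.
have ordN k : (k < 3)%N -> exists u : 'I_N, u = k :> nat.
  by move=> k3; exists (inord k); rewrite inordK //; lia.
have [[o0 v0] [o1 v1] [o2 v2]] := And3 (ordN 0 isT) (ordN 1 isT) (ordN 2 isT).
pose B : 'M[F]_N := \matrix_(i, j) ((i != j) && ((i, j) != (o1, o0)))%:R.
have BE i j : B i j = ((i != j) && ~~ ((i == o1) && (j == o0)))%:R by rewrite mxE xpair_eqE.
exists B; split; first by rewrite /mxtrace big1 // => i _; rewrite mxE eqxx.
pose A := diag_mx a.
pose L := [seq a 0 i | i <- enum 'I_N].
have sL : size L = N by rewrite size_map size_enum_ord.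
have Ln i (iN : (i < N)%N) : L`_i = a 0 (Ordinal iN).
  rewrite (nth_map ord0) ?size_enum_ord //; congr (a 0 _); apply: val_inj.
  by rewrite /= nth_enum_ord.
have chA : char_poly A = rprod L.
  rewrite char_poly_trig ?diag_mx_is_trig // /rprod /L big_map big_enum /=.
  by apply: eq_bigr => i _; rewrite !mxE eqxx.
have nocf (x y : 'I_N) i j : x != y -> (i < size L)%N -> (j < size L)%N ->
    ~~ conflict_at x y i j L.
  rewrite sL => xy iN jN; apply/negP => /and3P[h1 h2].
  have Lx (z : 'I_N) : L`_z = a 0 z by rewrite (Ln _ (ltn_ord z)); congr (a 0 _); apply: val_inj.
  rewrite (Ln _ iN) (Ln _ jN) !Lx => /eqP e.
  have p1 : (Ordinal iN, Ordinal jN) != (x, y) by apply: contra h1 => /eqP[<- <-].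
  have p2 : (Ordinal iN, Ordinal jN) != (y, x) by apply: contra h2 => /eqP[<- <-].
  by have := spread x y _ _ xy p1 p2; rewrite e eqxx.
have neq_a i j : i != j -> a 0 i != a 0 j.
  move=> ij; have := spread i j i i ij; rewrite !xpair_eqE eqxx (negPf ij) /= => /(_ isT isT).
  by rewrite subrr subr_eq0.
pose o (i : 'I_3) : 'I_N := inord i.
have oE (i : 'I_3) : o i = i :> nat by rewrite inordK //; have := ltn_ord i; lia.
have Lo (i : 'I_3) : L`_i = a 0 (o i).
  have iN : (i < N)%N by have := ltn_ord i; lia.
  by rewrite (Ln _ iN); congr (a 0 _); apply: val_inj; rewrite /= oE.
have o_inj : injective o by move=> i j /(congr1 val) /=; rewrite !oE => /val_inj.
pose i0 : 'I_3 := inord 0; pose i1 : 'I_3 := inord 1; pose i2 : 'I_3 := inord 2.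
have [w0 w1 w2] : [/\ i0 = 0%N :> nat, i1 = 1%N :> nat & i2 = 2%N :> nat] by rewrite !inordK.
have [oo0 oo1 oo2] : [/\ o i0 = o0, o i1 = o1 & o i2 = o2] by split; apply: val_inj; rewrite [LHS]oE ?w0 ?w1 ?w2 ?v0 ?v1 ?v2.
pose l_ (i : 'I_3) := a 0 (o i).
have eL : L = [:: l_ i0, l_ i1, l_ i2 & drop 3 L].
  rewrite -[RHS]/([:: l_ i0; l_ i1; l_ i2] ++ drop 3 L) -{1}(cat_take_drop 3 L).
  congr (_ ++ _); apply: (@eq_from_nth _ 0) => [|i]; rewrite size_takel ?sL //.
  by move=> i3; rewrite nth_take // /l_ -!Lo w0 w1 w2; case: i i3 => [|[|[|]]].
have rest_in r : r \in drop 3 L -> exists2 i, (3 <= i < size L)%N & L`_i = r.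
  move=> rin; exists (3 + index r (drop 3 L))%N; last by rewrite -nth_drop nth_index.
  by rewrite leq_addr /=; have := rin; rewrite -index_mem size_drop; move: (index _ _) (size L) => u v; lia.
have sepL (x y z : 'I_3) : x != y -> z != x -> z != y -> sep (l_ x) (l_ y) (l_ z :: drop 3 L).
  move=> xy zx zy; rewrite /l_ -!Lo.
  have ltL (u : 'I_3) : (u < size L)%N by rewrite sL; have := ltn_ord u; lia.
  apply: sep_of_no_conflict => // [i j iL jL|r].
    by rewrite -(oE x) -(oE y); apply: nocf => //; apply: contra xy => /eqP/o_inj ->.
  rewrite inE => /orP[/eqP ->|/rest_in[i /andP[i3 iL] <-]]; first by exists z.
  by exists i; split=> //; rewrite neq_ltn (leq_trans (ltn_ord _) i3) orbT.
have [n01 n12 n02] : [/\ i0 != i1, i1 != i2 & i0 != i2] by rewrite -!val_eqE /= w0 w1 w2.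
have [n10 n21 n20] : [/\ i1 != i0, i2 != i1 & i2 != i0] by rewrite -!val_eqE /= w0 w1 w2.
have s3 : sep3 (l_ i0) (l_ i1) (l_ i2) (drop 3 L) by rewrite /sep3 !sepL.
pose x_ (i : 'I_3) : 'rV[F]_N := delta_mx 0 (o i); pose y_ (i : 'I_3) : 'cV[F]_N := delta_mx (o i) 0.
have xA i : x_ i *m A = l_ i *: x_ i.
  apply/rowP => j; rewrite mul_mx_diag !mxE /= mulrC.
  by case: eqP => [->|]; rewrite ?mulr0.
have Ay i : A *m y_ i = l_ i *: y_ i.
  apply/colP => j; rewrite mul_diag_mx !mxE /= andbT.
  by case: eqP => [->|]; rewrite ?mulr0.
have xy i : x_ i *m y_ i = 1%:M.
  by rewrite /x_ -rowE; apply/matrixP => u v; rewrite !ord1 !mxE !eqxx.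
have pe : perm_eq L [:: l_ i0, l_ i1, l_ i2 & drop 3 L] by rewrite -eL.
have [c [d [c0 d0 units]]] := matrix_units chA pe s3 xA Ay xy.
have l_inj : injective l_.
  by move=> i j e; apply/o_inj; apply: contra_eq e => /neq_a.
have orth := matrix_units_orth l_inj xA Ay xy.
have corner i j : dot (x_ i) (B *m y_ j) = B (o i) (o j).
  by rewrite /dot /x_ /y_ -colE -rowE !mxE.
move=> S clS SA SB.
have [m01 m12 m02] : [/\ o0 != o1, o1 != o2 & o0 != o2] by rewrite -!val_eqE /= v0 v1 v2.
have [m10 m21 m20] : [/\ o1 != o0, o2 != o1 & o2 != o0] by rewrite -!val_eqE /= v0 v1 v2.
have SE : forall i j, i != j -> S (y_ i *m x_ j).
  apply: units clS SA SB _; rewrite !corner oo0 oo1 oo2.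
  have -> : B o0 o1 = 1 by rewrite BE m01 (negPf m01).
  have -> : B o1 o2 = 1 by rewrite BE m12 (negPf m20) andbF.
  have -> : B o2 o0 = 1 by rewrite BE m20 (negPf m21).
  have -> : B o1 o0 = 0 by rewrite BE !eqxx andbF.
  by rewrite !mulr1 !mul0r mulr0 addr0.
have span_rows (W : 'rV[F]_N -> Prop) (w : 'rV[F]_N) : subspace W ->
    (forall v, W v -> W (v *m A)) -> W (delta_mx 0 o2) -> W w ->
    (forall j, j != o2 -> w 0 j != 0) -> forall v, W v.
  move=> sW WA W2 Ww wj v; rewrite [v]row_sum_delta; apply: subspace_sum => // j.
  apply: subspaceZ => //; have [->|j2] := eqVneq j o2; first exact: W2.
  by apply: (diag_spread_rows (a := a) (w := w)) => //; [move=> i; apply: neq_a | apply: wj].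
apply: (lie_closed_contains_sl clS orth SE).
- move=> W sW WS W0.
  have W2 : W (delta_mx o2 0).
    have := WS _ _ (SE _ _ n20) W0; rewrite -mulmxA.
    have -> : x_ i0 *m y_ ord0 = 1%:M by rewrite -(xy i0); congr (_ *m y_ _); apply: val_inj; rewrite /= w0.
    by rewrite mulmx1 /y_ oo2.
  move=> y; rewrite -[y]trmxK.
  apply: (span_rows (fun v => W v^T) (B *m delta_mx o2 0)^T).
  + by case: sW => W00 WL; split=> [|e u v Wu Wv]; rewrite ?trmx0 // linearP; apply: WL.
  + by move=> v Wv; rewrite trmx_mul tr_diag_mx; apply: WS.
  + by rewrite trmx_delta.
  + by rewrite trmxK; apply: WS.
  + move=> j /negPf j2; rewrite -colE 2!mxE BE j2 (eq_sym o2) (negPf m02) andbF; apply: oner_neq0.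
move=> W sW WS W0.
have W2 : W (delta_mx 0 o2).
  have := WS _ _ (SE _ _ n02) W0; rewrite mulmxA.
  have -> : x_ ord0 *m y_ i0 = 1%:M by rewrite -(xy i0); congr (x_ _ *m _); apply: val_inj; rewrite /= w0.
  by rewrite mul1mx /x_ oo2.
apply: (span_rows W (delta_mx 0 o2 *m B)) => //; try by move=> v; apply: WS.
  exact: WS.
by move=> j /negPf j2; rewrite -rowE mxE BE (eq_sym o2) j2 (negPf m21); apply: oner_neq0.
Qed.

Lemma generating_pair_sl2 : n = 1%N -> exists A B : 'M[F]_N,
  [/\ \tr A = 0, \tr B = 0 & generating_pair A B].
Proof.
move=> n1; rewrite /generating_pair; rewrite n1.
have trd (i j : 'I_2) : i != j -> \tr (delta_mx i j : 'M[F]_2) = 0.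
  move=> /negPf ij; rewrite /mxtrace big1 // => k _; rewrite mxE.
  by case: eqP => //= ->; rewrite ij.
pose X : 'M[F]_2 := delta_mx 0 1; pose Y : 'M[F]_2 := delta_mx 1 0.
exists X, Y; rewrite !trd //; split=> // S clS SA SB Z trZ.
have -> : Z = Z 0 1 *: X + Z 1 0 *: Y + Z 0 0 *: (X *m Y - Y *m X).
  have tr : Z 1 1 = - Z 0 0.
    apply/eqP; rewrite -addr_eq0 addrC -trZ /mxtrace !big_ord_recl big_ord0 addr0.
    by apply/eqP; congr (_ + Z _ _); apply: val_inj.
  have I2 (i : 'I_2) : i = 0 \/ i = 1 by case: i => [[|[|//]] Hi]; [left | right]; apply: val_inj.
  rewrite !mul_delta_mx; apply/matrixP => i j; rewrite !mxE.
  by case: (I2 i) => ->; case: (I2 j) => -> /=; rewrite ?tr; ring.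
by apply: lie_closedD => //; [apply: lie_closedD => //; apply: lie_closedZ
  | apply: lie_closedZ => //; apply: lie_closed_br].
Qed.

End Witness.

Theorem generating_pair_exists (F : finFieldType) n p : (1 <= n)%N -> p \in [pchar F] ->
  (n.+1, p) <> (3, 3)%N -> (n.+1, p) <> (4, 2)%N -> (n.+1 ^ 4 < #|F|)%N ->
  exists A B : 'M[F]_n.+1, [/\ \tr A = 0, \tr B = 0 & generating_pair A B].
Proof.
rewrite leq_eqVlt => /orP[/eqP n1 *|n2 chF h3 h4 qN]; first exact: generating_pair_sl2.
have [a a0 sp] := spread_diagonal n2 chF h3 h4 qN.
have [B [tB gB]] := generating_pair_spread n2 a0 sp.
by exists (diag_mx a), B; rewrite mxtrace_diag.
Qed.

(** * Choice of the constants *)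

Lemma cubic_leq_exp2 C : exists t0, forall t, (t0 <= t -> C * t.+2 ^ 3 <= 2 ^ t)%N.
Proof.
(* With u = t / 4, 2^t contains four factors 2^u: one exceeds 125 C, and three bound (t + 2)^3
   because t + 2 <= 5 2^u. *)
exists (4 * (C * 125))%N => t t0; pose u := (t %/ 4)%N.
have tu : (t.+2 <= 5 * 2 ^ u)%N.
  have : (u < 2 ^ u)%N by apply: ltn_expl.
  rewrite /u; lia.
have Cu : (C * 125 <= 2 ^ u)%N.
  have : (C * 125 <= u)%N by rewrite leq_divRL // mulnC.
  by move=> h; apply: (leq_trans h); apply/ltnW/ltn_expl.
have ut : (2 ^ u * (2 ^ u) ^ 3 <= 2 ^ t)%N.
  by rewrite -expnS -expnM leq_exp2l // /u mulnC; apply: leq_trans (leq_trunc_div t 4); rewrite mulnC.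
apply: leq_trans ut; apply: (@leq_trans (C * (5 * 2 ^ u) ^ 3)); first by rewrite leq_mul2l leq_exp2r // tu orbT.
by rewrite expnMn mulnA leq_mul2r Cu orbT.
Qed.

(* With 2^T exceeding every polynomial in the rank that occurs, D is a multiple of T and
   h a third of the rank. *)
Lemma card_nongenerating_eventually E : (0 < E)%N -> exists n0, forall n (F : finFieldType),
  (n0 <= n)%N -> (#|nongenerating F n.+1| * E <= 6 * #|sl n.+1 F| ^ 2)%N.
Proof.
move=> E0; pose M := (100 * E)%N.
have [t0 t0P] := cubic_leq_exp2 (3 * E * M ^ 3)%N.
exists (M * t0.+1)%N => n F hn; pose T := (n %/ M)%N.
have M0 : (0 < M)%N by rewrite muln_gt0.
have tT : (t0.+1 <= T)%N by rewrite leq_divRL // mulnC.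
have T0 : (0 < T)%N by apply: leq_trans tT.
have nT : (100 * (T * E) <= n)%N.
  by rewrite mulnCA; apply: leq_trunc_div.
have nT2 : (n.+2 <= M * T.+2)%N.
  have : (n < T.+1 * M)%N by apply: ltn_ceil.
  by rewrite !mulSn mulnC (mulnC M); lia.
have big : (n.+2 * (3 * (n.+1 * n.+1)) * E <= 2 ^ T)%N.
  apply: leq_trans (t0P T (ltnW tT)); apply: (@leq_trans (3 * E * n.+2 ^ 3)).
    rewrite (_ : (3 * E * n.+2 ^ 3 = n.+2 * (3 * (n.+2 * n.+2)) * E)%N); last by ring.
    by rewrite !leq_mul.
  by rewrite -[X in (_ <= X)%N]mulnA leq_mul2l -expnMn leq_exp2r // nT2 orbT.
have q2 : (2 <= #|F|)%N := finRing_gt1 F.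
have Tq k : (T <= k)%N -> (2 ^ T <= #|F| ^ k)%N.
  move=> Tk; apply: (@leq_trans (2 ^ k)); first by rewrite leq_exp2l.
  by rewrite leq_exp2r //; apply: leq_trans Tk.
have TE : (T <= T * E)%N by rewrite leq_pmulr.
have ET : (E <= T * E)%N by rewrite leq_pmull.
have nE : (4 * n.+1 * E <= 2 ^ T)%N.
  apply: leq_trans big; rewrite leq_mul2r; apply/orP; right; nia.
have E2 : (E <= 2 ^ T)%N by apply: leq_trans nE; rewrite leq_pmull.
(* This D gives (D - 1) / 3 = T + 1, where the additional 1 absorbs the factor q. The 100 in M makes
   h at least 33 T E, well above 3 D E = 9 T E + 12 E. *)
pose D := (3 * T).+4; pose h := (n %/ 3)%N.
have h33 : (33 * (T * E) <= h)%N by rewrite leq_divRL // mulnC; lia.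
have hn3 : (h * 3 <= n)%N by apply: leq_trunc_div.
apply: (@card_nongenerating_large F n D E h).
- by rewrite /D; lia.
- by lia.
- rewrite (_ : (3 * D * E = 9 * (T * E) + 12 * E)%N); first by lia.
  by rewrite /D; lia.
- have -> : (D.-1 %/ 3 = T.+1)%N by rewrite /D; lia.
  by rewrite mulnAC expnSr leq_mul2r (leq_trans big) ?Tq ?orbT.
- have hh : (h < 2 ^ h)%N by apply: ltn_expl.
  apply: (@leq_trans (2 ^ h * 2 ^ h)); first by rewrite leq_mul //; lia.
  rewrite -expnD; apply: (@leq_trans (2 ^ (n - h))); first by rewrite leq_exp2l //; lia.
  by rewrite leq_exp2r //; lia.
- rewrite (mulnAC _ (_ * _)%N) mulnn -[X in (_ <= _ ^ X)%N](@subnK 2 n); last by lia.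
  by rewrite expnD leq_mul2r (leq_trans nE) ?Tq ?orbT //; lia.
by rewrite (_ : D = 3 + (3 * T).+1)%N // expnD leq_mul2l (leq_trans E2) ?Tq ?orbT //; lia.
Qed.

Lemma prob_two_generate_ge (R : realType) (eps : R) (F : finFieldType) n (a b : nat) :
  (0 < b)%N -> a%:R <= eps * b%:R ->
  (#|nongenerating F n.+1| * b <= a * #|sl n.+1 F| ^ 2)%N ->
  1 - eps <= prob_two_generate R (sl n.+1 F).
Proof.
move=> b0 ab; set g := sl n.+1 F; set X := #|nongenerating _ _| => hX.
have g0 : (0 < #|g|)%N by apply/card_gt0P; exists 0; rewrite inE mxtrace0.
rewrite /prob_two_generate /uniform_prob; set Y := #|_|.
have XY : (Y + X = #|g| ^ 2)%N.
  rewrite -mulnn -cardsX -(cardsID [set AB | lie_generate g AB.1 AB.2] (setX g g)).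
  congr (_ + _)%N; apply: eq_card => AB; first by rewrite !in_set.
  by rewrite in_setD !in_set andbC.
rewrite cardsX mulnn; have gR : 0 < (#|g| ^ 2)%:R :> R by rewrite ltr0n expn_gt0 g0.
rewrite ler_pdivlMr // -XY natrD.
have bR : 0 < b%:R :> R by rewrite ltr0n.
have : X%:R * b%:R <= eps * b%:R * (Y + X)%:R :> R.
  apply: le_trans (ler_wpM2r (ler0n R (Y + X)) ab).
  by rewrite XY -!natrM ler_nat.
rewrite mulrAC ler_pM2r // => h; move: h; rewrite natrD; lra.
Qed.

Theorem theorem1p1 (R : realType) (eps : R) (heps : 0 < eps) :
  exists2 K : R, 0 < K &
    forall (n : nat) (F : finFieldType) (p : nat),
      (0 < n)%N ->
      p \in [pchar F] ->
      (n, p) <> (3, 3)%N ->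
      (n, p) <> (4, 2)%N ->
      K <= #|sl n F|%:R ->
      1 - eps <= prob_two_generate R (sl n F).
Proof.
have large (a : nat) : exists b : nat, a%:R <= eps * b%:R.
  exists (Num.bound (a%:R / eps)); rewrite mulrC -ler_pdivrMr //.
  by apply/ltW/archi_boundP; rewrite divr_ge0 // ltW.
have [E0 E0P] := large 6; pose E := E0.+1.
have [n0 n0P] := @card_nongenerating_eventually E isT.
pose L := (\max_(n < n0) line_bound n)%N.
(* In Q, n0^4 provides room for a diagonal with distinct differences, and b makes [line_bound] at
   most eps (q - 1). *)
have [b bP] := large L; pose Q := (n0 ^ 4 + b.+1)%N.
(* For matrix size at most n0, |sl| <= q^(n0^2), so this bound forces q > Q. The summand 2 also
   rules out size 1, where sl has one element. *)
exists (2 + Q ^ (n0 ^ 2))%:R; first by rewrite ltr0n.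
move=> [//|n] F p _ chF h3 h4; rewrite ler_nat => K.
have [nn0|nn0] := leqP n0 n.
  apply: (prob_two_generate_ge (a := 6) (b := E)) => //; last exact: n0P.
  by apply: le_trans E0P _; rewrite ler_pM2l // ler_nat.
have slq := card_sl F n; have q1 := finRing_gt1 F.
have n1 : (1 <= n)%N.
  rewrite lt0n; apply/eqP => n1; move: slq K; rewrite n1 exp1n expn1 => slq.
  have : (#|sl 1 F| * #|F| = 1 * #|F|)%N by rewrite slq mul1n.
  by move/eqP; rewrite eqn_pmul2r ?(ltnW q1) // => /eqP ->.
have Qq : (Q < #|F|)%N.
  have n20 : (0 < n0 ^ 2)%N by rewrite expn_gt0 (leq_trans _ nn0).
  rewrite -(ltn_exp2r _ _ n20); apply: (@leq_trans #|sl n.+1 F|).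
    by apply: leq_trans K; rewrite add2n.
  apply: (@leq_trans (#|F| ^ (n.+1 ^ 2))); first by rewrite -slq leq_pmulr ?(ltnW q1).
  by rewrite leq_exp2l // leq_exp2r.
have qN : (n.+1 ^ 4 < #|F|)%N.
  by apply: leq_ltn_trans Qq; rewrite /Q; apply: leq_trans (leq_addr _ _); rewrite leq_exp2r.
have [A [B [tA tB gAB]]] := generating_pair_exists n1 chF h3 h4 qN.
apply: (prob_two_generate_ge (a := line_bound n) (b := #|F|.-1)); last exact: card_nongenerating_line tA tB gAB.
  by lia.
apply: (@le_trans _ _ L%:R); first by rewrite ler_nat; apply: (@leq_bigmax_cond _ _ (fun i : 'I_n0 => line_bound i) (Ordinal nn0)).
apply: le_trans bP _; rewrite ler_pM2l // ler_nat; move: Qq; rewrite /Q; lia.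
Qed.
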